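(* Let $k$ be a positive integer, and let $B=\{B_t : t\ge 0\}$ be a fractional Brownian motion in $\mathbb{R}^d$ with Hurst index $H\in(0,1)$ such that $Hd>1$. If $E$ is a fixed, nonempty compact set in $\mathbb{R}^d$ with positive capacity with respect to the function $\phi(s)=s^{-k(d-1/H)}$, then $E$ contains $k$-tuple points of $B$ with positive probability, i.e. $$\mathbb{P}\big(\text{there exist } x\in E \text{ and } 0\le t_1<t_2<\cdots<t_k \text{ with } B_{t_1}=B_{t_2}=\cdots=B_{t_k}=x\big)>0.$$
   Context: Fractional Brownian motion: the one-dimensional fractional Brownian motion of Hurst index $0<H<1$ is a mean zero Gaussian process $\{B_t : t\ge 0\}$ with continuous sample paths and covariance $\mathbb{E}(B_tB_s)=\frac12(|t|^{2H}+|s|^{2H}-|t-s|^{2H})$. The fractional Brownian motion in $\mathbb{R}^d$ of Hurst index $H$ is $B_t=(B_t^1,\dots,B_t^d)$, where $B^1,\dots,B^d$ are i.i.d. copies of the one-dimensional fractional Brownian motion of Hurst index $H$. $k$-tuple point: $x\in\mathbb{R}^d$ is a $k$-tuple point for the path $\omega$ if there are times $t_1<t_2<\cdots<t_k$ (in $[0,\infty)$) such that $x=B_{t_1}(\omega)=\cdots=B_{t_k}(\omega)$. Notation: $|\cdot|$ is the Euclidean norm; $\phi(0)=\infty$ for $\phi(s)=s^{-k(d-1/H)}$. Capacity: for a nonempty Borel set $E\subset\mathbb{R}^d$ and a function $\phi:[0,\infty)\to[0,\infty]$, the capacity of $E$ with respect to $\phi$ is $C_\phi(E)=\big[\inf_\mu\int_E\int_E\phi(|z_1-z_2|)\,\mu(dz_1)\,\mu(dz_2)\big]^{-1}$,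 the infimum being over all probability measures $\mu$ on $E$ (with $1/\infty=0$, $1/0=\infty$). Thus $E$ has positive capacity with respect to $\phi$ if and only if there is a probability measure $\mu$ on $E$ with $\int_E\int_E\phi(|z_1-z_2|)\,\mu(dz_1)\,\mu(dz_2)<\infty$. *)

(* Defs.v *)
From HB Require Import structures.
From mathcomp Require Import all_boot all_order all_algebra.
From mathcomp Require Import all_classical all_reals all_analysis.

Set Implicit Arguments.
Unset Strict Implicit.
Unset Printing Implicit Defensive.

Import Order.TTheory GRing.Theory Num.Theory.
Import numFieldNormedType.Exports.

Local Open Scope classical_set_scope.
Local Open Scope ring_scope.

Section GaussianProcesses.
Context {disp : measure_display} {Omega : measurableType disp} {R : realType}.
Variable P : probability Omega R.

(* The normal law with mean m and standard deviation s. The case s = 0 is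
   treated apart because normal_prob m 0 is the uniform law on [0, 1]. *)
Definition gaussian_law (m s : R) : set R -> \bar R :=
  fun A => if s == 0 then (\d_m A)%E else normal_prob m s A.

Definition gaussian_rv (X : Omega -> R) : Prop :=
  measurable_fun [set: Omega] X /\
  exists m s : R, 0 <= s /\
    forall A : set R, measurable A -> P (X @^-1` A) = gaussian_law m s A.

(* Processes are indexed by R, but only their values at times t >= 0 are ever
   constrained. Joint normality of the finite-dimensional marginals is
   expressed through linear combinations. *)
Definition gaussian_process (X : R -> Omega -> R) : Prop :=
  forall (n : nat) (t a : 'I_n -> R), (forall i, 0 <= t i) ->
    gaussian_rv (fun w => \sum_(i < n) a i * X (t i) w).

Definition fbm1 (H : R) (X : R -> Omega -> R) : Prop :=
  [/\ gaussian_process X,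
      (forall t : R, 0 <= t -> ('E_P[X t])%E = 0%:E),
      (forall t s : R, 0 <= t -> 0 <= s ->
        ('E_P[(fun w => X t w * X s w)%R])%E =
        (2^-1 * (`|t| `^ (2 * H) + `|s| `^ (2 * H) - `|t - s| `^ (2 * H)))%:E) &
      (forall w, {within `[0, +oo[, continuous (fun t : R => X t w)})].

Definition process_sigma_algebra (X : R -> Omega -> R) : set (set Omega) :=
  <<s \bigcup_(t in [set t : R | 0 <= t])
        preimage_set_system [set: Omega] (X t) measurable >>.

Definition mutually_independent (n : nat) (F : 'I_n -> set (set Omega)) : Prop :=
  forall (J : {set 'I_n}) (A : 'I_n -> set Omega),
    (forall i, i \in J -> F i (A i)) ->
    P (\bigcap_(i in [set` J]) A i) = (\prod_(i in J) P (A i))%E.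

(* Any two processes satisfying fbm1 H have the same finite-dimensional laws,
   so the coordinates are identically distributed. *)
Definition fbm (d : nat) (H : R) (B : R -> Omega -> 'rV[R]_d) : Prop :=
  (forall i : 'I_d, fbm1 H (fun t w => B t w 0 i)) /\
  mutually_independent
    (fun i : 'I_d => process_sigma_algebra (fun t w => B t w 0 i)).

End GaussianProcesses.

Definition multiple_point {Omega : Type} {R : realType} {d : nat} (k : nat)
    (B : R -> Omega -> 'rV[R]_d) (w : Omega) (x : 'rV[R]_d) : Prop :=
  exists t : 'I_k -> R,
    [/\ forall i, 0 <= t i,
        forall i j : 'I_k, (i < j)%N -> t i < t j &
        forall i, B (t i) w = x].

Notation borel_rV R d := (g_sigma_algebraType (@open 'rV[R]_d)).

Section Capacity.
Context {R : realType} {d : nat}.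

(* The library norm on 'rV[R]_d is the sup norm. *)
Definition euclidean_norm (x : 'rV[R]_d) : R :=
  Num.sqrt (\sum_(i < d) x 0 i ^+ 2).

Definition energy (phi : R -> \bar R) (E : set 'rV[R]_d)
    (mu : probability (borel_rV R d) R) : \bar R :=
  (\int[mu]_(z1 in E) \int[mu]_(z2 in E)
     phi (euclidean_norm ((z1 : 'rV[R]_d) - (z2 : 'rV[R]_d))))%E.

(* Inversion on \bar R satisfies 0^-1 = +oo and +oo^-1 = 0. *)
Definition capacity (phi : R -> \bar R) (E : set 'rV[R]_d) : \bar R :=
  ((ereal_inf [set energy phi E mu | mu in
      [set mu : probability (borel_rV R d) R | mu E = 1%E]])^-1)%E.

End Capacity.

Definition riesz_kernel {R : realType} (a : R) (s : R) : \bar R :=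
  if s == 0 then +oo%E else (s `^ (- a))%:E.

(* Main.v *)
Require Import Defs.
From mathcomp Require Import all_boot all_order all_algebra.
From mathcomp Require Import all_classical all_reals all_analysis.
From mathcomp Require Import measurable_realfun.
From mathcomp Require Import ring lra.

Set Implicit Arguments.
Unset Strict Implicit.
Unset Printing Implicit Defensive.

Import Order.TTheory GRing.Theory Num.Theory.
Import numFieldNormedType.Exports.

Local Open Scope classical_set_scope.
Local Open Scope ring_scope.

(** The proof is a second moment argument for a smoothed intersection local
    time. Fix [k] unit intervals of times [[tau i, tau i + 1]], far apart on a
    geometric scale, and let [mu] be a probability on [E] of finite energy for
    the kernel [r ^ (- k (d - 1 / H))]; it exists because the capacity is
    positive. For [e > 0] consider the random mass
      [J e = \int mu(dx) \prod_i \int_0^1 e ^ (- d) K ((B (tau i + u) - x) / e) du]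
    with a Gaussian bump [K]. Three facts give the theorem.

    First, the mean of [J e] is bounded below by a positive constant
    ([density_mean_ge]), and its second moment is bounded above by a constant
    times the energy of [mu] ([density_pair_le], [random_mass_square_le]), both
    uniformly in [e]. Secondly, if the pieces of path over the [k] intervals have
    no common point in [E], then [J e] tends to 0 ([random_mass_cvg0]): by
    compactness every point of [E] is at a distance bounded below from one of the
    pieces. Thirdly, variables with bounded second moments and means bounded
    below cannot tend to 0 almost surely ([bounded_second_moment_not_cvg0]).
    Hence a common point exists with positive probability, and it is a [k]-tuple
    point since the intervals are disjoint and ordered. The event is measurable
    because it is a countable union, over rational intervals, of events that
    compactness reduces to countably many conditions
    ([measurable_multiple_point]).

    The moment bounds reduce to one coordinate by independence
    ([Rintegral_prod_indep]) and to the following density estimates. On well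
    separated blocks, the normalised positions [B (t i)] and increments
    [B (s i) - B (t i)] have correlations that are as small as desired
    ([incr_cov_far] and the lemmas after it). For a nearly orthonormal Gaussian
    family the expectation of a product of Gaussian bumps is comparable to what
    it is for independent variables ([Rintegral_prod_bump_ge],
    [Rintegral_prod_bump_le]). This is shown without densities or covariance
    matrices: a bump is an average of characters over a Gaussian frequency, so
    the expectation is an iterated Gaussian integral of the characteristic
    function of the family, which is compared with a Gaussian function of the
    frequency ([bump_transform_approx]). For two points at distance [r] this gives
    the bound [\prod_i min (|s i - t i| ^ (- H d), r ^ (- d))] on the two-point
    expectation ([pair_bound]), and integrating over the times turns every factor
    into a multiple of [r ^ (- (d - 1 / H))]
    ([integral_trunc_power_unit_uniform]). *)

(** * Gaussian integrals on the line *)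

Section gauss.
Context {R : realType}.
Local Notation mu := (@lebesgue_measure R).
Local Notation w := (@normal_pdf R 0 1).
Implicit Types (f h : R -> R).

Lemma normal_pdf1E (b x : R) :
  normal_pdf b 1 x = normal_peak 1 * expR (- (x - b) ^+ 2 / 2).
Proof. by rewrite normal_pdfE ?oner_neq0// /normal_fun expr1n. Qed.

Lemma expR_normal_pdf (b x : R) :
  expR (b * x) * w x = expR (b ^+ 2 / 2) * normal_pdf b 1 x.
Proof.
rewrite !normal_pdf1E mulrCA -expRD [RHS]mulrCA -expRD.
by congr (_ * expR _); field.
Qed.

Lemma integrable_expR_normal_pdf (b : R) :
  mu.-integrable setT (fun x => (expR (b * x) * w x)%:E).
Proof.
under eq_fun do rewrite expR_normal_pdf EFinM.
by apply: integrableZl => //; exact: integrable_normal_pdf.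
Qed.

Lemma Rintegral_normal_pdf (m s : R) : \int[mu]_x normal_pdf m s x = 1.
Proof. by rewrite /Rintegral integral_normal_pdf. Qed.

Lemma Rintegral_expR_normal_pdf (b : R) :
  \int[mu]_x (expR (b * x) * w x) = expR (b ^+ 2 / 2).
Proof.
under eq_Rintegral do rewrite expR_normal_pdf.
rewrite RintegralZl ?Rintegral_normal_pdf ?mulr1//.
exact: integrable_normal_pdf.
Qed.

Lemma expR_norm_le (c x : R) : 0 <= c ->
  expR (c * `|x|) <= expR (c * x) + expR (- c * x).
Proof.
move=> c0; have [x0|x0] := leP 0 x.
  by rewrite ger0_norm// lerDl expR_ge0.
by rewrite ltr0_norm// mulrN mulNr lerDr expR_ge0.
Qed.

Lemma integrable_expR_norm_normal_pdf (c : R) : 0 <= c ->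
  mu.-integrable setT (fun x => (expR (c * `|x|) * w x)%:E).
Proof.
move=> c0.
apply: (@le_integrable _ _ _ mu setT measurableT _
  (fun x => (expR (c * x) * w x)%:E + (expR (- c * x) * w x)%:E)%E).
- apply/measurable_EFinP; apply: measurable_funM.
    apply: measurableT_comp => //; apply: measurable_funM => //.
  exact: measurable_normal_pdf.
- move=> x _; rewrite -EFinD !abse_EFin lee_fin.
  rewrite (@ger0_norm _ (_ * _)) ?mulr_ge0 ?expR_ge0 ?normal_pdf_ge0//.
  rewrite ger0_norm ?addr_ge0 ?mulr_ge0 ?expR_ge0 ?normal_pdf_ge0//.
  by rewrite -mulrDl ler_wpM2r ?normal_pdf_ge0// expR_norm_le.
- have h := integrableD measurableT (integrable_expR_normal_pdf c) (integrable_expR_normal_pdf (- c)).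
  exact: h.
Qed.

Lemma integrable_exp_growth f (c : R) : 0 <= c -> measurable_fun setT f ->
  (forall x, `|f x| <= expR (c * `|x|)) ->
  mu.-integrable setT (fun x => (f x * w x)%:E).
Proof.
move=> c0 mf fc.
apply: (le_integrable measurableT _ _ (integrable_expR_norm_normal_pdf c0)).
- apply/measurable_EFinP; apply: measurable_funM => //.
  exact: measurable_normal_pdf.
- move=> x _; rewrite !abse_EFin lee_fin !normrM ler_wpM2r//.
  by rewrite (ger0_norm (expR_ge0 _)).
Qed.

Lemma norm_le_expR (x : R) : `|x| <= expR `|x|.
Proof. by rewrite (le_trans _ (expR_ge1Dx _))// lerDr. Qed.

(** The moments and the characteristic function of the normal law are all read
    off from derivatives of its tilted integrals; differentiation under the
    integral sign is dominated on a window of length two around [m] because [h]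
    grows at most exponentially. *)
Lemma is_derive_laplace h (m : R) : measurable_fun setT h ->
  (forall x, `|h x| <= expR `|x|) ->
  is_derive m (1 : R) (fun b : R => \int[mu]_x (expR (b * x) * h x * w x))
    (\int[mu]_x (x * (expR (m * x) * h x) * w x)).
Proof.
move=> mh hb.
pose f (b x : R) := expR (b * x) * h x * w x.
have mf (b : R) : measurable_fun setT (fun x : R => expR (b * x) * h x).
  apply: measurable_funM => //.
  by apply: measurableT_comp => //; exact: measurable_funM.
have eb (b x : R) : `|expR (b * x)| <= expR (`|b| * `|x|).
  by rewrite ger0_norm ?expR_ge0// ler_expR -normrM ler_norm.
have df (b x : R) : is_derive b (1 : R) (f ^~ x) (x * (expR (b * x) * h x) * w x).
  have -> : f ^~ x = (fun b => (h x * w x) *: (expR \o (fun c : R => x *: c)) b).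
    by apply/funext => b'; rewrite /f /= /GRing.scale/= (mulrC x b'); ring.
  apply: is_derive_eq.
  by rewrite /GRing.scale/= (mulrC x b); ring.
have mI : `](m - 1), (m + 1)[%classic m by rewrite /= in_itv/=; apply/andP; split; lra.
have bI (b x : R) : `](m - 1), (m + 1)[%classic b -> `|b| * `|x| <= (`|m| + 1) * `|x|.
  rewrite /= in_itv/= => /andP[b1 b2]; rewrite ler_wpM2r//.
  have -> : b = m + (b - m) by ring.
  by rewrite (le_trans (ler_normD _ _))// lerD2l ler_norml; apply/andP; split; lra.
have m2 : 0 <= `|m| + 2 by rewrite addr_ge0.
have m3 : 0 <= `|m| + 3 by rewrite addr_ge0.
have H1 (b : R) : `](m - 1), (m + 1)[%classic b -> mu.-integrable setT (EFin \o f b).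
  move=> bi; apply: (@integrable_exp_growth _ (`|m| + 2)) => //.
  move=> x; rewrite normrM (le_trans (ler_pM _ _ (eb b x) (hb x)))//.
  rewrite -expRD ler_expR (le_trans (lerD (bI b x bi) (lexx _)))//.
  by lra.
have H2 (b y : R) : `](m - 1), (m + 1)[%classic b -> setT y -> derivable (f^~ y) b 1.
  by move=> _ _; have [] := df b y.
pose G (x : R) := expR ((`|m| + 3) * `|x|) * w x.
have G0 (y : R) : 0 <= G y by rewrite mulr_ge0 ?expR_ge0 ?normal_pdf_ge0.
have iG : mu.-integrable setT (EFin \o G) by exact: integrable_expR_norm_normal_pdf.
have Gub (b y : R) : `](m - 1), (m + 1)[%classic b -> setT y -> `|partial1of2 f b y| <= G y.
  move=> bi _; rewrite partial1of2E derive_val.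
  rewrite normrM (ger0_norm (normal_pdf_ge0 _ _ _)) ler_wpM2r ?normal_pdf_ge0//.
  rewrite !normrM.
  apply: (@le_trans _ _ (expR `|y| * (expR (`|b| * `|y|) * expR `|y|))).
    by rewrite ler_pM ?mulr_ge0 ?norm_le_expR// ler_pM.
  rewrite -!expRD ler_expR.
  have := bI b y bi; lra.
split.
  exact: (derivable_under_integral measurableT mI H1 H2 G0 iG Gub).
rewrite -derive1E (differentiation_under_integral measurableT mI H1 H2 G0 iG Gub).
by apply: eq_Rintegral => x _; rewrite partial1of2E derive_val.
Qed.

Lemma is_derive_expR_sqr (b : R) :
  is_derive b (1 : R) (fun c : R => expR (c ^+ 2 / 2)) (b * expR (b ^+ 2 / 2)).
Proof.
have -> : (fun c : R => expR (c ^+ 2 / 2)) = expR \o (fun c : R => 2^-1 *: c ^+ 2).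
  by apply/funext => c; rewrite /= /GRing.scale/= mulrC.
apply: is_derive_eq; rewrite /GRing.scale/= (mulrC 2^-1 (b ^+ 2)).
by field.
Qed.

Lemma Rintegral_id_expR_normal_pdf (b : R) :
  \int[mu]_x (x * expR (b * x) * w x) = b * expR (b ^+ 2 / 2).
Proof.
have mh : measurable_fun (setT : set R) (fun=> 1 : R) by [].
have hb (x : R) : `|1 : R| <= expR `|x| by rewrite normr1 -expR0 ler_expR.
have := is_derive_laplace b mh hb.
under eq_fun do (under eq_Rintegral do rewrite mulr1; rewrite Rintegral_expR_normal_pdf).
move=> D; have := @derive_val _ _ _ _ _ _ _ D.
rewrite (@derive_val _ _ _ _ _ _ _ (is_derive_expR_sqr b)) => ->.
by apply: eq_Rintegral => x _; rewrite mulr1.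
Qed.

Lemma Rintegral_id_normal_pdf : \int[mu]_x (x * w x) = 0.
Proof.
rewrite -[RHS](mul0r (expR (0 ^+ 2 / 2))) -Rintegral_id_expR_normal_pdf.
by apply: eq_Rintegral => x _; rewrite mul0r expR0 mulr1.
Qed.

Lemma Rintegral_sqr_normal_pdf : \int[mu]_x (x ^+ 2 * w x) = 1.
Proof.
have D2 : is_derive (0 : R) (1 : R) (fun b : R => b * expR (b ^+ 2 / 2)) 1.
  have -> : (fun b : R => b * expR (b ^+ 2 / 2)) = (id : R -> R) * (fun b : R => expR (b ^+ 2 / 2)).
    by [].
  have d2 := is_derive_expR_sqr 0.
  apply: is_derive_eq.
  by rewrite scale0r add0r expr0n/= mul0r expR0 scale1r.
have mh : measurable_fun (setT : set R) (fun x : R => x) by [].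
have := is_derive_laplace 0 mh norm_le_expR.
under eq_fun do (under eq_Rintegral do rewrite [expR _ * _]mulrC; rewrite Rintegral_id_expR_normal_pdf).
move=> D; rewrite -[RHS](@derive_val _ _ _ _ _ _ _ D2) (@derive_val _ _ _ _ _ _ _ D).
by apply: eq_Rintegral => x _; rewrite mul0r expR0 mul1r expr2.
Qed.

(** Change of variables for nonnegative integrands only, which is what the
    substitution theorem on the whole line provides; bounded integrands are
    reduced to it below by adding a constant. *)
Lemma integral_normal_pdf_affine f (m s : R) : 0 < s -> continuous f ->
  (forall x, 0 <= f x) ->
  (\int[mu]_x (f x * normal_pdf m s x)%:E =
   \int[mu]_x (f (m + s * x) * w x)%:E)%E.
Proof.
move=> s0 cf f0.
have dF (x : R) : is_derive x (1 : R) (fun x => m + s * x) s.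
  have -> : (fun x => m + s * x) = (fun x : R => m + s *: x) by [].
  by apply: is_derive_eq; rewrite add0r mul1r; exact: mulr1.
have F'E : (fun x => m + s * x)^`()%classic = cst s.
  by apply/funext => x; rewrite derive1E derive_val.
rewrite (increasing_ge0_integration_by_substitutionT (F := fun x => m + s * x)).
- apply: eq_integral => x _; rewrite F'E; congr EFin.
  rewrite /= -mulrA; congr (_ * _).
  rewrite !normal_pdfE ?oner_neq0 ?gt_eqF// /normal_peak /normal_fun.
  rewrite !fctE /= subr0 [m + _]addrC addrK exprMn expr1n mul1r.
  rewrite -mulrnAr sqrtrM ?sqr_ge0// sqrtr_sqr gtr0_norm//.
  have -> : - (s ^+ 2 * x ^+ 2) / (s ^+ 2 *+ 2) = - x ^+ 2 / 2.
    by rewrite -mulr_natr; field; rewrite gt_eqF.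
  rewrite invfM -[RHS]mul1r -(divff (lt0r_neq0 s0)); ring.
- by move=> x y xy; rewrite ltrD2l ltr_pM2l.
- by rewrite F'E => x; exact: cvg_cst.
- by rewrite F'E; exact: is_cvg_cst.
- by rewrite F'E; exact: is_cvg_cst.
- by move=> x; have [] := dF x.
- have -> : (fun x => m + s * x) = ( +%R^~ m) \o ( *%R s).
    by apply/funext => x /=; rewrite addrC.
  apply: cvg_comp; last exact: cvg_addrr_Ny.
  by apply: gt0_cvgMrNy => //; exact: cvg_id.
- have -> : (fun x => m + s * x) = ( +%R^~ m) \o ( *%R s).
    by apply/funext => x /=; rewrite addrC.
  apply: cvg_comp; last exact: cvg_addrr.
  by apply: gt0_cvgMry => //; exact: cvg_id.
- move=> x; apply: cvgM; first exact: cf.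
  by apply: continuous_normal_pdf; rewrite gt_eqF.
- by move=> x; rewrite mulr_ge0 ?normal_pdf_ge0.
Qed.

Lemma integrable_bounded_normal_pdf f (m s : R) (M : R) : measurable_fun setT f ->
  (forall x, `|f x| <= M) ->
  mu.-integrable setT (fun x => (f x * normal_pdf m s x)%:E).
Proof.
move=> mf fM.
apply: (@le_integrable _ _ _ mu setT measurableT _
  (fun x => M%:E * (normal_pdf m s x)%:E)%E).
- apply/measurable_EFinP; apply: measurable_funM => //.
  exact: measurable_normal_pdf.
- move=> x _; rewrite -EFinM !abse_EFin lee_fin !normrM ler_wpM2r//.
  by rewrite (le_trans (fM x))// ler_norm.
- by apply: integrableZl => //; exact: integrable_normal_pdf.
Qed.

Lemma Rintegral_normal_pdf_affine f (m s : R) : 0 < s -> continuous f ->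
  (forall x, `|f x| <= 1) ->
  \int[mu]_x (f x * normal_pdf m s x) = \int[mu]_x (f (m + s * x) * w x).
Proof.
move=> s0 cf f1.
have mf : measurable_fun setT f by exact: continuous_measurable_fun.
have cm : continuous (fun x : R => m + s * x).
  by move=> x; apply: cvgD; [exact: cvg_cst|apply: cvgM; [exact: cvg_cst|exact: cvg_id]].
have cfm : continuous (fun x => f (m + s * x)).
  by move=> x; apply: (continuous_comp (f := fun x => m + s * x)); [exact: cm|exact: cf].
have mfm : measurable_fun setT (fun x => f (m + s * x)).
  exact: continuous_measurable_fun.
have f1m x : `|f (m + s * x)| <= 1 by exact: f1.
have fp x : 0 <= 1 + f x by have := f1 x; rewrite ler_norml => /andP[? ?]; lra.
have cfp : continuous (fun x => 1 + f x).
  by move=> x; apply: cvgD; [exact: cvg_cst|exact: cf].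
have : \int[mu]_x ((1 + f x) * normal_pdf m s x) =
    \int[mu]_x ((1 + f (m + s * x)) * w x).
  by congr fine; exact: (integral_normal_pdf_affine m s0 cfp fp).
under eq_Rintegral do rewrite mulrDl mul1r.
under [in RHS]eq_Rintegral do rewrite mulrDl mul1r.
have iw := @integrable_normal_pdf R 0 1.
have iwm := @integrable_normal_pdf R m s.
have i1 := integrable_bounded_normal_pdf m s mf f1.
have i2 := integrable_bounded_normal_pdf 0 1 mfm f1m.
rewrite (RintegralD measurableT iwm i1) (RintegralD measurableT iw i2).
by rewrite !Rintegral_normal_pdf => /addrI.
Qed.

Let cosw (p x : R) := \int[mu]_t (cos (p + x * t) * w t).
Let sinw (p x : R) := \int[mu]_t (sin (p + x * t) * w t).

Let norm_cos (x : R) : `|cos x| <= 1.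
Proof. by rewrite ler_norml cos_geN1 cos_le1. Qed.
Let norm_sin (x : R) : `|sin x| <= 1.
Proof. by rewrite ler_norml sin_geN1 sin_le1. Qed.

Let affine_cont (p x : R) : continuous (fun t : R => p + x * t).
Proof.
by move=> t; apply: cvgD; [exact: cvg_cst|apply: cvgM; [exact: cvg_cst|exact: cvg_id]].
Qed.

Let cos_cont (p x : R) : continuous (fun t : R => cos (p + x * t)).
Proof.
move=> t; apply: (continuous_comp (f := fun t => p + x * t)); first exact: affine_cont.
exact: continuous_cos.
Qed.

Let sin_cont (p x : R) : continuous (fun t : R => sin (p + x * t)).
Proof.
move=> t; apply: (continuous_comp (f := fun t => p + x * t)); first exact: affine_cont.
exact: continuous_sin.
Qed.

Let icos (p x : R) : mu.-integrable setT (fun t => (cos (p + x * t) * w t)%:E).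
Proof.
apply: (integrable_bounded_normal_pdf _ _ _ (fun t => norm_cos (p + x * t))).
exact: continuous_measurable_fun.
Qed.

Let isin (p x : R) : mu.-integrable setT (fun t => (sin (p + x * t) * w t)%:E).
Proof.
apply: (integrable_bounded_normal_pdf _ _ _ (fun t => norm_sin (p + x * t))).
exact: continuous_measurable_fun.
Qed.

(** Gaussian integration by parts, obtained by differentiating in [b] at 0 the
    translation identity for the density tilted by [expR (b * t)]. *)
Lemma Rintegral_id_sin_normal_pdf (p x : R) :
  \int[mu]_t (t * sin (p + x * t) * w t) = x * \int[mu]_t (cos (p + x * t) * w t).
Proof.
have mh : measurable_fun setT (fun t : R => sin (p + x * t)).
  exact: continuous_measurable_fun.
have hb t : `|sin (p + x * t)| <= expR `|t|.
  by rewrite (le_trans (norm_sin _))// -expR0 ler_expR.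
have E (b : R) : \int[mu]_t (expR (b * t) * sin (p + x * t) * w t) =
    expR (b ^+ 2 / 2) * (sin (x * b) * cosw p x + cos (x * b) * sinw p x).
  under eq_Rintegral do rewrite mulrAC expR_normal_pdf -mulrA.
  rewrite RintegralZl//; last first.
    under eq_fun do rewrite mulrC.
    by apply: (integrable_bounded_normal_pdf _ _ mh (fun t => norm_sin (p + x * t))).
  congr (_ * _).
  under eq_Rintegral do rewrite mulrC.
  rewrite (Rintegral_normal_pdf_affine b (f := fun t => sin (p + x * t)))//.
  rewrite -(RintegralZl _ measurableT (icos p x)) -(RintegralZl _ measurableT (isin p x)).
  have i1 := integrableZl measurableT (sin (x * b)) (icos p x).
  have i2 := integrableZl measurableT (cos (x * b)) (isin p x).
  rewrite -(RintegralD measurableT i1 i2).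
  apply: eq_Rintegral => t _.
  have -> : p + x * (b + 1 * t) = x * b + (p + x * t) by ring.
  by rewrite (sinD (x * b)); ring.
have D1 : is_derive (0 : R) (1 : R) (fun b : R => expR (b ^+ 2 / 2) * (sin (x * b) * cosw p x + cos (x * b) * sinw p x)) (x * cosw p x).
  have d2 := is_derive_expR_sqr 0.
  have -> : (fun b : R => expR (b ^+ 2 / 2) * (sin (x * b) * cosw p x + cos (x * b) * sinw p x)) =
     (fun b : R => expR (b ^+ 2 / 2)) * (fun b => cosw p x *: (sin \o (fun c : R => x *: c)) b + sinw p x *: (cos \o (fun c : R => x *: c)) b).
     apply/funext => b; rewrite !fctE /=; congr (_ * (_ + _)); exact: mulrC.
  apply: is_derive_eq.
  rewrite /= scaler0 sin0 cos0 mul0r scaler0 addr0 expr0n/= mul0r expR0 scale1r oppr0.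
  rewrite mul0r scaler0 addr0 mul1r.
  by rewrite /GRing.scale/= mulr1 mulrC.
have := is_derive_laplace 0 mh hb.
under eq_fun do rewrite E.
move=> D; rewrite -[RHS](@derive_val _ _ _ _ _ _ _ D1) (@derive_val _ _ _ _ _ _ _ D).
by apply: eq_Rintegral => t _; rewrite mul0r expR0 mul1r.
Qed.

(** Integration by parts turns the derivative in the frequency back into the
    function itself. *)
Lemma is_derive_cosw (p x : R) :
  is_derive x (1 : R) (cosw p) (- (x * cosw p x)).
Proof.
pose f (x t : R) := cos (p + x * t) * w t.
have df (b t : R) : is_derive b (1 : R) (f ^~ t) (- (t * sin (p + b * t) * w t)).
  have -> : f ^~ t = (fun b => w t *: (cos \o (fun c : R => p + t *: c)) b).
    by apply/funext => b'; rewrite /f /= /GRing.scale/= (mulrC t b') [LHS]mulrC.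
  apply: is_derive_eq.
  by rewrite /GRing.scale/= (mulrC t b); ring.
have mI : `](x - 1), (x + 1)[%classic x by rewrite /= in_itv/=; apply/andP; split; lra.
have H1 (b : R) : `](x - 1), (x + 1)[%classic b -> mu.-integrable setT (EFin \o f b).
  by move=> _; exact: icos.
have H2 (b y : R) : `](x - 1), (x + 1)[%classic b -> setT y -> derivable (f^~ y) b 1.
  by move=> _ _; have [] := df b y.
pose G (t : R) := expR (1 * `|t|) * w t.
have G0 (y : R) : 0 <= G y by rewrite mulr_ge0 ?expR_ge0 ?normal_pdf_ge0.
have iG : mu.-integrable setT (EFin \o G) by exact: integrable_expR_norm_normal_pdf.
have Gub (b y : R) : `](x - 1), (x + 1)[%classic b -> setT y -> `|partial1of2 f b y| <= G y.
  move=> bi _; rewrite partial1of2E derive_val normrN.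
  rewrite normrM (ger0_norm (normal_pdf_ge0 _ _ _)) ler_wpM2r ?normal_pdf_ge0//.
  by rewrite mul1r normrM -[leRHS]mulr1 ler_pM ?norm_le_expR.
have dI := derivable_under_integral measurableT mI H1 H2 G0 iG Gub.
have D := differentiation_under_integral measurableT mI H1 H2 G0 iG Gub.
split; first exact: dI.
rewrite -derive1E D.
under eq_Rintegral do rewrite partial1of2E derive_val.
rewrite -mulN1r -Rintegral_id_sin_normal_pdf -RintegralZl//.
  by apply: eq_Rintegral => t _; rewrite mulN1r.
apply: (integrable_exp_growth (f := fun t => t * sin (p + x * t)) (c := 1)) => //.
  by apply: measurable_funM => //; exact: continuous_measurable_fun.
by move=> t; rewrite mul1r normrM -[leRHS]mulr1 ler_pM ?norm_le_expR.
Qed.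

(** The characteristic function of the standard normal law solves
    [F' = - x F]. *)
Lemma Rintegral_cos_normal_pdf (p x : R) :
  \int[mu]_t (cos (p + x * t) * w t) = cos p * expR (- x ^+ 2 / 2).
Proof.
have D (y : R) : is_derive y (1 : R) (cosw p * (fun b : R => expR (b ^+ 2 / 2))) 0.
  have d1 := is_derive_cosw p y.
  have d2 := is_derive_expR_sqr y.
  apply: is_derive_eq.
  by rewrite /GRing.scale/=; ring.
have := is_derive_0_is_cst x 0 D.
rewrite !fctE expr0n/= mul0r expR0 mulr1 => h.
have c0 : cosw p 0 = cos p.
  rewrite /cosw; under eq_Rintegral do rewrite mul0r addr0.
  by rewrite RintegralZl ?Rintegral_normal_pdf ?mulr1//; exact: integrable_normal_pdf.
rewrite -c0 -h -/(cosw p x) -mulrA -expRD.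
by rewrite (_ : _ + _ = 0) ?expR0 ?mulr1//; field.
Qed.

(** Completing the square: the tilted density is a multiple of another normal
    density. *)
Lemma expR_quadratic_normal_pdf (b s x : R) : 0 < s ->
  expR (- ((s ^- 2 - 1) / 2 * x ^+ 2 + b * x)) * w x =
  s * expR (b ^+ 2 * s ^+ 2 / 2) * normal_pdf (- (b * s ^+ 2)) s x.
Proof.
move=> s0; rewrite !normal_pdfE ?oner_neq0 ?gt_eqF// /normal_peak /normal_fun.
rewrite expr1n mul1r -mulrnAr sqrtrM ?sqr_ge0// sqrtr_sqr gtr0_norm//.
set q := _ (pi *+ 2); set C := expR (b ^+ 2 * _ / 2); set D := expR (- _ ^+ 2 / (s ^+ 2 *+ 2)).
have -> : s * C * ((s * q)^-1 * D) = s / s * (q^-1 * (C * D)).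
  by rewrite invfM; ring.
rewrite divff ?gt_eqF// mul1r mulrCA -!expRD; congr (_ * expR _).
by rewrite -[_ *+ 2]mulr_natr; field; rewrite gt_eqF.
Qed.

(** A Gaussian integral with a quadratic, a linear and an oscillating factor,
    computed by completing the square; [s ^+ 2] is the variance of the tilted
    law. *)
Lemma Rintegral_cos_quadratic_normal_pdf (p z b s : R) : 0 < s ->
  \int[mu]_x (cos (p + z * x) *
      (expR (- ((s ^- 2 - 1) / 2 * x ^+ 2 + b * x)) * w x)) =
  s * expR (b ^+ 2 * s ^+ 2 / 2) * (cos (p - z * (b * s ^+ 2)) *
    expR (- z ^+ 2 * s ^+ 2 / 2)).
Proof.
move=> s0.
under eq_Rintegral do rewrite expR_quadratic_normal_pdf// mulrCA.
rewrite RintegralZl//; last first.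
  apply: (integrable_bounded_normal_pdf _ _ _ (fun t => norm_cos (p + z * t))).
  exact: continuous_measurable_fun.
congr (_ * _).
rewrite (Rintegral_normal_pdf_affine _ s0 (@cos_cont p z) (fun t => norm_cos _)).
rewrite mulNr -exprMn -Rintegral_cos_normal_pdf.
by apply: eq_Rintegral => x _; congr (cos _ * _); ring.
Qed.

Lemma Rintegral_expR_sqr_normal_pdf (s : R) : 0 < s ->
  \int[mu]_x (expR (- ((s ^- 2 - 1) / 2 * x ^+ 2)) * w x) = s.
Proof.
move=> s0; have := Rintegral_cos_quadratic_normal_pdf 0 0 0 s0.
rewrite [0 ^+ 2]expr0n/= !(oppr0, mul0r, addr0) cos0 expR0 !mulr1 => hs.
rewrite -[RHS]hs; apply: eq_Rintegral => x _.
by rewrite !mul0r !addr0 cos0 mul1r.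
Qed.

Lemma integrable_expR_sqr_normal_pdf (c : R) : 0 <= c ->
  mu.-integrable setT (fun x => (expR (- (c * x ^+ 2)) * w x)%:E).
Proof.
move=> c0; apply: (@integrable_bounded_normal_pdf _ 0 1 1).
  apply: measurableT_comp => //; apply: measurableT_comp => //.
  by apply: measurable_funM => //; exact: measurable_funX.
move=> x; rewrite ger0_norm ?expR_ge0// -[leRHS]expR0 ler_expR oppr_le0.
by rewrite mulr_ge0// sqr_ge0.
Qed.

End gauss.

(** * Integrals against the law of a random variable *)

Section law_density.
Context {R : realType} d1 (T1 : measurableType d1) d2 (T2 : measurableType d2).
Variables (mu1 : {measure set T1 -> \bar R}) (mu2 : {measure set T2 -> \bar R}).
Variables (X : T1 -> R) (Y : T2 -> R) (g1 : T1 -> R) (g2 : T2 -> R).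
Hypotheses (mX : measurable_fun setT X) (mY : measurable_fun setT Y)
  (mg1 : measurable_fun setT g1) (mg2 : measurable_fun setT g2)
  (g10 : forall x, 0 <= g1 x) (g20 : forall x, 0 <= g2 x).
Hypothesis same_law : forall A, measurable A ->
  (\int[mu1]_(x in X @^-1` A) (g1 x)%:E = \int[mu2]_(x in Y @^-1` A) (g2 x)%:E)%E.
Import HBNNSimple.

Lemma integral_nnsfun_law d (T : measurableType d) (mu : {measure set T -> \bar R})
    (Z : T -> R) (g : T -> R) (h : {nnsfun R >-> R}) :
  measurable_fun setT Z -> measurable_fun setT g -> (forall x, 0 <= g x) ->
  (\int[mu]_x ((h (Z x))%:E * (g x)%:E) =
   \sum_(r \in range h) r%:E * \int[mu]_(x in Z @^-1` (h @^-1` [set r])) (g x)%:E)%E.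
Proof.
move=> mZ mg g0.
have mh r : measurable (Z @^-1` (h @^-1` [set r])).
  by rewrite -[X in measurable X]setTI; apply: mZ => //; exact: measurable_sfunP.
transitivity (\int[mu]_x \sum_(r \in range h)
    ((r * \1_(Z @^-1` (h @^-1` [set r])) x)%:E * (g x)%:E))%E.
  apply: eq_integral => x _; rewrite fimfunE -fsumEFin// ge0_mule_fsuml//.
  by move=> r; rewrite nnfun_muleindic_ge0.
rewrite ge0_integral_fsum//; last 2 first.
- move=> r; apply/measurable_EFinP; apply: measurable_funM => //.
  by apply: measurable_funM => //; exact: measurable_indic.
- move=> r x _; apply: mule_ge0; last by rewrite lee_fin.
  by rewrite EFinM; exact: (nnfun_muleindic_ge0 h r (Z x)).
apply: eq_fsbigr => r; rewrite inE => -[y _ <-].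
rewrite (integral_mkcond (Z @^-1` _)) -ge0_integralZl//.
- apply: eq_integral => x _; rewrite epatch_indic EFinM -muleA.
  by congr (_ * _)%E; exact: muleC.
- apply/(measurable_restrictT _ _).1 => //.
  by apply/measurable_EFinP; exact: measurable_funTS.
- by move=> x _; apply: erestrict_ge0 => ? _; rewrite lee_fin.
- by rewrite lee_fin.
Qed.

(** Both weighted measures push forward to the same law, so simple functions
    have the same integrals and monotone convergence does the rest. Carrying
    the weights [g1] and [g2] lets the lemma serve both for a density and for
    the independence argument. *)
Lemma ge0_integral_same_law (f : R -> \bar R) : measurable_fun setT f ->
  (forall x, (0 <= f x)%E) ->
  (\int[mu1]_x (f (X x) * (g1 x)%:E) = \int[mu2]_x (f (Y x) * (g2 x)%:E))%E.
Proof.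
move=> mf f0.
pose f_ := nnsfun_approx measurableT mf.
have L d (T : measurableType d) (mu : {measure set T -> \bar R})
    (Z : T -> R) (g : T -> R) : measurable_fun setT Z ->
    measurable_fun setT g -> (forall x, 0 <= g x) ->
  (\int[mu]_x (f (Z x) * (g x)%:E) = lim (\int[mu]_x ((f_ n (Z x))%:E * (g x)%:E) @[n --> \oo]))%E.
  move=> mZ mg g0; rewrite -monotone_convergence//=.
  - apply: eq_integral => x _; apply/esym/cvg_lim => //=.
    by apply: cvgeZr => //; exact: cvg_nnsfun_approx.
  - move=> n; apply/measurable_EFinP; apply: measurable_funM => //.
    exact: measurableT_comp.
  - by move=> n x _; rewrite mule_ge0// lee_fin.
  - move=> x _ a b ab; apply: lee_wpmul2r; first by rewrite lee_fin.
    by rewrite lee_fin; exact/lefP/nd_nnsfun_approx.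
rewrite !L//; apply: congr_lim; apply/funext => n /=.
rewrite !integral_nnsfun_law//; apply: eq_fsbigr => r _.
by rewrite same_law//; exact: measurable_sfunP.
Qed.

End law_density.

Lemma measurable_cos (R : realType) : measurable_fun setT (@cos R).
Proof. by apply: continuous_measurable_fun; exact: continuous_cos. Qed.

Lemma EFin_Rintegral (R : realType) d (T : measurableType d)
    (mu : {measure set T -> \bar R}) (D : set T) (f : T -> R) :
  measurable D -> mu.-integrable D (EFin \o f) ->
  (\int[mu]_(x in D) (f x)%:E = (\int[mu]_(x in D) f x)%:E)%E.
Proof. by move=> mD fi; rewrite /Rintegral fineK//; exact: integrable_fin_num. Qed.

Lemma bounded_integrable_prob (R : realType) d (T : measurableType d)
    (P : probability T R) (f : T -> R) (C : R) : measurable_fun setT f ->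
  (forall w, `|f w| <= C) -> P.-integrable setT (EFin \o f).
Proof.
move=> mf fC; have i1 : P.-integrable setT (fun=> C%:E) by exact: finite_measure_integrable_cst.
apply: (le_integrable measurableT _ _ i1); first exact/measurable_EFinP.
by move=> w _; rewrite !abse_EFin lee_fin (le_trans (fC w))// ler_norm.
Qed.

Lemma integral_sqr_affine_normal_pdf (R : realType) (a s : R) :
  (\int[lebesgue_measure]_x ((a + s * x) ^+ 2 * normal_pdf 0 1 x)%:E =
   (a ^+ 2 + s ^+ 2)%:E)%E.
Proof.
have iw := @integrable_normal_pdf R 0 1.
have ix : lebesgue_measure.-integrable setT (fun x : R => (x * normal_pdf 0 1 x)%:E).
  apply: (integrable_exp_growth (f := fun x => x) ler01) => // x.
  by rewrite mul1r; exact: norm_le_expR.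
have ix2 : lebesgue_measure.-integrable setT (fun x : R => (x ^+ 2 * normal_pdf 0 1 x)%:E).
  apply: (integrable_exp_growth (f := fun x => x ^+ 2) (c := 2)) => // x.
  by rewrite normrX -[2]/(1 + 1) mulrDl mul1r expRD expr2 ler_pM ?norm_le_expR.
transitivity (\int[lebesgue_measure]_(x in [set: R]) ((a ^+ 2)%:E * (normal_pdf 0 1 x)%:E +
    ((2 * a * s)%:E * (x * normal_pdf 0 1 x)%:E +
     (s ^+ 2)%:E * (x ^+ 2 * normal_pdf 0 1 x)%:E)))%E.
  by apply: eq_integral => x _; rewrite -!EFinM -!EFinD; congr EFin; ring.
have i0 := integrableZl measurableT (a ^+ 2) iw.
have i1 := integrableZl measurableT (2 * a * s) ix.
have i2 := integrableZl measurableT (s ^+ 2) ix2.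
have i12 := integrableD measurableT i1 i2.
rewrite (integralD measurableT i0 i12) (integralD measurableT i1 i2).
rewrite (integralZl measurableT iw) (integralZl measurableT ix) (integralZl measurableT ix2).
rewrite (EFin_Rintegral measurableT iw) (EFin_Rintegral measurableT ix) (EFin_Rintegral measurableT ix2).
rewrite Rintegral_normal_pdf Rintegral_id_normal_pdf Rintegral_sqr_normal_pdf.
by rewrite -!EFinM -!EFinD; congr EFin; ring.
Qed.

Section centered_gaussian.
Context {R : realType} d (T : measurableType d) (P : probability T R).
Local Notation mu := (@lebesgue_measure R).

Lemma ge0_integral_gaussian (Z : T -> R) (m s : R) (f : R -> R) : 0 < s ->
  measurable_fun setT Z ->
  (forall A, measurable A -> P (Z @^-1` A) = normal_prob m s A) ->
  continuous f -> (forall x, 0 <= f x) ->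
  (\int[P]_w (f (Z w))%:E =
   \int[mu]_x (f (m + s * x) * normal_pdf 0 1 x)%:E)%E.
Proof.
move=> s0 mZ lawZ cf f0.
rewrite -integral_normal_pdf_affine//.
have mf : measurable_fun setT f by exact: continuous_measurable_fun.
transitivity (\int[P]_w ((f (Z w))%:E * (cst 1 w)%:E))%E.
  by apply: eq_integral => w _; rewrite mule1.
apply: (@ge0_integral_same_law _ _ _ _ _ P mu Z (fun x => x) (cst 1)
    (normal_pdf m s) _ _ _ _ _ _ _ (EFin \o f)) => //.
- exact: measurable_normal_pdf.
- by move=> x; exact: normal_pdf_ge0.
- move=> A mA; rewrite -[RHS]/(normal_prob m s A) -lawZ//.
  rewrite (integral_cst P _ 1%:E) ?mul1e//.
  by rewrite -[X in measurable X]setTI; exact: mZ.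
- exact/measurable_EFinP.
Qed.

(** Only the law of [Z] is given, with unknown parameters; these are identified
    from the second moments of [Z] and of [Z + 1], which avoids integrating the
    unbounded signed function [Z] against the normal density. *)
Lemma Rintegral_cos_gaussian (Z : T -> R) (v p : R) : gaussian_rv P Z ->
  (\int[P]_w (Z w)%:E = 0)%E -> (\int[P]_w (Z w ^+ 2)%:E = v%:E)%E ->
  \int[P]_w cos (p + Z w) = cos p * expR (- v / 2).
Proof.
move=> [mZ [m [s [s_ge0 lawZ]]]] EZ EZ2.
have iZ2 : P.-integrable setT (fun w => (Z w ^+ 2)%:E).
  apply/integrableP; split; first by apply/measurable_EFinP; exact: measurable_funX.
  under eq_integral do rewrite abse_EFin ger0_norm ?sqr_ge0//.
  by rewrite EZ2 ltry.
have Ec (c : R) : (\int[P]_w c%:E = c%:E)%E.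
  rewrite (integral_cst P measurableT c%:E) -[RHS]mule1; congr (_ * _)%E.
  exact: probability_setT.
have i1 : P.-integrable setT (fun w => (1 : R)%:E).
  by apply: finite_measure_integrable_cst.
have iZ : P.-integrable setT (fun w => (Z w)%:E).
  apply: (@le_integrable _ _ _ P setT measurableT _
    (fun w => (1 : R)%:E + (Z w ^+ 2)%:E)%E).
  - exact/measurable_EFinP.
  - move=> w _; rewrite -EFinD !abse_EFin lee_fin [leRHS]ger0_norm ?addr_ge0 ?sqr_ge0//.
    have := sqr_ge0 (`|Z w| - 1); rewrite sqrrB real_normK ?num_real// expr1n mulr1.
    have := normr_ge0 (Z w); lra.
  - exact: integrableD.
have EZ1 : (\int[P]_w ((Z w + 1) ^+ 2)%:E = (v + 1)%:E)%E.
  transitivity (\int[P]_w ((Z w ^+ 2)%:E + (1%:E + 2%:E * (Z w)%:E)))%E.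
    by apply: eq_integral => w _; rewrite -EFinM -!EFinD; congr EFin; ring.
  have i2 := integrableZl measurableT 2 iZ.
  rewrite integralD//; last exact: integrableD.
  by rewrite integralD// integralZl// EZ EZ2 mule0 Ec adde0 EFinD.
have mpZ : measurable_fun setT (fun w => p + Z w) by exact: measurable_funD.
have mc : measurable_fun setT (fun w => cos (p + Z w)).
  exact: (measurableT_comp (@measurable_cos R) mpZ).
have [s0|s_neq0] := eqVneq s 0.
  have lawZ' A : measurable A -> P (Z @^-1` A) = \d_m A.
    by move=> mA; rewrite lawZ// /gaussian_law s0 eqxx.
  have Zm : {ae P, forall w, Z w = m}.
    exists (Z @^-1` (~` [set m])); split.
    - by rewrite -[X in measurable X]setTI; apply: mZ => //; exact: measurableC.
    - rewrite lawZ'; last exact: measurableC.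
      by rewrite diracE memNset// => /(_ erefl).
    - by move=> w /= h; contradict h.
  have m0 : m = 0.
    have : (\int[P]_w (Z w)%:E = \int[P]_w m%:E)%E.
      apply: ae_eq_integral => //; first exact/measurable_EFinP.
      by apply: filterS Zm => w /= ->.
    by rewrite EZ Ec => -[].
  have v0 : v = 0.
    have : (\int[P]_w (Z w ^+ 2)%:E = \int[P]_w 0%:E)%E.
      apply: ae_eq_integral => //; first by apply/measurable_EFinP; exact: measurable_funX.
      by apply: filterS Zm => w /= ->; rewrite m0 expr0n.
    by rewrite EZ2 Ec => -[].
  rewrite v0 oppr0 mul0r expR0 mulr1 /Rintegral.
  rewrite (_ : (\int[P]_w _ = \int[P]_w (cos p)%:E)%E).
    by rewrite Ec.
  apply: ae_eq_integral => //.
    exact/measurable_EFinP.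
  by apply: filterS Zm => w /= ->; rewrite m0 addr0.
have s_gt0 : 0 < s by rewrite lt_neqAle eq_sym s_neq0.
have lawZ' A : measurable A -> P (Z @^-1` A) = normal_prob m s A.
  by move=> mA; rewrite lawZ// /gaussian_law (negbTE s_neq0).
have I f := @ge0_integral_gaussian Z m s f s_gt0 mZ lawZ'.
have S2 (c : R) : (\int[P]_w ((Z w + c) ^+ 2)%:E = ((m + c) ^+ 2 + s ^+ 2)%:E)%E.
  rewrite (I (fun x => (x + c) ^+ 2)); last 2 first.
  - move=> x; apply: (continuous_comp (f := fun x => x + c) (g := fun y : R => y ^+ 2)).
      by apply: cvgD; [exact: cvg_id|exact: cvg_cst].
    exact: exprn_continuous.
  - by move=> x; exact: sqr_ge0.
  under eq_integral do rewrite -addrA [s * _ + c]addrC addrA.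
  exact: integral_sqr_affine_normal_pdf.
have := S2 1; rewrite EZ1 => -[h1].
have := S2 0; under eq_integral do rewrite addr0; rewrite EZ2 addr0 => -[h2].
have m0 : m = 0 by move: h1; rewrite h2 sqrrD; lra.
have {h1}v2 : v = s ^+ 2 by rewrite h2 m0; ring.
have cc : continuous (fun x : R => 1 + cos (p + x)).
  move=> x; apply: cvgD; first exact: cvg_cst.
  apply: (continuous_comp (f := fun x => p + x)); last exact: continuous_cos.
  by apply: cvgD; [exact: cvg_cst|exact: cvg_id].
have c_ge0 (x : R) : 0 <= 1 + cos (p + x) by have := cos_geN1 (p + x); lra.
have nc (x : R) : `|cos x| <= 1 by rewrite ler_norml cos_geN1 cos_le1.
have ic : P.-integrable setT (fun w => (cos (p + Z w))%:E).
  apply: (@le_integrable _ _ _ P setT measurableT _ (fun w => (1 : R)%:E)) => //.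
    exact/measurable_EFinP.
  by move=> w _; rewrite !abse_EFin lee_fin normr1.
have iw := @integrable_normal_pdf R 0 1.
have icw : mu.-integrable setT (fun x => (cos (p + (m + s * x)) * normal_pdf 0 1 x)%:E).
  apply: (@integrable_bounded_normal_pdf _ (fun x => cos (p + (m + s * x))) 0 1 1) => //.
  apply: continuous_measurable_fun => x.
  apply: (continuous_comp (f := fun x => p + (m + s * x))); last exact: continuous_cos.
  apply: cvgD; first exact: cvg_cst; apply: cvgD; first exact: cvg_cst.
  by apply: cvgM; [exact: cvg_cst|exact: cvg_id].
have : \int[P]_w (1 + cos (p + Z w)) =
    \int[mu]_x ((1 + cos (p + (m + s * x))) * normal_pdf 0 1 x).
  by congr fine; exact: (I _ cc c_ge0).
under [in RHS]eq_Rintegral do rewrite mulrDl mul1r.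
rewrite RintegralD// RintegralD//.
rewrite Rintegral_normal_pdf {1}/Rintegral Ec => /addrI ->.
rewrite v2 -Rintegral_cos_normal_pdf; apply: eq_Rintegral => x _.
by rewrite m0 add0r.
Qed.
End centered_gaussian.

(** * Fourier transforms of products of Gaussian bumps *)

Section fubini_cos.
Context {R : realType} d (T : measurableType d) (P : probability T R).
Local Notation mu := (@lebesgue_measure R).
Local Notation g := (@normal_pdf R 0 1).
Variables (A X B : T -> R).
Hypotheses (mA : measurable_fun setT A) (mX : measurable_fun setT X)
  (mB : measurable_fun setT B) (B1 : forall w, `|B w| <= 1).

Let F (z : T * R) := cos (A z.1 + X z.1 * z.2) * B z.1 * g z.2.

Let norm_cos (x : R) : `|cos x| <= 1.
Proof. by rewrite ler_norml cos_geN1 cos_le1. Qed.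

Let mF : measurable_fun setT F.
Proof.
apply: measurable_funM; last first.
  by apply: measurableT_comp => //; exact: measurable_normal_pdf.
apply: measurable_funM; last by apply: measurableT_comp.
apply: (measurableT_comp (@measurable_cos R)).
apply: measurable_funD; first exact: measurableT_comp.
by apply: measurable_funM => //; exact: measurableT_comp.
Qed.

Let cosB1 w t : `|cos (A w + X w * t) * B w| <= 1.
Proof. by rewrite normrM -[leRHS]mulr1 ler_pM. Qed.

Let iF : (P \x mu)%E.-integrable setT (EFin \o F).
Proof.
apply/integrable12ltyP; first exact/measurable_EFinP.
apply: (@le_lt_trans _ _ (\int[P]_w \int[mu]_t (g t)%:E)%E).
  apply: ge0_le_integral => //.
  - by move=> w _; apply: integral_ge0.
  - have mF' : measurable_fun setT (fun z : T * R => (`|(F z)%:E|)%E).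
      by apply: measurableT_comp => //; exact/measurable_EFinP.
    by apply: (@measurable_fun_fubini_tonelli_F _ _ _ _ _ mu (fun z => `|(F z)%:E|%E)).
  - move=> w _; apply: ge0_le_integral => //.
    + apply: measurableT_comp => //; apply/measurable_EFinP.
      exact: (measurableT_comp mF (@measurable_pair1 _ _ _ _ w)).
    + by apply/measurable_EFinP; exact: measurable_normal_pdf.
    + move=> t _; rewrite /= lee_fin normrM (ger0_norm (normal_pdf_ge0 _ _ _)).
      by rewrite ler_piMl ?normal_pdf_ge0.
under eq_integral do rewrite integral_normal_pdf.
by rewrite integral_cst// mul1e; exact: (le_lt_trans (probability_le1 P measurableT) (ltry _)).
Qed.

Let inner1 w : (\int[mu]_t (F (w, t))%:E)%E =
  (cos (A w) * (expR (- X w ^+ 2 / 2) * B w))%:E.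
Proof.
rewrite EFin_Rintegral//; last first.
  apply: (@integrable_bounded_normal_pdf _ (fun t => cos (A w + X w * t) * B w) 0 1 1) => //.
  apply: measurable_funM => //.
  apply: (measurableT_comp (@measurable_cos R)).
  by apply: measurable_funD => //; exact: measurable_funM.
congr EFin.
have -> : \int[mu]_t F (w, t) = \int[mu]_t (B w * (cos (A w + X w * t) * g t)).
  by apply: eq_Rintegral => t _; rewrite /F/=; ring.
rewrite RintegralZl//; last first.
  apply: (@integrable_bounded_normal_pdf _ (fun t => cos (A w + X w * t)) 0 1 1) => //.
  apply: (measurableT_comp (@measurable_cos R)).
  by apply: measurable_funD => //; exact: measurable_funM.
by rewrite Rintegral_cos_normal_pdf; ring.
Qed.

Let inner2 t : (\int[P]_w (F (w, t))%:E)%E =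
  ((\int[P]_w (cos (A w + X w * t) * B w)) * g t)%:E.
Proof.
have mc : measurable_fun setT (fun w => cos (A w + X w * t) * B w).
  apply: measurable_funM => //.
  apply: (measurableT_comp (@measurable_cos R)).
  by apply: measurable_funD => //; exact: measurable_funM.
have ic : P.-integrable setT (fun w => (cos (A w + X w * t) * B w)%:E).
  apply: (@le_integrable _ _ _ P setT measurableT _ (fun w => (1 : R)%:E)) => //.
  - exact/measurable_EFinP.
  - by move=> w _; rewrite !abse_EFin lee_fin normr1.
  - exact: finite_measure_integrable_cst.
rewrite mulrC -RintegralZl// -EFin_Rintegral//.
  by apply: eq_integral => w _; rewrite /F/= mulrC.
by apply: (integrableZl measurableT (g t) ic).
Qed.

(** A Gaussian bump is the characteristic function of a standard normal
    frequency, so that multiplying by it amounts to averaging the phase over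
    that frequency. *)
Lemma Rintegral_cos_bump :
  \int[P]_w (cos (A w) * (expR (- X w ^+ 2 / 2) * B w)) =
  \int[mu]_t ((\int[P]_w (cos (A w + X w * t) * B w)) * g t).
Proof.
congr fine.
under eq_integral do rewrite -inner1.
rewrite (Fubini iF); apply: eq_integral => t _; exact: inner2.
Qed.

Lemma integrable_cos_bump : mu.-integrable setT
  (fun t => ((\int[P]_w (cos (A w + X w * t) * B w)) * g t)%:E).
Proof.
apply: (@le_integrable _ _ _ mu setT measurableT _ (fun t => (g t)%:E)).
- have := measurable_fubini_G iF.
  by congr measurable_fun; apply/funext => t; rewrite -inner2.
- move=> t _; rewrite !abse_EFin lee_fin normrM ler_piMl//.
  have mc : measurable_fun setT (fun w => cos (A w + X w * t) * B w).
    apply: measurable_funM => //; apply: (measurableT_comp (@measurable_cos R)).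
    by apply: measurable_funD => //; exact: measurable_funM.
  have i1 : P.-integrable setT (fun=> (1 : R)%:E).
    exact: finite_measure_integrable_cst.
  have ic : P.-integrable setT (fun w => (cos (A w + X w * t) * B w)%:E).
    apply: (le_integrable measurableT _ _ i1) => //; first exact/measurable_EFinP.
    by move=> w _; rewrite !abse_EFin lee_fin normr1.
  apply: le_trans (le_normr_Rintegral _ ic) _ => //.
  apply: (@le_trans _ _ (\int[P]_(w in [set: T]) 1)).
    by apply: le_Rintegral => //; exact: (integrable_norm ic).
  rewrite Rintegral_cst// mul1r [X in fine X](_ : _ = 1%E)//.
  exact: probability_setT.
- exact: integrable_normal_pdf.
Qed.

End fubini_cos.

Section bumps.
Context {R : realType} d (T : measurableType d) (P : probability T R).
Local Notation mu := (@lebesgue_measure R).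
Local Notation g := (@normal_pdf R 0 1).
Context (I : finType) (Y : I -> T -> R) (z e : I -> R).
Hypotheses (mY : forall l, measurable_fun setT (Y l)) (e_gt0 : forall l, 0 < e l).
Implicit Types (x : I -> R) (s : seq I).

(** The products of bumps are estimated through the transforms
    [bump_transform s], in which some of the bumps have been replaced by a
    frequency [x]; [shrink lam l] is the factor by which one bump multiplies a
    Gaussian integral of inverse variance [lam]. *)
Definition bump l w := expR (- ((Y l w - z l) / e l) ^+ 2 / 2).
Definition phase x w := \sum_l x l * (Y l w - z l).
Definition bump_transform s x :=
  \int[P]_w (cos (phase x w) * \prod_(l <- s) bump l w).
Definition shift_freq x l t : I -> R := fun j => x j + (if j == l then t else 0).
Definition sqnorm x := \sum_l x l ^+ 2.
Definition shrink (lam : R) l := (Num.sqrt (1 + lam / e l ^+ 2))^-1.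

Lemma bump_ge0 l w : 0 <= bump l w. Proof. exact: expR_ge0. Qed.

Lemma bump_le1 l w : bump l w <= 1.
Proof.
by rewrite -expR0 ler_expR mulNr oppr_le0 divr_ge0 ?sqr_ge0.
Qed.

Lemma measurable_bump l : measurable_fun setT (bump l).
Proof.
apply: measurableT_comp => //; apply: measurable_funM => //.
apply: measurableT_comp => //; apply: measurable_funX.
by apply: measurable_funM => //; exact: measurable_funB.
Qed.

Lemma measurable_prod_bump s : measurable_fun setT (fun w => \prod_(l <- s) bump l w).
Proof.
by apply: measurable_prod => l _; exact: measurable_bump.
Qed.

Lemma prod_bump_ge0 s w : 0 <= \prod_(l <- s) bump l w.
Proof. by apply: prodr_ge0 => l _; exact: bump_ge0. Qed.

Lemma prod_bump_le1 s w : \prod_(l <- s) bump l w <= 1.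
Proof. by apply: prodr_ile1 => l _; rewrite bump_ge0 bump_le1. Qed.

Lemma norm_prod_bump_le1 s w : `|\prod_(l <- s) bump l w| <= 1.
Proof. by rewrite ger0_norm ?prod_bump_ge0// prod_bump_le1. Qed.

Lemma measurable_phase x : measurable_fun setT (phase x).
Proof.
apply: measurable_sum => l; apply: measurable_funM => //.
exact: measurable_funB.
Qed.

Lemma phase_shift x l t w :
  phase (shift_freq x l t) w = phase x w + t * (Y l w - z l).
Proof.
rewrite /phase /shift_freq; under eq_bigr do rewrite mulrDl.
rewrite big_split/=; congr (_ + _).
rewrite (bigD1 l)//= eqxx big1 ?addr0// => j /negPf jl.
by rewrite jl mul0r.
Qed.

Lemma sqnorm_shift x l t : x l = 0 -> sqnorm (shift_freq x l t) = sqnorm x + t ^+ 2.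
Proof.
move=> xl; rewrite /sqnorm (bigD1 l)//= [in RHS](bigD1 l)//= xl expr0n add0r.
rewrite /shift_freq eqxx xl add0r addrC; congr (_ + _).
by apply: eq_bigr => j /negPf ->; rewrite addr0.
Qed.

(** Trading the bump of index [l] for a random shift of the frequency. *)
Lemma bump_transform_cons l s x : bump_transform (l :: s) x =
  \int[mu]_t (bump_transform s (shift_freq x l (t / e l)) * g t).
Proof.
pose X w := (Y l w - z l) / e l.
rewrite /bump_transform; under eq_Rintegral do rewrite big_cons.
rewrite (@Rintegral_cos_bump _ _ _ P (phase x) X (fun w => \prod_(j <- s) bump j w)).
- apply: eq_Rintegral => t _; congr (_ * _); apply: eq_Rintegral => w _.
  by congr (cos _ * _); rewrite phase_shift /X; ring.
- exact: measurable_phase.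
- by apply: measurable_funM => //; exact: measurable_funB.
- exact: measurable_prod_bump.
- exact: norm_prod_bump_le1.
Qed.

Lemma integrable_bump_transform l s x : mu.-integrable setT
  (fun t => (bump_transform s (shift_freq x l (t / e l)) * g t)%:E).
Proof.
pose X w := (Y l w - z l) / e l.
have mX : measurable_fun setT X by apply: measurable_funM => //; exact: measurable_funB.
have := @integrable_cos_bump _ _ _ P (phase x) X (fun w => \prod_(j <- s) bump j w)
  (measurable_phase x) mX (measurable_prod_bump s) (norm_prod_bump_le1 s).
congr (integrable _ _ _); apply/funext => t; congr (_ * _)%:E.
apply: eq_Rintegral => w _.
by congr (cos _ * _); rewrite phase_shift /X; ring.
Qed.

Lemma shrink_gt0 (lam : R) l : 0 <= lam -> 0 < shrink lam l.
Proof.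
by move=> lam0; rewrite invr_gt0 sqrtr_gt0 ltr_wpDr// divr_ge0// sqr_ge0.
Qed.

Lemma Rintegral_expR_shift (lam c : R) x l : 0 <= lam -> x l = 0 ->
  \int[mu]_t (c * expR (- (lam * sqnorm (shift_freq x l (t / e l)) / 2)) * g t) =
  c * shrink lam l * expR (- (lam * sqnorm x / 2)).
Proof.
move=> lam0 xl.
have el := lt0r_neq0 (e_gt0 l).
have c0 : 0 <= lam / e l ^+ 2 by rewrite divr_ge0 ?sqr_ge0.
transitivity (\int[mu]_t (c * expR (- (lam * sqnorm x / 2)) *
    (expR (- ((lam / e l ^+ 2 / 2) * t ^+ 2)) * g t))).
  apply: eq_Rintegral => t _; rewrite sqnorm_shift// -!mulrA; congr (_ * _).
  rewrite [RHS]mulrA -expRD; congr (expR _ * _); field; exact: el.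
rewrite RintegralZl//; last first.
  by apply: integrable_expR_sqr_normal_pdf; rewrite divr_ge0.
have := Rintegral_expR_sqr_normal_pdf (shrink_gt0 l lam0).
have -> : shrink lam l ^- 2 - 1 = lam / e l ^+ 2.
  rewrite /shrink exprVn invrK sqr_sqrtr; first by rewrite addrC addKr.
  by rewrite addr_ge0.
by move=> ->; ring.
Qed.

Lemma integrable_expR_shift (lam c : R) x l : 0 <= lam -> x l = 0 ->
  mu.-integrable setT (fun t : R =>
    (c * expR (- (lam * sqnorm (shift_freq x l (t / e l)) / 2)) * g t)%:E).
Proof.
move=> lam0 xl.
have el := lt0r_neq0 (e_gt0 l).
have c0 : 0 <= lam / e l ^+ 2 / 2 by rewrite divr_ge0 ?divr_ge0 ?sqr_ge0.
have := integrableZl measurableT (c * expR (- (lam * sqnorm x / 2)))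
  (integrable_expR_sqr_normal_pdf c0).
congr (integrable _ _ _); apply/funext => t; rewrite -EFinM; congr EFin.
rewrite sqnorm_shift// -!mulrA; congr (_ * _).
rewrite [LHS]mulrA -expRD; congr (expR _ * _); field; exact: el.
Qed.

(** Adding a bump averages the transform over a Gaussian shift of one
    frequency, and Gaussian functions of the frequency are reproduced by this
    average up to the factor [shrink]. A comparison of the transform over [s0]
    with a Gaussian function therefore propagates to every larger family. The
    frequencies of the bumps already present have to vanish, so that each shift
    only adds a square to [sqnorm]. *)
Lemma bump_transform_approx (a b lam : R) s0 s : 0 <= lam ->
  (forall x, {in s0, forall l, x l = 0} ->
    `|bump_transform s0 x - a * expR (- (1 * sqnorm x / 2))| <=
      b * expR (- (lam * sqnorm x / 2))) ->
  uniq (s ++ s0) -> forall x, {in s ++ s0, forall l, x l = 0} ->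
  `|bump_transform (s ++ s0) x -
      a * \prod_(l <- s) shrink 1 l * expR (- (1 * sqnorm x / 2))| <=
    b * \prod_(l <- s) shrink lam l * expR (- (lam * sqnorm x / 2)).
Proof.
move=> lam0 H0; elim: s => [_ x x0|l s IH /= /andP[ls us] x x0].
  by rewrite !big_nil !mulr1; exact: H0.
set a' := a * \prod_(l <- s) shrink 1 l; set b' := b * \prod_(l <- s) shrink lam l.
have xl : x l = 0 by rewrite x0// inE eqxx.
have IHt t : `|bump_transform (s ++ s0) (shift_freq x l (t / e l)) -
    a' * expR (- (1 * sqnorm (shift_freq x l (t / e l)) / 2))| <=
    b' * expR (- (lam * sqnorm (shift_freq x l (t / e l)) / 2)).
  apply: IH => // j js; rewrite /shift_freq x0 ?inE ?js ?orbT//.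
  by case: eqVneq => [jl|]; rewrite ?addr0//; move: ls; rewrite -jl js.
rewrite !big_cons bump_transform_cons.
rewrite ![_ * (shrink _ _ * _)]mulrCA ![shrink _ _ * _]mulrC -/a' -/b'.
rewrite -!Rintegral_expR_shift ?ler01//.
have i1 := integrable_bump_transform l (s ++ s0) x.
have i2 := integrable_expR_shift a' ler01 xl.
have i3 := integrable_expR_shift b' lam0 xl.
rewrite -(RintegralB measurableT i1 i2).
have i12 := integrableB measurableT i1 i2.
apply: le_trans (le_normr_Rintegral measurableT i12) _.
apply: le_Rintegral => //; first exact: (integrable_norm i12).
move=> t _; rewrite -mulrBl normrM (ger0_norm (normal_pdf_ge0 _ _ _)).
by rewrite ler_wpM2r ?normal_pdf_ge0.
Qed.

End bumps.

(** * Nearly orthonormal Gaussian families *)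

Section quadratic_form.
Context {R : realType} (I : finType) (c : I -> I -> R) (delta kappa : R).
Hypotheses (c1 : forall l, c l l = 1) (delta0 : 0 <= delta)
  (c_small : forall l m, l != m -> `|c l m| <= delta)
  (dk : delta * #|I|%:R <= kappa).
Implicit Type x : I -> R.

Definition qform x := \sum_l \sum_m x l * x m * c l m.

(** The off-diagonal entries sum to at most [kappa] times the squared norm, by
    the inequality between arithmetic and geometric means. *)
Lemma qform_near x : `|qform x - sqnorm x| <= kappa * sqnorm x.
Proof.
have N0 : 0 <= sqnorm x by apply: sumr_ge0 => l _; exact: sqr_ge0.
rewrite /qform /sqnorm -sumrB.
apply: (@le_trans _ _ (\sum_l \sum_(m | m != l) delta * ((x l ^+ 2 + x m ^+ 2) / 2))).
  apply: le_trans (ler_norm_sum _ _ _) _; apply: ler_sum => l _.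
  rewrite (bigD1 l)//= c1 mulr1 -expr2 addrAC subrr add0r.
  apply: le_trans (ler_norm_sum _ _ _) _; apply: ler_sum => m ml.
  rewrite normrM mulrC ler_pM// ?c_small//; first by rewrite eq_sym.
  rewrite normrM ler_pdivlMr//.
  have := sqr_ge0 (`|x l| - `|x m|).
  by rewrite sqrrB !real_normK ?num_real// -mulr_natr; lra.
apply: (@le_trans _ _ (\sum_l \sum_m delta * ((x l ^+ 2 + x m ^+ 2) / 2))).
  apply: ler_sum => l _; rewrite [leRHS](bigD1 l)//= lerDr.
  by rewrite mulr_ge0// divr_ge0// addr_ge0 ?sqr_ge0.
rewrite (_ : \sum_l _ = delta * #|I|%:R * \sum_l x l ^+ 2).
  by rewrite ler_wpM2r.
under eq_bigr => l _ do rewrite -mulr_sumr -mulr_suml big_split/= sumr_const.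
rewrite -mulr_sumr -mulr_suml big_split/= sumr_const sumrMnl -[_ *+ #|_|]mulr_natr.
by rewrite (_ : #|xpredT| = #|I|)//; field.
Qed.

Lemma qform_ge x : (1 - kappa) * sqnorm x <= qform x.
Proof. by have := qform_near x; rewrite ler_norml => /andP[? ?]; lra. Qed.

Lemma qform_shift x l t : (forall l m, c l m = c m l) ->
  qform (shift_freq x l t) = qform x + 2 * t * (\sum_m x m * c l m) + t ^+ 2.
Proof.
move=> csym; rewrite /qform.
have E j m : shift_freq x l t j * shift_freq x l t m * c j m =
   x j * x m * c j m + (if j == l then t * (x m * c j m) else 0) +
   (if m == l then t * (x j * c j m) else 0) +
   (if m == l then if j == l then t ^+ 2 * c j m else 0 else 0).
  by rewrite /shift_freq; case: (j == l); case: (m == l); ring.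
under eq_bigr => j _ do (under eq_bigr => m _ do rewrite E).
under eq_bigr => j _ do rewrite !big_split/= -!big_mkcond/= !big_pred1_eq.
rewrite !big_split/= -!addrA; congr (_ + _).
rewrite -[X in _ + (_ + X)]big_mkcond/= big_pred1_eq c1 mulr1.
rewrite addrA; congr (_ + _).
rewrite (bigD1 l)//= [X in _ + X + _]big1 ?addr0; last first.
  by move=> j /negPf ->; rewrite big1.
rewrite eqxx -!mulr_sumr -mulrA mulr_natl mulr2n; congr (t * _ + t * _).
by apply: eq_bigr => j _; rewrite csym.
Qed.

(** Minimising the form along the coordinate [l] gives the conditional
    variance given the variable of index [l]; it stays comparable to the
    squared norm. *)
Lemma qform_min x l : (forall l m, c l m = c m l) -> kappa <= 1 -> x l = 0 ->
  (1 - kappa) * sqnorm x <= qform x - (\sum_m x m * c l m) ^+ 2.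
Proof.
move=> csym k1 xl; set b := \sum_m _.
have := qform_ge (shift_freq x l (- b)).
rewrite qform_shift// sqnorm_shift// -/b mulrDr => h.
have : 0 <= (1 - kappa) * (- b) ^+ 2 by rewrite mulr_ge0 ?sqr_ge0 ?subr_ge0.
by move: h; rewrite sqrrN expr2; lra.
Qed.

End quadratic_form.

Lemma norm_sin_le (R : realType) (x : R) : `|sin x| <= `|x|.
Proof.
wlog x0 : x / 0 <= x.
  move=> H; have [/H//|/ltW x0] := leP 0 x.
  by rewrite -normrN -sinN -[leRHS]normrN; apply: H; rewrite oppr_ge0.
move: x0; rewrite le_eqVlt => /orP[/eqP <-|x0]; first by rewrite sin0 !normr0.
have [t _] := @MVT _ sin cos 0 x x0 (fun t _ => is_derive_sin t)
  (continuous_subspaceT (@continuous_sin R)).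
rewrite sin0 !subr0 => ->; rewrite normrM ler_piMl//.
by rewrite ler_norml cos_geN1 cos_le1.
Qed.

Lemma one_sub_cos_le (R : realType) (t : R) : 1 - cos t <= t ^+ 2 / 2.
Proof.
have {1}-> : t = (t / 2) *+ 2 by rewrite -mulr_natr divfK.
rewrite cos_mulr2n cos2sin2.
have : sin (t / 2) ^+ 2 <= (t / 2) ^+ 2.
  by rewrite -real_normK ?num_real// -[leRHS]real_normK ?num_real// lerXn2r ?nnegrE ?norm_sin_le.
have -> : t ^+ 2 / 2 = (t / 2) ^+ 2 *+ 2 by rewrite -[RHS]mulr_natr; field.
lra.
Qed.

Lemma cauchy_schwarz_sum (R : realType) (I : finType) (x y : I -> R) :
  (\sum_l x l * y l) ^+ 2 <= (\sum_l x l ^+ 2) * (\sum_l y l ^+ 2).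
Proof.
set A := \sum_l x l ^+ 2; set B := \sum_l y l ^+ 2; set C := \sum_l _.
have A0 : 0 <= A by apply: sumr_ge0 => l _; exact: sqr_ge0.
have Q (t : R) : 0 <= A * t ^+ 2 + 2 * C * t + B.
  have -> : A * t ^+ 2 + 2 * C * t + B = \sum_l (t * x l + y l) ^+ 2.
    rewrite /A /B /C mulr_suml mulr_sumr mulr_suml -!big_split/=.
    by apply: eq_bigr => l _; ring.
  by apply: sumr_ge0 => l _; exact: sqr_ge0.
have [A_eq0|A_neq0] := eqVneq A 0.
  have x0 l : x l = 0.
    have /psumr_eq0P : A = 0 by [].
    by move=> /(_ (fun i _ => sqr_ge0 _))/(_ l isT)/eqP; rewrite sqrf_eq0 => /eqP.
  by rewrite /C big1 ?expr0n ?A_eq0 ?mul0r// => l _; rewrite x0 mul0r.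
have A_gt0 : 0 < A by rewrite lt_def A_neq0.
have := Q (- C / A); rewrite -(ler_pM2l A_gt0) mulr0.
have -> : A * (A * (- C / A) ^+ 2 + 2 * C * (- C / A) + B) = A * B - C ^+ 2.
  by field.
by rewrite subr_ge0.
Qed.

(** The mean value theorem for the exponential, with the convexity bound
    [1 + x <= expR x] in place of a derivative. *)
Lemma expR_sub_le (R : realType) (a b m : R) : m <= a -> m <= b ->
  `|expR (- a) - expR (- b)| <= `|a - b| * expR (- m).
Proof.
wlog ab : a b / a <= b.
  move=> H ma mb; have [ab|/ltW ba] := leP a b; first exact: H.
  by rewrite distrC [`|a - b|]distrC; exact: H.
move=> ma mb; rewrite ger0_norm ?subr_ge0 ?ler_expR ?lerN2//.
rewrite distrC ger0_norm ?subr_ge0//.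
have -> : expR (- b) = expR (- a) * expR (- (b - a)) by rewrite -expRD; congr expR; ring.
rewrite -[X in X - _]mulr1 -mulrBr mulrC ler_pM ?expR_ge0 ?ler_expR ?lerN2//.
  by rewrite subr_ge0 -expR0 ler_expR oppr_le0 subr_ge0.
by have := expR_ge1Dx (- (b - a)); lra.
Qed.

Lemma decay_arith (R : realType) (N K q C B : R) : 0 <= N -> K <= 4^-1 * N ->
  N - K <= q - C -> B <= C -> - q / 2 + B / 2 <= - (4^-1 * N / 2).
Proof. lra. Qed.

Section near_orthonormal.
Context {R : realType} d (T : measurableType d) (P : probability T R).
Local Notation mu := (@lebesgue_measure R).
Local Notation g := (@normal_pdf R 0 1).
Context (I : finType) (Y : I -> T -> R) (c : I -> I -> R) (delta kappa : R).
Hypotheses (mY : forall l, measurable_fun setT (Y l)).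
Hypotheses (c1 : forall l, c l l = 1) (csym : forall l m, c l m = c m l)
  (delta0 : 0 <= delta) (c_small : forall l m, l != m -> `|c l m| <= delta)
  (dk : delta * #|I|%:R <= kappa) (k14 : kappa <= 4^-1).
(** Joint normality with covariance [c] enters only through the
    characteristic function of the linear combinations. *)
Hypothesis cosY : forall (x : I -> R) p,
  \int[P]_w cos (p + \sum_l x l * Y l w) = cos p * expR (- qform c x / 2).
Variables (z e : I -> R).
Hypothesis (e_gt0 : forall l, 0 < e l).

Local Notation bump := (bump Y z e).
Local Notation transform := (bump_transform P Y z e).

Lemma bump_transform_nil x : transform [::] x =
  cos (- \sum_l x l * z l) * expR (- qform c x / 2).
Proof.
rewrite /bump_transform -cosY; apply: eq_Rintegral => w _.
rewrite big_nil mulr1 /phase; congr cos.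
by rewrite addrC -sumrB; apply: eq_bigr => l _; rewrite mulrBr.
Qed.

(** The characteristic function of the family differs from the standard
    Gaussian one by the phase of the targets [z] and by the off-diagonal part of
    the covariance. Both errors are of order [kappa] times the squared norm of
    the frequency, and the squared norm is absorbed by giving up half of the
    exponential decay. *)
Lemma bump_transform_nil_near x : \sum_l z l ^+ 2 <= kappa ->
  `|transform [::] x - 1 * expR (- (1 * sqnorm x / 2))| <=
  8 * kappa * expR (- (4^-1 * sqnorm x / 2)).
Proof.
move=> zk; rewrite bump_transform_nil !mul1r cosN.
set th := \sum_l _; set N := sqnorm x; set q := qform c x.
have N0 : 0 <= N by apply: sumr_ge0 => l _; exact: sqr_ge0.
have k0 : 0 <= kappa by apply: le_trans zk; apply: sumr_ge0 => l _; exact: sqr_ge0.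
have qN : `|q - N| <= kappa * N by exact: (qform_near c1 delta0 c_small dk).
have [qN1 qN2] : N - kappa * N <= q /\ q <= N + kappa * N.
  by move: qN; rewrite ler_norml => /andP[? ?]; split; lra.
have kN : kappa * N <= N / 4 by rewrite mulrC; apply: ler_wpM2l.
have th2 : th ^+ 2 <= N * kappa.
  apply: le_trans (cauchy_schwarz_sum _ _) _; exact: ler_wpM2l.
have c2 : `|cos th - 1| <= N * kappa / 2.
  rewrite distrC ger0_norm ?subr_ge0 ?cos_le1//.
  apply: le_trans (one_sub_cos_le th) _; rewrite ler_pM2r//.
have -> : cos th * expR (- q / 2) - expR (- (N / 2)) =
  (cos th - 1) * expR (- (q / 2)) + (expR (- (q / 2)) - expR (- (N / 2))).
  by rewrite mulNr; ring.
have E : N / 8 <= expR (N / 8) by have := expR_ge1Dx (N / 8); lra.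
apply: (@le_trans _ _ (N * kappa * expR (- (N / 4)))).
  apply: le_trans (ler_normD _ _) _.
  have -> : N * kappa * expR (- (N / 4)) = N * kappa / 2 * expR (- (N / 4)) + N * kappa / 2 * expR (- (N / 4)).
    by field.
  apply: lerD.
    rewrite normrM ler_pM// ger0_norm ?expR_ge0// ler_expR; lra.
  apply: (@le_trans _ _ (`|q / 2 - N / 2| * expR (- (N / 4)))).
    by apply: expR_sub_le; lra.
  rewrite ler_wpM2r ?expR_ge0// -mulrBl normrM (@ger0_norm _ 2^-1)//.
  by rewrite ler_pM2r// mulrC.
have -> : expR (- (N / 4)) = expR (- (N / 8)) * expR (- (N / 8)).
  by rewrite -expRD; congr expR; field.
have -> : 4^-1 * N / 2 = N / 8 by field.
rewrite mulrA ler_wpM2r ?expR_ge0//.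
have NE : N / 8 * expR (- (N / 8)) <= 1.
  by rewrite -[leRHS](expRxMexpNx_1 (N / 8)) ler_wpM2r ?expR_ge0.
have -> : N * kappa * expR (- (N / 8)) = 8 * kappa * (N / 8 * expR (- (N / 8))).
  by field.
by rewrite ler_piMr// mulr_ge0.
Qed.

Lemma shrink_le (l : I) : shrink e 4^-1 l <= 2 * shrink e 1 l.
Proof.
rewrite /shrink; have e2 : 0 < e l ^+ 2 by rewrite exprn_gt0.
have h : 0 < 1 + 1 / e l ^+ 2 by rewrite addr_gt0// divr_gt0.
have h4 : 0 < 1 + 4^-1 / e l ^+ 2 by rewrite addr_gt0// divr_gt0.
set S := Num.sqrt (1 + 1 / _); have S0 : 0 < S by rewrite sqrtr_gt0.
rewrite -(invf_div S 2) lef_pV2 ?posrE ?divr_gt0 ?sqrtr_gt0//.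
rewrite ler_pdivrMr// -(@ger0_norm _ (2 : R))// -sqrtr_sqr -sqrtrM ?(ltW h4)//.
rewrite /S ler_sqrt ?mulr_ge0 ?(ltW h4)//; set u := (e l ^+ 2)^-1; rewrite mul1r expr2.
have : 0 < u by rewrite invr_gt0.
lra.
Qed.

Lemma prod_shrink_le : \prod_l shrink e 4^-1 l <= 2 ^+ #|I| * \prod_l shrink e 1 l.
Proof.
rewrite -prodr_const -big_split/=; apply: ler_prod => l _.
by rewrite ltW ?shrink_gt0//= shrink_le.
Qed.

(** The law of the family is close to a standard Gaussian one and the targets
    [z] are close to its mode, so the bumps see at least half of the mass they
    would see for independent variables. The error term carries
    [shrink 4^-1] instead of [shrink 1], which costs a factor 2 per variable and
    explains the smallness required of [kappa]. *)
Lemma Rintegral_prod_bump_ge : \sum_l z l ^+ 2 <= kappa ->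
  16 * kappa * 2 ^+ #|I| <= 1 ->
  2^-1 * \prod_l shrink e 1 l <= \int[P]_w \prod_l bump l w.
Proof.
move=> zk k16.
have q0 : 0 <= (4^-1 : R) by [].
have H0 (x : I -> R) : {in [::], forall l, x l = 0} ->
    `|transform [::] x - 1 * expR (- (1 * sqnorm x / 2))| <=
    8 * kappa * expR (- (4^-1 * sqnorm x / 2)).
  by move=> _; exact: bump_transform_nil_near.
have us : uniq (index_enum I ++ [::]) by rewrite cats0 index_enum_uniq.
have := bump_transform_approx mY e_gt0 q0 H0 us (x := fun=> 0) (fun _ _ => erefl).
have -> : sqnorm (fun _ : I => 0 : R) = 0 by rewrite /sqnorm big1// => l _; rewrite expr0n.
rewrite !mulr0 !mul0r oppr0 expR0 !mulr1 mul1r cats0.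
have -> : transform (index_enum I) (fun=> 0) = \int[P]_w \prod_l bump l w.
  apply: eq_Rintegral => w _; rewrite /phase big1 ?cos0 ?mul1r// => l _.
  by rewrite mul0r.
set A := \prod_l shrink e 1 l; set B := \prod_l _.
have A0 : 0 <= A by apply: prodr_ge0 => l _; rewrite ltW ?shrink_gt0.
have BA : B <= 2 ^+ #|I| * A by exact: prod_shrink_le.
have k0 : 0 <= kappa by apply: le_trans zk; apply: sumr_ge0 => l _; exact: sqr_ge0.
rewrite ler_norml => /andP[h _].
have : 8 * kappa * B <= 2^-1 * A.
  apply: (@le_trans _ _ (8 * kappa * (2 ^+ #|I| * A))); first by rewrite ler_wpM2l// mulr_ge0.
  rewrite mulrA ler_wpM2r//; lra.
lra.
Qed.

Lemma norm_cos_le1 (t : R) : `|cos t| <= 1.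
Proof. by rewrite ler_norml cos_geN1 cos_le1. Qed.

(** The bump of index [l0] is integrated exactly, by completing the square, so
    that the Gaussian decay in its target [z l0] survives; what is left of the
    quadratic form is the conditional variance bounded in [qform_min]. *)
Lemma bump_transform_one_le l0 x : x l0 = 0 ->
  `|transform [:: l0] x| <=
  shrink e 1 l0 * expR (- (z l0 ^+ 2 / (2 * (1 + e l0 ^+ 2)))) *
  expR (- (4^-1 * sqnorm x / 2)).
Proof.
move=> x0; rewrite bump_transform_cons//.
have el := lt0r_neq0 (e_gt0 l0).
have e2 : 0 < e l0 ^+ 2 by rewrite exprn_gt0.
set s := shrink e 1 l0; have s0 : 0 < s by exact: shrink_gt0.
have s2 : s ^- 2 - 1 = (e l0 ^+ 2)^-1.
  rewrite /s /shrink exprVn invrK sqr_sqrtr; first by rewrite mul1r addrC addKr.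
  by rewrite mul1r addr_ge0// invr_ge0 ltW.
have s2' : s ^+ 2 = e l0 ^+ 2 / (1 + e l0 ^+ 2).
  rewrite -[s ^+ 2]invrK -[X in X^-1](subrK 1) s2; field.
  by rewrite el gt_eqF// addr_gt0.
set b := \sum_m x m * c l0 m.
set p := - \sum_l x l * z l.
have decay : - qform c x / 2 + (b / e l0) ^+ 2 * s ^+ 2 / 2 <= - (4^-1 * sqnorm x / 2).
  have N0 : 0 <= sqnorm x by apply: sumr_ge0 => l _; exact: sqr_ge0.
  have k1 : kappa <= 1 by apply: le_trans k14 _; rewrite invf_le1// ler1n.
  have := qform_min c1 delta0 c_small dk csym k1 x0; rewrite -/b.
  have b2 : (b / e l0) ^+ 2 * s ^+ 2 <= b ^+ 2.
    have -> : (b / e l0) ^+ 2 * s ^+ 2 = b ^+ 2 / (1 + e l0 ^+ 2).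
      by rewrite s2'; field; rewrite el gt_eqF// addr_gt0.
    by rewrite ler_pdivrMr ?addr_gt0// ler_peMr ?sqr_ge0// lerDl ltW.
  rewrite mulrBl mul1r => qm.
  exact: (decay_arith N0 (ler_wpM2r N0 k14) qm b2).
have -> : \int[mu]_t (transform [::] (shift_freq x l0 (t / e l0)) * g t) =
    expR (- qform c x / 2) * \int[mu]_t (cos (p + (- (z l0 / e l0)) * t) *
      (expR (- ((s ^- 2 - 1) / 2 * t ^+ 2 + b / e l0 * t)) * g t)).
  rewrite -RintegralZl//; last first.
    have := integrable_bounded_normal_pdf (- (b / e l0 * s ^+ 2)) s
      (f := fun t => cos (p + (- (z l0 / e l0)) * t)) _ (fun t => norm_cos_le1 _).
    have mc : measurable_fun setT (fun t => cos (p + (- (z l0 / e l0)) * t)).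
      apply: (measurableT_comp (@measurable_cos R)).
      by apply: measurable_funD => //; exact: measurable_funM.
    move=> /(_ mc) /(integrableZl measurableT (s * expR ((b / e l0) ^+ 2 * s ^+ 2 / 2))).
    congr (integrable _ _ _); apply/funext => t; rewrite -EFinM; congr EFin.
    by rewrite expR_quadratic_normal_pdf//; ring.
  apply: eq_Rintegral => t _; rewrite bump_transform_nil.
  have -> : - \sum_l shift_freq x l0 (t / e l0) l * z l = p + (- (z l0 / e l0)) * t.
    rewrite /p /shift_freq; under eq_bigr do rewrite mulrDl.
    rewrite big_split/= opprD; congr (_ + _).
    rewrite (bigD1 l0)//= eqxx big1 ?addr0; first by field.
    by move=> j /negPf ->; rewrite mul0r.
  rewrite [RHS]mulrCA -[LHS]mulrA; congr (_ * _); rewrite [RHS]mulrA -expRD; congr (expR _ * _).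
  by rewrite qform_shift// s2 -/b; field.
rewrite Rintegral_cos_quadratic_normal_pdf// !normrM.
rewrite !(ger0_norm (expR_ge0 _)) (gtr0_norm s0).
set D := `|cos _|; set E1 := expR (- qform c x / 2); set E2 := expR (_ * s ^+ 2 / 2).
set E3 := expR (- (- _) ^+ 2 * _ / 2).
have -> : E3 = expR (- (z l0 ^+ 2 / (2 * (1 + e l0 ^+ 2)))).
  rewrite /E3 s2'; congr expR; field.
  by rewrite el gt_eqF// addr_gt0.
set E4 := expR (- (z l0 ^+ 2 / _)).
apply: (@le_trans _ _ (s * E4 * (E1 * E2))).
  have -> : E1 * (s * E2 * (D * E4)) = s * E4 * (E1 * E2) * D by ring.
  by rewrite ler_piMr ?norm_cos_le1// !mulr_ge0 ?expR_ge0 ?(ltW s0).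
rewrite ler_wpM2l ?mulr_ge0 ?expR_ge0 ?(ltW s0)// -expRD ler_expR.
exact: decay.
Qed.

(** A density estimate for the family, up to the constant [2 ^+ #|I|], with the
    Gaussian decay of any one chosen variable. One variable is enough for the
    sequel and spares the inversion of the covariance matrix. *)
Lemma Rintegral_prod_bump_le l0 :
  \int[P]_w \prod_l bump l w <=
  2 ^+ #|I| * \prod_l shrink e 1 l * expR (- (z l0 ^+ 2 / (2 * (1 + e l0 ^+ 2)))).
Proof.
have q0 : 0 <= (4^-1 : R) by [].
set E4 := expR _.
have H0 (x : I -> R) : {in [:: l0], forall l, x l = 0} ->
    `|transform [:: l0] x - 0 * expR (- (1 * sqnorm x / 2))| <=
    shrink e 1 l0 * E4 * expR (- (4^-1 * sqnorm x / 2)).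
  by move=> x0; rewrite mul0r subr0; apply: bump_transform_one_le; rewrite x0 ?inE.
have ps : perm_eq (rem l0 (index_enum I) ++ [:: l0]) (index_enum I).
  by rewrite cats1 perm_rcons perm_sym perm_to_rem ?mem_index_enum.
have us : uniq (rem l0 (index_enum I) ++ [:: l0]).
  by rewrite (perm_uniq ps) index_enum_uniq.
have := bump_transform_approx mY e_gt0 q0 H0 us (x := fun=> 0) (fun _ _ => erefl).
have -> : sqnorm (fun _ : I => 0 : R) = 0 by rewrite /sqnorm big1// => l _; rewrite expr0n.
rewrite !(mulr0, mul0r, oppr0, subr0) expR0 mulr1.
have -> : transform (rem l0 (index_enum I) ++ [:: l0]) (fun=> 0) = \int[P]_w \prod_l bump l w.
  apply: eq_Rintegral => w _; rewrite /phase big1 ?cos0 ?mul1r; last first.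
    by move=> l _; rewrite mul0r.
  exact: perm_big.
move=> h; apply: le_trans (ler_norm _) _; apply: le_trans h _.
rewrite mulrAC ler_wpM2r ?expR_ge0//.
apply: le_trans prod_shrink_le.
rewrite [leRHS](perm_big _ (_ : perm_eq (index_enum I) (rcons (rem l0 (index_enum I)) l0)))/=; last first.
  by rewrite -cats1 perm_sym.
rewrite -cats1 big_cat/= big_seq1 mulrC ler_wpM2l//.
  by apply: prodr_ge0 => l _; rewrite ltW ?shrink_gt0.
rewrite /shrink lef_pV2 ?posrE ?sqrtr_gt0 ?ltr_wpDr ?divr_ge0 ?sqr_ge0//.
by rewrite ler_sqrt ?lerD2l ?ler_wpM2r ?invr_ge0 ?sqr_ge0// ?addr_ge0 ?divr_ge0 ?sqr_ge0//; lra.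
Qed.

End near_orthonormal.

(** * Correlations of fractional Brownian increments *)

Section powR_increments.
Context {R : realType}.
Implicit Types a b s t x y : R.

Lemma ge0_powR_le (r x y : R) : 0 <= r -> 0 <= x -> x <= y -> x `^ r <= y `^ r.
Proof. by move=> r0 x0 xy; apply: ge0_ler_powR; rewrite ?nnegrE// (le_trans x0). Qed.

Lemma powR_MVT b s x y : -2 <= b <= 2 -> -1 <= b -> 0 < s ->
  s / 2 <= x <= 2 * s -> s / 2 <= y <= 2 * s ->
  `|x `^ b - y `^ b| <= 8 * s `^ (b - 1) * `|x - y|.
Proof.
move=> /andP[b1 b2] b3 s0.
wlog xy : x y / y <= x.
  move=> H hx hy; have [|/ltW xy] := leP y x; first by move=> xy; exact: H.
  by rewrite distrC [`|x - y|]distrC; exact: H.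
move=> /andP[sx xs] /andP[sy ys].
have y0 : 0 < y by apply: lt_le_trans sy; rewrite divr_gt0.
move: xy; rewrite le_eqVlt => /orP[/eqP -> |yx].
  by rewrite !subrr !normr0 mulr0.
have der t : t \in `]y, x[%R -> is_derive t (1 : R) (fun x => x `^ b) (b * t `^ (b - 1)).
  by rewrite in_itv/= => /andP[yt _]; apply: is_derive1_powR; exact: lt_trans yt.
have cont : {within `[y, x], continuous (fun x => x `^ b)}.
  apply: derivable_within_continuous => t; rewrite in_itv/= => /andP[yt _].
  by have [] := @is_derive1_powR R b t (lt_le_trans y0 yt).
have [t] := MVT yx der cont.
rewrite in_itv/= => /andP[yt tx] ->.
have t0 : 0 < t by exact: lt_trans yt.
rewrite normrM ler_wpM2r// normrM (ger0_norm (powR_ge0 _ _)).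
have st : t `^ (b - 1) <= 4 * s `^ (b - 1).
  have -> : t = s * (t / s) by field; rewrite gt_eqF.
  rewrite powRM ?divr_ge0 ?(ltW t0) ?(ltW s0)// mulrC ler_wpM2r ?powR_ge0//.
  have [b1' | b1'] := leP 1 b.
    apply: (@le_trans _ _ (2 `^ (b - 1))).
      apply: ge0_ler_powR; rewrite ?nnegrE ?subr_ge0// ?divr_ge0 ?(ltW t0) ?(ltW s0)//.
      by rewrite ler_pdivrMr//; apply: le_trans xs; exact: ltW.
    apply: (@le_trans _ _ (2 `^ 1)); last by rewrite powRr1//; lra.
    by apply: ler_powR; lra.
  have -> : b - 1 = - (1 - b) by ring.
  have ts : 2^-1 <= t / s by rewrite ler_pdivlMr// mulrC; apply: le_trans sy _; exact: ltW.
  rewrite powRN -[leRHS]invrK lef_pV2 ?posrE ?powR_gt0 ?divr_gt0//.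
  apply: (@le_trans _ _ (2^-1 `^ (1 - b))).
    apply: (@le_trans _ _ (2^-1 `^ 2%:R)).
      by rewrite powR_mulrn// exprVn -natrX.
    by apply: ger_powR; lra.
  by apply: ge0_ler_powR; rewrite ?nnegrE ?subr_ge0 ?(ltW b1')// divr_ge0 ?(ltW t0) ?(ltW s0).
apply: (@le_trans _ _ (2 * (4 * s `^ (b - 1)))); last by lra.
by apply: ler_pM; rewrite ?powR_ge0// ler_norml; apply/andP.
Qed.

(** The mean value theorem applied twice to the mixed second difference of a
    power: this is where the covariance of two distant increments gains a factor
    [s ^ (a - 2)]. *)
Lemma powR_mixed_MVT a s t x y : 0 < a < 2 -> 0 < s ->
  s / 2 <= x <= 2 * s -> s / 2 <= y <= 2 * s ->
  s / 2 <= x - t <= 2 * s -> s / 2 <= y - t <= 2 * s ->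
  `|(x `^ a - (x - t) `^ a) - (y `^ a - (y - t) `^ a)| <=
  16 * s `^ (a - 2) * `|t| * `|x - y|.
Proof.
move=> /andP[a0 a2] s0.
wlog xy : x y / y <= x.
  move=> H hx hy hx' hy'; have [|/ltW xy] := leP y x; first by move=> xy; exact: H.
  by rewrite distrC [`|x - y|]distrC; exact: H.
move=> /andP[sx xs] /andP[sy ys] /andP[sxt xts] /andP[syt yts].
have s2 : 0 < s / 2 by rewrite divr_gt0.
move: xy; rewrite le_eqVlt => /orP[/eqP -> |yx].
  by rewrite !subrr !normr0 mulr0.
pose f (u : R) := u `^ a - (u - t) `^ a.
have derf u : 0 < u -> 0 < u - t -> is_derive u (1 : R) f (a * (u `^ (a - 1) - (u - t) `^ (a - 1))).
  move=> u0 ut0.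
  have d1 := @is_derive1_powR R a u u0.
  have d2 := @is_derive1_powR R a (u - t) ut0.
  have ds : is_derive u (1 : R) (fun v => v - t) 1.
    by apply: is_derive_eq; rewrite oppr0 addr0.
  have d3 : is_derive u (1 : R) ((fun v => v `^ a) \o (fun v => v - t)) (a * (u - t) `^ (a - 1) * 1).
    exact: is_derive1_comp.
  have -> : f = (fun v => v `^ a) - ((fun v => v `^ a) \o (fun v => v - t)) by [].
  by apply: is_derive_eq; rewrite mulr1 mulrBr.
have der u : u \in `]y, x[%R -> is_derive u (1 : R) f (a * (u `^ (a - 1) - (u - t) `^ (a - 1))).
  by rewrite in_itv/= => /andP[yu ux]; apply: derf; lra.
have cont : {within `[y, x], continuous f}.
  apply: derivable_within_continuous => u; rewrite in_itv/= => /andP[yu ux].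
  have u0 : 0 < u by lra.
  have ut : 0 < u - t by lra.
  by have [] := derf u u0 ut.
have [u] := MVT yx der cont.
rewrite in_itv/= => /andP[yu ux]; rewrite -/(f x) -/(f y) => ->.
rewrite normrM ler_wpM2r// normrM.
have -> : 16 * s `^ (a - 2) * `|t| = 2 * (8 * s `^ (a - 1 - 1) * `|u - (u - t)|).
  have -> : u - (u - t) = t by ring.
  have -> : a - 1 - 1 = a - 2 by ring.
  by ring.
apply: ler_pM => //; first by rewrite ger0_norm; lra.
by apply: powR_MVT => //; try (apply/andP; split); lra.
Qed.

End powR_increments.

(** The covariance of the increments of a fractional Brownian motion over
    [[p, q]] and [[p', q']]. *)
Definition incr_cov {R : realType} (H p q p' q' : R) : R :=
  2^-1 * (`|q - p'| `^ (2 * H) + `|p - q'| `^ (2 * H)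
          - `|q - q'| `^ (2 * H) - `|p - p'| `^ (2 * H)).

Section incr_cov.
Context {R : realType} (H M : R).
Hypotheses (H0 : 0 < H) (H1 : H < 1) (M4 : 4 <= M).
Implicit Types p q s t x y : R.

Lemma incr_covC p q s t : incr_cov H p q s t = incr_cov H s t p q.
Proof.
by rewrite /incr_cov [`|p - t|]distrC [`|q - s|]distrC [`|q - t|]distrC [`|p - s|]distrC; ring.
Qed.

Lemma incr_cov_diag p q : incr_cov H p q p q = `|q - p| `^ (2 * H).
Proof.
have H2 : 2 * H != 0 by rewrite mulf_neq0 ?gt_eqF.
by rewrite /incr_cov !subrr normr0 powR0// [`|p - q|]distrC; field.
Qed.

Let M0 : 0 < M. Proof. by apply: lt_le_trans M4. Qed.
Let H2 : 0 < 2 * H < 2.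
Proof.
move: (H0) (H1) (M4) => h0 h1 m4.
by apply/andP; split; lra.
Qed.

Let pow2H x : x `^ (2 * H) = x `^ H * x `^ H.
Proof.
move: (H0) (H1) (M4) => h0 h1 m4.
by rewrite -powRD ?mulr2n ?mulrDl ?mul1r//; apply/implyP => /eqP; lra. Qed.

Let pow_split x : 0 <= x -> x = x `^ H * x `^ (1 - H).
Proof.
move: (H0) (H1) (M4) => h0 h1 m4.
move=> x0; rewrite -powRD; first by rewrite addrC subrK powRr1.
by apply/implyP => /eqP; lra.
Qed.

Let powD s (r r' : R) : 0 < s -> s `^ (r + r') = s `^ r * s `^ r'.
Proof. by move=> s0; rewrite powRD// (gt_eqF s0) implybT. Qed.

Let pow2H1 s : 0 < s -> s `^ (2 * H - 1) = s `^ H * s `^ (H - 1).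
Proof.
move=> s0; rewrite -powD//; congr (_ `^ _); ring.
Qed.

Let H1' : 0 <= 1 - H. Proof. by rewrite subr_ge0 ltW. Qed.

Let powM s : M <= s -> s `^ (H - 1) <= M `^ (H - 1).
Proof.
move=> Ms; have s0 : 0 < s by exact: lt_le_trans Ms.
have -> : H - 1 = - (1 - H) by ring.
rewrite !powRN lef_pV2 ?posrE ?powR_gt0//.
by apply: ge0_powR_le => //; exact: ltW.
Qed.

Let pow_le1 x : 0 <= x <= 1 -> x `^ (1 - H) <= 1.
Proof.
move=> /andP[x0 x1]; apply: (@le_trans _ _ (1 `^ (1 - H))); last by rewrite powR1.
by apply: ge0_powR_le.
Qed.

Let pow_leH x : 0 <= x <= 1 -> x `^ H <= 1.
Proof.
move=> /andP[x0 x1]; apply: (@le_trans _ _ (1 `^ H)); last by rewrite powR1.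
by apply: ge0_powR_le => //; exact: ltW.
Qed.

(** Each of the four lemmas below bounds a correlation by a multiple of
    [M `^ (H - 1) + M `^ (- H)], which is small for large [M]. Here [[p, q]] lies well
    before [s] and the other increment has length at most 1: the second
    difference gives [s ^ (2 H - 2)], and splitting both lengths as
    [x = x `^ H * x `^ (1 - H)] leaves the product of the standard deviations
    times at most [s `^ (H - 1)]. *)
Lemma incr_cov_far p q s t : 0 <= p <= s / 4 -> 0 <= q <= s / 4 ->
  M <= s -> `|t - s| <= 1 ->
  `|incr_cov H p q s t| <= 8 * M `^ (H - 1) * (`|q - p| `^ H * `|t - s| `^ H).
Proof.
move: (H0) (H1) (M4) => h0 h1 m4.
move=> /andP[p0 ps] /andP[q0 qs] Ms ts.
have s0 : 0 < s by exact: lt_le_trans Ms.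
have [ts1 ts2] : s - 1 <= t /\ t <= s + 1.
  by move: ts; rewrite ler_norml => /andP[? ?]; split; lra.
have -> : incr_cov H p q s t = 2^-1 *
  (((t - p) `^ (2 * H) - ((t - p) - (q - p)) `^ (2 * H)) -
   ((s - p) `^ (2 * H) - ((s - p) - (q - p)) `^ (2 * H))).
  rewrite /incr_cov [`|q - s|]distrC [`|p - t|]distrC [`|q - t|]distrC [`|p - s|]distrC.
  rewrite !ger0_norm; try lra.
  have -> : t - p - (q - p) = t - q by ring.
  have -> : s - p - (q - p) = s - q by ring.
  by ring.
rewrite normrM (@ger0_norm _ 2^-1)//.
apply: (@le_trans _ _ (2^-1 * (16 * s `^ (2 * H - 2) * `|q - p| * `|(t - p) - (s - p)|))).
  rewrite ler_wpM2l//; apply: powR_mixed_MVT => //; apply/andP; split; lra.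
have -> : t - p - (s - p) = t - s by ring.
have qp : `|q - p| <= s by rewrite ler_norml; apply/andP; split; lra.
rewrite {1}(pow_split (normr_ge0 (q - p))) {1}(pow_split (normr_ge0 (t - s))).
set A := `|q - p| `^ H; set B := `|t - s| `^ H.
have A0 : 0 <= A by exact: powR_ge0.
have B0 : 0 <= B by exact: powR_ge0.
have -> : 2^-1 * (16 * s `^ (2 * H - 2) * (A * `|q - p| `^ (1 - H)) * (B * `|t - s| `^ (1 - H))) =
  8 * (s `^ (2 * H - 2) * (`|q - p| `^ (1 - H) * `|t - s| `^ (1 - H))) * (A * B) by field.
rewrite ler_wpM2r ?mulr_ge0// ler_wpM2l//.
apply: le_trans (powM Ms).
have -> : s `^ (H - 1) = s `^ (2 * H - 2) * (s `^ (1 - H) * 1).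
  by rewrite mulr1 -powD//; congr (_ `^ _); ring.
rewrite ler_wpM2l ?powR_ge0// ler_pM ?powR_ge0//; last by rewrite pow_le1 ?normr_ge0.
exact: ge0_powR_le.
Qed.

(** A short increment over [[p, q]] against the position at a much later time
    [s]: only first differences are available. *)
Lemma incr_cov_base p q s : M <= p -> `|q - p| <= 1 -> p <= s / 4 -> q <= s / 4 ->
  `|incr_cov H p q 0 s| <= 8 * M `^ (H - 1) * (`|q - p| `^ H * s `^ H).
Proof.
move: (H0) (H1) (M4) => h0 h1 m4.
move=> Mp qp ps qs.
have p0 : 0 < p by exact: lt_le_trans Mp.
have [pq1 pq2] : p - 1 <= q /\ q <= p + 1.
  by move: qp; rewrite ler_norml => /andP[? ?]; split; lra.
have s0 : 0 < s by lra.
have Ms : M <= s by lra.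
have -> : incr_cov H p q 0 s = 2^-1 *
  ((q `^ (2 * H) - p `^ (2 * H)) + ((s - p) `^ (2 * H) - (s - q) `^ (2 * H))).
  rewrite /incr_cov [`|p - s|]distrC [`|q - s|]distrC !subr0.
  by rewrite !ger0_norm; try lra; ring.
rewrite normrM (@ger0_norm _ 2^-1)//.
have E1 : `|q `^ (2 * H) - p `^ (2 * H)| <= 8 * p `^ (2 * H - 1) * `|q - p|.
  by apply: powR_MVT => //; try (apply/andP; split); lra.
have E2 : `|(s - p) `^ (2 * H) - (s - q) `^ (2 * H)| <= 8 * s `^ (2 * H - 1) * `|q - p|.
  have -> : q - p = (s - p) - (s - q) by ring.
  by apply: powR_MVT => //; try (apply/andP; split); lra.
apply: (@le_trans _ _ (2^-1 * (8 * p `^ (2 * H - 1) * `|q - p| + 8 * s `^ (2 * H - 1) * `|q - p|))).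
  by rewrite ler_wpM2l//; apply: le_trans (ler_normD _ _) _; exact: lerD.
rewrite {1 2}(pow_split (normr_ge0 (q - p))) !pow2H1//.
set A := `|q - p| `^ H; set B := `|q - p| `^ (1 - H).
have A0 : 0 <= A by exact: powR_ge0.
have B0 : 0 <= B by exact: powR_ge0.
have B1 : B <= 1 by rewrite pow_le1 ?normr_ge0.
have psH : p `^ H <= s `^ H.
  by apply: ge0_powR_le; rewrite ?(ltW H0) ?(ltW p0)//; lra.
have F1 : p `^ H * p `^ (H - 1) <= s `^ H * M `^ (H - 1).
  by apply: ler_pM; rewrite ?powR_ge0 ?powM.
have F2 : s `^ H * s `^ (H - 1) <= s `^ H * M `^ (H - 1).
  by rewrite ler_wpM2l ?powR_ge0 ?powM.
have -> : 2^-1 * (8 * (p `^ H * p `^ (H - 1)) * (A * B) + 8 * (s `^ H * s `^ (H - 1)) * (A * B)) =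
  4 * (p `^ H * p `^ (H - 1) + s `^ H * s `^ (H - 1)) * A * B by field.
have -> : 8 * M `^ (H - 1) * (A * s `^ H) =
  4 * (s `^ H * M `^ (H - 1) + s `^ H * M `^ (H - 1)) * A * 1 by ring.
apply: ler_pM; rewrite ?mulr_ge0 ?addr_ge0 ?mulr_ge0 ?powR_ge0//.
by rewrite ler_wpM2r// ler_wpM2l// lerD.
Qed.

(** Positions at two times of very different size. *)
Lemma incr_cov_origin t s : 0 < t -> M * t <= s ->
  `|incr_cov H 0 t 0 s| <= 8 * (M `^ (H - 1) + M `^ (- H)) * (t `^ H * s `^ H).
Proof.
move: (H0) (H1) (M4) => h0 h1 m4.
move=> t0 Mts.
have ts : 4 * t <= s by apply: le_trans Mts; rewrite ler_wpM2r ?(ltW t0).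
have s0 : 0 < s by lra.
have H2n : 2 * H != 0 by rewrite mulf_neq0 ?gt_eqF.
have tM : t <= s / M by rewrite ler_pdivlMr// mulrC.
have -> : incr_cov H 0 t 0 s = 2^-1 *
  (t `^ (2 * H) + (s `^ (2 * H) - (s - t) `^ (2 * H))).
  rewrite /incr_cov !(subr0, sub0r) normrN [`|t - s|]distrC normr0 powR0// subr0.
  by rewrite !ger0_norm; try lra; ring.
rewrite normrM (@ger0_norm _ 2^-1)//.
have E2 : `|s `^ (2 * H) - (s - t) `^ (2 * H)| <= 8 * s `^ (2 * H - 1) * t.
  have {2}-> : t = `|s - (s - t)|.
    by rewrite (_ : s - (s - t) = t) ?gtr0_norm//; ring.
  by apply: powR_MVT => //; try (apply/andP; split); lra.
apply: (@le_trans _ _ (2^-1 * (t `^ (2 * H) + 8 * s `^ (2 * H - 1) * t))).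
  rewrite ler_wpM2l//; apply: le_trans (ler_normD _ _) _.
  by rewrite (ger0_norm (powR_ge0 _ _)) lerD2l.
rewrite {2}(pow_split (ltW t0)) pow2H1// pow2H.
have F1 : t `^ H <= s `^ H * M `^ (- H).
  rewrite powRN -powR_inv1 ?powR_ge0// -powRAC powR_inv1 ?(ltW M0)//.
  rewrite -powRM ?invr_ge0 ?(ltW s0) ?(ltW M0)//.
  by apply: ge0_powR_le; rewrite ?(ltW H0) ?(ltW t0).
have F2 : s `^ (H - 1) * t `^ (1 - H) <= M `^ (H - 1).
  have -> : M `^ (H - 1) = s `^ (H - 1) * (s / M) `^ (1 - H).
    rewrite powRM ?invr_ge0 ?(ltW s0) ?(ltW M0)// mulrA -powD//.
    have -> : H - 1 + (1 - H) = 0 by ring.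
    rewrite powRr0 mul1r -powR_inv1 ?(ltW M0)// -powRrM; congr (_ `^ _); ring.
  rewrite ler_wpM2l ?powR_ge0//.
  by apply: ge0_powR_le => //; exact: ltW.
have -> : 2^-1 * (t `^ H * t `^ H + 8 * (s `^ H * s `^ (H - 1)) * (t `^ H * t `^ (1 - H))) =
  t `^ H * (2^-1 * t `^ H + 4 * s `^ H * (s `^ (H - 1) * t `^ (1 - H))) by field.
have -> : 8 * (M `^ (H - 1) + M `^ (- H)) * (t `^ H * s `^ H) =
  t `^ H * (8 * (s `^ H * M `^ (- H)) + 8 * s `^ H * M `^ (H - 1)) by ring.
rewrite ler_wpM2l ?powR_ge0//; apply: lerD.
  by rewrite ler_pM ?powR_ge0//; lra.
by rewrite ler_pM ?mulr_ge0 ?powR_ge0// ler_wpM2r ?powR_ge0//; lra.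
Qed.

(** A late position against a short increment that starts there. *)
Lemma incr_cov_adjacent t s : M <= t -> `|s - t| <= 1 ->
  `|incr_cov H 0 t t s| <= 8 * (M `^ (H - 1) + M `^ (- H)) * (t `^ H * `|s - t| `^ H).
Proof.
move: (H0) (H1) (M4) => h0 h1 m4.
move=> Mt st.
have t0 : 0 < t by exact: lt_le_trans Mt.
have [ts1 ts2] : t - 1 <= s /\ s <= t + 1.
  by move: st; rewrite ler_norml => /andP[? ?]; split; lra.
have H2n : 2 * H != 0 by rewrite mulf_neq0 ?gt_eqF.
have -> : incr_cov H 0 t t s = 2^-1 *
  ((s `^ (2 * H) - t `^ (2 * H)) - `|s - t| `^ (2 * H)).
  rewrite /incr_cov subrr !sub0r !normrN [`|t - s|]distrC normr0 powR0//.
  by rewrite (@ger0_norm _ s) ?(@ger0_norm _ t); try lra; ring.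
rewrite normrM (@ger0_norm _ 2^-1)//.
have E1 : `|s `^ (2 * H) - t `^ (2 * H)| <= 8 * t `^ (2 * H - 1) * `|s - t|.
  by apply: powR_MVT => //; try (apply/andP; split); lra.
apply: (@le_trans _ _ (2^-1 * (8 * t `^ (2 * H - 1) * `|s - t| + `|s - t| `^ (2 * H)))).
  rewrite ler_wpM2l//; apply: le_trans (ler_normB _ _) _.
  by rewrite (@ger0_norm _ (_ `^ _)) ?powR_ge0// lerD2r.
rewrite {1}(pow_split (normr_ge0 (s - t))) pow2H1// pow2H.
set A := `|s - t| `^ H; set B := `|s - t| `^ (1 - H).
have A0 : 0 <= A by exact: powR_ge0.
have B0 : 0 <= B by exact: powR_ge0.
have B1 : B <= 1 by rewrite pow_le1 ?normr_ge0.
have A1 : A <= 1 by rewrite pow_leH ?normr_ge0.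
have F1 : A <= M `^ (- H) * t `^ H.
  apply: le_trans A1 _; rewrite powRN mulrC ler_pdivlMr ?powR_gt0// mul1r.
  by apply: ge0_powR_le; rewrite ?(ltW H0) ?(ltW M0).
have F2 : t `^ (H - 1) * B <= M `^ (H - 1).
  by rewrite -[leRHS]mulr1 ler_pM ?powR_ge0 ?powM.
have -> : 2^-1 * (8 * (t `^ H * t `^ (H - 1)) * (A * B) + A * A) =
  A * (4 * t `^ H * (t `^ (H - 1) * B) + 2^-1 * A) by field.
have -> : 8 * (M `^ (H - 1) + M `^ (- H)) * (t `^ H * A) =
  A * (8 * t `^ H * M `^ (H - 1) + 8 * (M `^ (- H) * t `^ H)) by ring.
rewrite ler_wpM2l//; apply: lerD; last by rewrite ler_pM//; lra.
by rewrite ler_pM ?mulr_ge0 ?powR_ge0// ler_wpM2r ?powR_ge0//; lra.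
Qed.

End incr_cov.

(** * Normalised increments of fractional Brownian motion *)

Section fbm_increments.
Context {R : realType} d (T : measurableType d) (P : probability T R).
Variables (H : R) (X : R -> T -> R).
Hypotheses (H0 : 0 < H) (hX : fbm1 P H X).

Definition fbm_cov (t s : R) : R :=
  2^-1 * (`|t| `^ (2 * H) + `|s| `^ (2 * H) - `|t - s| `^ (2 * H)).

Lemma fbm1_measurable (t : R) : 0 <= t -> measurable_fun setT (X t).
Proof.
move=> t0; have [gX _ _ _] := hX.
have [mX _] := gX 1%N (fun=> t) (fun=> 1) (fun=> t0).
move: mX; congr measurable_fun; apply/funext => w.
by rewrite big_ord1 mul1r.
Qed.

Lemma fbm1_mean (t : R) : 0 <= t -> (\int[P]_w (X t w)%:E = 0)%E.
Proof. by move=> t0; have [_ + _ _] := hX => /(_ t t0); rewrite unlock. Qed.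

Lemma fbm1_cov (t s : R) : 0 <= t -> 0 <= s ->
  (\int[P]_w (X t w * X s w)%:E = (fbm_cov t s)%:E)%E.
Proof. by move=> t0 s0; have [_ _ + _] := hX => /(_ t s t0 s0); rewrite unlock. Qed.

Lemma fbm1_integrable_sqr (t : R) : 0 <= t ->
  P.-integrable setT (fun w => (X t w ^+ 2)%:E).
Proof.
move=> t0; have mX := fbm1_measurable t0.
apply/integrableP; split; first by apply/measurable_EFinP; exact: measurable_funX.
under eq_integral do rewrite abse_EFin ger0_norm ?sqr_ge0// expr2.
by rewrite fbm1_cov// ltry.
Qed.

Lemma fbm1_integrable_mul (t s : R) : 0 <= t -> 0 <= s ->
  P.-integrable setT (fun w => (X t w * X s w)%:E).
Proof.
move=> t0 s0; have mt := fbm1_measurable t0; have ms := fbm1_measurable s0.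
have i := integrableD measurableT (fbm1_integrable_sqr t0) (fbm1_integrable_sqr s0).
apply: (le_integrable measurableT _ _ i).
- by apply/measurable_EFinP; exact: measurable_funM.
- move=> w _; rewrite -EFinD !abse_EFin lee_fin normrM [leRHS]ger0_norm ?addr_ge0 ?sqr_ge0//.
  have := sqr_ge0 (`|X t w| - `|X s w|); rewrite sqrrB !real_normK ?num_real//.
  by have := mulr_ge0 (normr_ge0 (X t w)) (normr_ge0 (X s w)); lra.
Qed.

Lemma fbm1_integrable (t : R) : 0 <= t -> P.-integrable setT (fun w => (X t w)%:E).
Proof.
move=> t0; have mt := fbm1_measurable t0.
have i1 : P.-integrable setT (fun=> (1 : R)%:E) by exact: finite_measure_integrable_cst.
have i := integrableD measurableT i1 (fbm1_integrable_sqr t0).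
apply: (le_integrable measurableT _ _ i); first exact/measurable_EFinP.
move=> w _; rewrite -EFinD !abse_EFin lee_fin [leRHS]ger0_norm ?addr_ge0 ?sqr_ge0//.
have := sqr_ge0 (`|X t w| - 1); rewrite sqrrB real_normK ?num_real// expr1n mulr1.
by have := normr_ge0 (X t w); lra.
Qed.

(** Linear combinations of the process are centered Gaussian, hence their
    characteristic function is determined by the covariance. *)
Lemma Rintegral_cos_fbm (J : finType) (t a : J -> R) (p : R) :
  (forall j, 0 <= t j) ->
  \int[P]_w cos (p + \sum_j a j * X (t j) w) =
  cos p * expR (- (\sum_i \sum_j a i * a j * fbm_cov (t i) (t j)) / 2).
Proof.
move=> t0; pose Z w := \sum_j a j * X (t j) w.
have gZ : gaussian_rv P Z.
  have [gX _ _ _] := hX.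
  have := gX #|J| (t \o enum_val) (a \o enum_val) (fun i => t0 _).
  congr (gaussian_rv P); apply/funext => w; rewrite /Z.
  transitivity (\sum_(j in J) a j * X (t j) w); last exact: eq_bigl.
  by rewrite [RHS]big_enum_val.
apply: (Rintegral_cos_gaussian p gZ).
- transitivity (\int[P]_w (\sum_j (a j)%:E * (X (t j) w)%:E))%E.
    by apply: eq_integral => w _; rewrite /Z -sumEFin.
  rewrite integral_sum//; last by move=> j; apply: integrableZl => //; exact: fbm1_integrable.
  by rewrite big1// => j _; rewrite integralZl ?fbm1_mean ?mule0//; exact: fbm1_integrable.
- transitivity (\int[P]_w (\sum_i \sum_j (a i * a j)%:E * (X (t i) w * X (t j) w)%:E))%E.
    apply: eq_integral => w _; rewrite expr2 /Z mulr_suml -sumEFin.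
    apply: eq_bigr => i _; rewrite mulr_sumr -sumEFin; apply: eq_bigr => j _.
    by rewrite -EFinM; congr EFin; ring.
  have iij i j : P.-integrable setT (fun w => ((a i * a j)%:E * (X (t i) w * X (t j) w)%:E)%E).
    by apply: integrableZl => //; exact: fbm1_integrable_mul.
  rewrite integral_sum//; last by move=> i; exact: integrable_sum.
  rewrite -sumEFin; apply: eq_bigr => i _.
  rewrite integral_sum// -sumEFin; apply: eq_bigr => j _.
  by rewrite integralZl ?fbm1_cov//; exact: fbm1_integrable_mul.
Qed.

Context (I : finType) (p q : I -> R) (u : I -> bool).
Hypotheses (p0 : forall l, 0 <= p l) (q0 : forall l, 0 <= q l)
  (pq : forall l, q l != p l) (up : forall l, ~~ u l -> p l = 0).

(** Increments over [[p l, q l]] scaled to variance one. A family mixing genuine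
    increments and positions is needed, and [u l = false] marks the positions,
    that is the increments from time 0: using the value 0 there instead of
    [X 0] makes them equal to the position everywhere, not just almost surely. *)
Definition fbm_incr l w :=
  (X (q l) w - (if u l then X (p l) w else 0)) / `|q l - p l| `^ H.
Definition fbm_corr l m := incr_cov H (p l) (q l) (p m) (q m) /
  (`|q l - p l| `^ H * `|q m - p m| `^ H).

Let nu_gt0 l : 0 < `|q l - p l| `^ H.
Proof. by rewrite powR_gt0// normr_gt0 subr_eq0. Qed.

Lemma measurable_fbm_incr l : measurable_fun setT (fbm_incr l).
Proof.
apply: measurable_funM => //; apply: measurable_funB; first exact: fbm1_measurable.
by case: (u l) => //; exact: fbm1_measurable.
Qed.

Lemma fbm_corr_diag l : fbm_corr l l = 1.
Proof.
have nu := nu_gt0 l.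
rewrite /fbm_corr incr_cov_diag// -powRD; last first.
  by rewrite normr_eq0 subr_eq0 pq implybT.
have -> : 2 * H = H + H by ring.
rewrite divff// gt_eqF// powR_gt0//.
by rewrite normr_gt0 subr_eq0.
Qed.

Lemma fbm_corrC l m : fbm_corr l m = fbm_corr m l.
Proof. by rewrite /fbm_corr incr_covC [X in _ / X]mulrC. Qed.

Lemma fbm_cov0 s : fbm_cov 0 s = 0 /\ fbm_cov s 0 = 0.
Proof.
have H2 : 2 * H != 0 by rewrite mulf_neq0 ?gt_eqF.
rewrite /fbm_cov sub0r subr0 normrN !normr0 powR0//; split; ring.
Qed.

(** The normalised increments satisfy the hypothesis on characteristic
    functions of the section on nearly orthonormal families, with covariance
    [fbm_corr]. *)
Lemma Rintegral_cos_fbm_incr (x : I -> R) (th : R) :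
  \int[P]_w cos (th + \sum_l x l * fbm_incr l w) =
  cos th * expR (- qform fbm_corr x / 2).
Proof.
pose nu l := `|q l - p l| `^ H.
pose t (j : bool * I) := if j.1 then q j.2 else p j.2.
pose a (j : bool * I) := if j.1 then x j.2 / nu j.2
  else - (if u j.2 then x j.2 / nu j.2 else 0).
have t0 j : 0 <= t j by rewrite /t; case: ifP.
have sumE (F : bool * I -> R) : \sum_j F j = \sum_l (F (true, l) + F (false, l)).
  rewrite (eq_bigr (fun j => F (j.1, j.2))); last by case.
  by rewrite -(pair_bigA _ (fun b l => F (b, l)))/= big_bool big_split.
have := Rintegral_cos_fbm a th t0.
have -> : \sum_i \sum_j a i * a j * fbm_cov (t i) (t j) = qform fbm_corr x.
  rewrite sumE /qform; apply: eq_bigr => l _.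
  rewrite !sumE -big_split/=; apply: eq_bigr => m _.
  rewrite /t /a/= /fbm_corr -/(nu l) -/(nu m).
  have ul (v s : R) : (if u l then v else 0) * fbm_cov (p l) s = v * fbm_cov (p l) s.
    by case: ifPn => // /up ->; rewrite (fbm_cov0 s).1 !mulr0.
  have um (v s : R) : (if u m then v else 0) * fbm_cov s (p m) = v * fbm_cov s (p m).
    by case: ifPn => // /up ->; rewrite (fbm_cov0 s).2 !mulr0.
  have := ul (x l / nu l); have := um (x m / nu m).
  set A := x l / nu l; set B := x m / nu m.
  set U := if u l then _ else _; set V := if u m then _ else _ => um' ul'.
  have UV : V * (U * fbm_cov (p l) (p m)) = A * (B * fbm_cov (p l) (p m)).
    by rewrite ul' mulrCA um'.
  have -> : A * B * fbm_cov (q l) (q m) + A * - V * fbm_cov (q l) (p m) +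
      (- U * B * fbm_cov (p l) (q m) + - U * - V * fbm_cov (p l) (p m)) =
      A * B * fbm_cov (q l) (q m) - A * (V * fbm_cov (q l) (p m)) -
      B * (U * fbm_cov (p l) (q m)) + V * (U * fbm_cov (p l) (p m)) by ring.
  rewrite UV ul' um' /A /B.
  have nl := lt0r_neq0 (nu_gt0 l); have nm := lt0r_neq0 (nu_gt0 m).
  by rewrite /fbm_cov /incr_cov; field; rewrite -/(nu l) -/(nu m) nl nm.
move=> <-; apply: eq_Rintegral => w _; congr (cos (_ + _)).
rewrite sumE; apply: eq_bigr => l _; rewrite /a /t/= /fbm_incr -/(nu l).
by case: ifP => _; ring.
Qed.

End fbm_increments.

(** * One coordinate at well separated times *)

Section separated_times.
Context {R : realType} d (T : measurableType d) (P : probability T R).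
Variables (H M kappa : R) (k : nat) (tau : 'I_k -> R) (X : R -> T -> R).
Hypotheses (H0 : 0 < H) (H1 : H < 1) (M4 : 4 <= M)
  (tauM : forall i, M <= tau i)
  (tau_sep : forall i j : 'I_k, (i < j)%N -> M * (tau i + 1) <= tau j)
  (hX : fbm1 P H X).
Let delta : R := 8 * (M `^ (H - 1) + M `^ (- H)).
Hypotheses (dk : delta * (2 * k)%:R <= kappa) (k14 : kappa <= 4^-1).

Let M0 : 0 < M. Proof. exact: lt_le_trans M4. Qed.

Let delta0 : 0 <= delta.
Proof. by rewrite mulr_ge0// addr_ge0 ?powR_ge0. Qed.

Let delta1 : 8 * M `^ (H - 1) <= delta.
Proof. by rewrite /delta ler_wpM2l// lerDl powR_ge0. Qed.

Variables (t s : 'I_k -> R).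
Hypotheses (ht : forall i, tau i <= t i <= tau i + 1)
  (hs : forall i, tau i <= s i <= tau i + 1).

Let tM i : M <= t i. Proof. by apply: le_trans (tauM i) _; case/andP: (ht i). Qed.
Let t_gt0 i : 0 < t i. Proof. by apply: lt_le_trans (tM i); apply: lt_le_trans M4. Qed.
Let s_gt0 i : 0 < s i.
Proof.
case/andP: (hs i) => h _; apply: lt_le_trans h; apply: lt_le_trans (tauM i).
exact: lt_le_trans M4.
Qed.
Let st1 i : `|s i - t i| <= 1.
Proof. by have /andP[? ?] := ht i; have /andP[? ?] := hs i; rewrite ler_norml; apply/andP; split; lra. Qed.

Let tt_sep (i j : 'I_k) : (i < j)%N -> M * t i <= t j.
Proof.
move=> ij; have /andP[_ h1] := ht i; have /andP[h2 _] := ht j.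
apply: le_trans h2; apply: le_trans (tau_sep ij); rewrite ler_wpM2l//.
exact: le_trans M4.
Qed.

Let t4 (i j : 'I_k) : (i < j)%N -> 0 <= t i <= t j / 4.
Proof.
move=> ij; rewrite ltW//= ler_pdivlMr// mulrC; apply: le_trans (tt_sep ij).
by rewrite ler_wpM2r// ltW.
Qed.

Let s4 (i j : 'I_k) : (i < j)%N -> 0 <= s i <= t j / 4.
Proof.
move=> ij; rewrite ltW//= ler_pdivlMr// mulrC.
have /andP[h2 _] := ht j; apply: le_trans h2; apply: le_trans (tau_sep ij).
have /andP[_ h1] := hs i; apply: (@le_trans _ _ (4 * (tau i + 1))).
  by rewrite ler_wpM2l.
by rewrite ler_wpM2r// addr_ge0//; apply: le_trans (tauM i); apply: le_trans M4.
Qed.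

Let corr_le (p q p' q' B : R) : B <= delta -> 0 < `|q - p| -> 0 < `|q' - p'| ->
  `|incr_cov H p q p' q'| <= B * (`|q - p| `^ H * `|q' - p'| `^ H) ->
  `|incr_cov H p q p' q' / (`|q - p| `^ H * `|q' - p'| `^ H)| <= delta.
Proof.
move=> Bd h1 h2 h; rewrite normrM normfV.
have n0 : 0 < `|q - p| `^ H * `|q' - p'| `^ H by rewrite mulr_gt0 ?powR_gt0.
by rewrite (gtr0_norm n0) ler_pdivrMr//; apply: le_trans h _; rewrite ler_wpM2r ?(ltW n0).
Qed.

Let norm_t i : `|t i - 0| = t i. Proof. by rewrite subr0 gtr0_norm. Qed.

Let u1 (l : 'I_k) := false.
Let p1 (l : 'I_k) : R := 0.

Lemma position_corr_le i j : i != j -> `|fbm_corr H p1 t i j| <= delta.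
Proof.
wlog ij : i j / (i < j)%N.
  move=> W ij; have [|] := ltnP i j; first by move=> lt; exact: W.
  rewrite leq_eqVlt => /orP[/eqP ji|ji]; first by move: ij; rewrite (val_inj ji) eqxx.
  by rewrite fbm_corrC; apply: W; rewrite // eq_sym.
move=> _; apply: corr_le (lexx _) _ _ _; rewrite /p1 ?norm_t//.
by apply: incr_cov_origin => //; exact: tt_sep.
Qed.

Let p2 (l : bool * 'I_k) : R := if l.1 then t l.2 else 0.
Let q2 (l : bool * 'I_k) : R := if l.1 then s l.2 else t l.2.
Hypothesis st_neq : forall i, s i != t i.

Let st_gt0 i : 0 < `|s i - t i|. Proof. by rewrite normr_gt0 subr_eq0. Qed.

(** The family consists of the positions at the times [t i] and of the
    increments over [[t i, s i]]. These [2 k] normalised variables are nearly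
    orthonormal as soon as the blocks of times are far apart on a geometric
    scale, however close [s i] is to [t i]; hence the pair of positions at [t i]
    and [s i], whose correlation may tend to 1, is never used directly. *)
Lemma position_increment_corr_le l m : l != m -> `|fbm_corr H p2 q2 l m| <= delta.
Proof.
have W (i j : 'I_k) : (i < j)%N -> forall a b, `|fbm_corr H p2 q2 (a, i) (b, j)| <= delta.
  move=> ij [] []; rewrite /fbm_corr /p2 /q2/=.
  - by apply: (corr_le delta1) => //; apply: incr_cov_far => //; [exact: t4|exact: s4].
  - apply: (corr_le delta1); rewrite ?norm_t//; apply: incr_cov_base => //.
      by case/andP: (t4 ij).
    by case/andP: (s4 ij).
  - apply: (corr_le delta1); rewrite ?norm_t//.
    rewrite -{2}(norm_t i); apply: incr_cov_far => //; last exact: t4.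
    by rewrite lexx/= divr_ge0// ltW.
  - apply: (corr_le (lexx _)); rewrite ?norm_t//; apply: incr_cov_origin => //.
    exact: tt_sep.
case: l m => [a i] [b j]; have [ij|ij|/val_inj ij] := ltngtP i j.
- by move=> _; exact: W.
- by move=> _; rewrite fbm_corrC; exact: W.
rewrite ij; case: a b => [] []; rewrite ?eqxx// => _; last first.
  rewrite /fbm_corr /p2 /q2/=; apply: (corr_le (lexx _)); rewrite ?norm_t//.
  exact: incr_cov_adjacent.
rewrite fbm_corrC /fbm_corr /p2 /q2/=; apply: (corr_le (lexx _)); rewrite ?norm_t//.
exact: incr_cov_adjacent.
Qed.

(** The probability density of passing close to [x] at all the times [t i] is
    bounded below. The targets [x / t i `^ H] are small because the times are
    large. *)
Lemma position_bumps_ge (x e : R) : 0 < e -> e <= 1 ->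
  k%:R * (x * M `^ (- H)) ^+ 2 <= kappa -> 16 * kappa * 2 ^+ k <= 1 ->
  2^-1 * \prod_i (e / (2 * (tau i + 1) `^ H)) <=
  \int[P]_w \prod_i expR (- ((X (t i) w - x) / e) ^+ 2 / 2).
Proof.
move=> e0 e1 hx k16.
pose z l := x / t l `^ H; pose f l := e / t l `^ H.
have tH l : 0 < t l `^ H by rewrite powR_gt0.
have f0 l : 0 < f l by rewrite divr_gt0.
have tH1 l : 1 <= t l `^ H.
  rewrite -[leLHS](powRr0 (t l)); apply: ler_powR; last exact: ltW.
  by apply: le_trans (tM l); apply: le_trans M4; rewrite ler1n.
have p10 l : 0 <= p1 l by [].
have t0 l : 0 <= t l by exact: ltW.
have tp l : t l != p1 l by rewrite gt_eqF.
have dk' : delta * #|'I_k|%:R <= kappa.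
  by apply: le_trans dk; rewrite card_ord ler_wpM2l// ler_nat leq_pmull.
have mI l : measurable_fun setT (fbm_incr H X p1 t u1 l).
  exact: (measurable_fbm_incr hX).
have c1 l : fbm_corr H p1 t l l = 1 by exact: fbm_corr_diag.
have cosI := Rintegral_cos_fbm_incr H0 hX p10 t0 tp (fun (l : 'I_k) (_ : ~~ u1 l) => erefl (p1 l)).
have := Rintegral_prod_bump_ge mI c1 delta0 position_corr_le dk' k14 cosI (z := z) f0.
rewrite card_ord => /(_ _ k16); set zk := (X in (X -> _) -> _).
have hz : zk.
  rewrite /zk; apply: le_trans hx; rewrite -[X in X%:R]card_ord mulr_natl -sumr_const.
  apply: ler_sum => l _; rewrite /z !exprMn ler_wpM2l ?sqr_ge0//.
  rewrite powRN lerXn2r ?nnegrE ?invr_ge0 ?powR_ge0//.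
  rewrite lef_pV2 ?posrE ?powR_gt0//.
  by apply: ge0_powR_le; rewrite ?(ltW H0) ?(ltW M0).
move=> /(_ hz) h; apply: le_trans (le_trans _ h) _.
  rewrite ler_wpM2l//; apply: ler_prod => l _; rewrite divr_ge0 ?(ltW e0) ?mulr_ge0 ?powR_ge0//=.
  have el : e / f l = t l `^ H by rewrite /f; field; rewrite !gt_eqF.
  rewrite /shrink -[leLHS]invf_div lef_pV2 ?posrE ?divr_gt0 ?mulr_gt0 ?powR_gt0 ?sqrtr_gt0 ?ltr_wpDr ?divr_ge0 ?sqr_ge0//; last first.
    exact: lt_le_trans (tauM l).
  set a := t l `^ H / e; have a1 : 1 <= a by rewrite ler_pdivlMr// mul1r (le_trans e1).
  have -> : 1 / f l ^+ 2 = a ^+ 2 by rewrite /f /a; field; rewrite !gt_eqF.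
  apply: (@le_trans _ _ (2 * a)).
    have a2 : 0 <= 2 * a by rewrite mulr_ge0// (le_trans ler01).
    rewrite -(ger0_norm a2) -sqrtr_sqr ler_sqrt ?sqr_ge0//.
    have : 1 <= a ^+ 2 by rewrite expr_ge1// (le_trans ler01).
    have -> : (2 * a) ^+ 2 = 4 * a ^+ 2 by ring.
    lra.
  rewrite /a -mulrA ler_wpM2l// ler_wpM2r ?invr_ge0 ?(ltW e0)//.
  by apply: ge0_powR_le; rewrite ?(ltW H0) ?(ltW (t_gt0 l))//; case/andP: (ht l).
rewrite le_eqVlt; apply/orP; left; apply/eqP; apply: eq_Rintegral => w _.
apply: eq_bigr => l _; rewrite /bump; congr (expR (- (_ ^+ 2) / 2)).
rewrite /fbm_incr /z /f /u1 /p1 norm_t subr0.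
by field; rewrite !gt_eqF.
Qed.

(** A bound for the joint density of the positions at the times [t i] near [x]
    and at the times [s i] near [y]. The bumps at [X (t i) - x] and
    [X (s i) - y] are dominated by bumps at the position [X (t i) - x] and at
    the increment [X (s i) - X (t i) - (y - x)], by the inequality
    [a ^+ 2 + (b - a) ^+ 2 <= 3 * (a ^+ 2 + b ^+ 2)], which triples the variance
    of the bumps; the decay in the increment of index [i0] is kept. *)
Lemma position_increment_bumps_le (x y e : R) i0 : 0 < e ->
  \int[P]_w \prod_i
    expR (- (((X (t i) w - x) ^+ 2 + (X (s i) w - y) ^+ 2) / (2 * e ^+ 2))) <=
  4 ^+ k * \prod_i ((3 * e ^+ 2) / Num.sqrt (3 * e ^+ 2 + `|s i - t i| `^ (2 * H))) *
  expR (- ((y - x) ^+ 2 / (2 * (3 * e ^+ 2 + `|s i0 - t i0| `^ (2 * H))))).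
Proof.
move=> e0; set c := 3 * e ^+ 2.
have c0 : 0 < c by rewrite mulr_gt0// exprn_gt0.
pose r := Num.sqrt c; have r0 : 0 < r by rewrite sqrtr_gt0.
have r2 : r ^+ 2 = c by rewrite sqr_sqrtr// ltW.
pose nu (l : bool * 'I_k) := `|q2 l - p2 l| `^ H.
have nu0 l : 0 < nu l.
  by rewrite powR_gt0// /q2 /p2; case: l => [[] i]/=; rewrite ?norm_t.
pose z (l : bool * 'I_k) := (if l.1 then y - x else x) / nu l; pose f l := r / nu l.
have f0 l : 0 < f l by rewrite divr_gt0.
pose u2 (l : bool * 'I_k) := l.1.
have p20 l : 0 <= p2 l by rewrite /p2; case: ifP => // _; exact: ltW.
have q20 l : 0 <= q2 l by rewrite /q2; case: ifP => // _; exact: ltW.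
have pq l : q2 l != p2 l.
  by rewrite /q2 /p2; case: ifP => // _; rewrite gt_eqF.
have dk' : delta * #|{: bool * 'I_k}|%:R <= kappa.
  by rewrite card_prod card_bool card_ord.
have mI l : measurable_fun setT (fbm_incr H X p2 q2 u2 l).
  exact: (measurable_fbm_incr hX).
have c1 l : fbm_corr H p2 q2 l l = 1 by exact: fbm_corr_diag.
have up l : ~~ u2 l -> p2 l = 0 by rewrite /u2 /p2 => /negPf ->.
have cosI := Rintegral_cos_fbm_incr H0 hX p20 q20 pq up.
have B := Rintegral_prod_bump_le mI c1 (fbm_corrC H p2 q2) delta0
  position_increment_corr_le dk' k14 cosI z f0 (true, i0).
have pairE (F : bool * 'I_k -> R) : \prod_l F l = \prod_i (F (true, i) * F (false, i)).
  rewrite (eq_bigr (fun l => F (l.1, l.2))); last by case.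
  by rewrite -(pair_bigA _ (fun b i => F (b, i)))/= big_bool big_split.
have nuE i : nu (true, i) = `|s i - t i| `^ H by [].
have nu2 i : nu (true, i) ^+ 2 = `|s i - t i| `^ (2 * H).
  by rewrite nuE mulrC powRrM powR_mulrn ?powR_ge0.
apply: le_trans (le_trans _ B) _.
  apply: le_Rintegral => //.
  - apply: (@bounded_integrable_prob _ _ _ P _ 1).
      apply: measurable_prod => i _; apply: measurableT_comp => //.
      apply: measurableT_comp => //; apply: measurable_funM => //.
      by apply: measurable_funD; apply: measurable_funX; apply: measurable_funB => //;
        apply: (fbm1_measurable hX); rewrite ltW.
    move=> w; rewrite ger0_norm; last by apply: prodr_ge0 => i _; exact: expR_ge0.
    apply: prodr_ile1 => i _; rewrite expR_ge0 -expR0 ler_expR oppr_le0.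
    by rewrite divr_ge0 ?addr_ge0 ?sqr_ge0// mulr_ge0 ?sqr_ge0.
  - apply: (@bounded_integrable_prob _ _ _ P _ 1).
      by apply: measurable_prod => l _; exact: measurable_bump.
    exact: norm_prod_bump_le1.
  - move=> w _; rewrite pairE; apply: ler_prod => i _; rewrite expR_ge0/= /bump -expRD ler_expR.
    have n1 := lt0r_neq0 (nu0 (true, i)); have n2 := lt0r_neq0 (nu0 (false, i)).
    have -> : (fbm_incr H X p2 q2 u2 (true, i) w - z (true, i)) / f (true, i) =
        ((X (s i) w - y) - (X (t i) w - x)) / r.
      rewrite /fbm_incr /z /f -/(nu (true, i))/= /p2 /q2/=; field.
      by rewrite n1 gt_eqF.
    have -> : (fbm_incr H X p2 q2 u2 (false, i) w - z (false, i)) / f (false, i) =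
        (X (t i) w - x) / r.
      rewrite /fbm_incr /z /f -/(nu (false, i))/= /p2 /q2/= subr0; field.
      by rewrite n2 gt_eqF.
    rewrite !exprMn exprVn r2 /c.
    set a := X (t i) w - x; set b := X (s i) w - y.
    have -> : - ((b - a) ^+ 2 / (3 * e ^+ 2)) / 2 + - (a ^+ 2 / (3 * e ^+ 2)) / 2 =
       - (((b - a) ^+ 2 + a ^+ 2) / 3 / (2 * e ^+ 2)).
      by field; rewrite gt_eqF.
    have h : ((b - a) ^+ 2 + a ^+ 2) / 3 <= a ^+ 2 + b ^+ 2.
      have := sqr_ge0 (a + b); have := sqr_ge0 b.
      have -> : (a + b) ^+ 2 = a ^+ 2 + 2 * (a * b) + b ^+ 2 by ring.
      have -> : (b - a) ^+ 2 = a ^+ 2 - 2 * (a * b) + b ^+ 2 by ring.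
      lra.
    rewrite lerN2; apply: ler_wpM2r => //.
    by rewrite invr_ge0 mulr_ge0 ?sqr_ge0.
rewrite card_prod card_bool card_ord exprM.
have -> : (2 : R) ^+ 2 = 4 by rewrite -natrX.
have -> : z (true, i0) ^+ 2 / (2 * (1 + f (true, i0) ^+ 2)) =
    (y - x) ^+ 2 / (2 * (c + `|s i0 - t i0| `^ (2 * H))).
  rewrite /z /f/= -nu2 -r2; have n1 := lt0r_neq0 (nu0 (true, i0)).
  field; rewrite n1 andbT.
  have h : 0 < nu (true, i0) ^+ 2 + r ^+ 2 by rewrite addr_gt0 ?exprn_gt0.
  by rewrite !gt_eqF// addrC.
rewrite ler_wpM2r ?expR_ge0// ler_wpM2l ?exprn_ge0// pairE.
have sh l : 0 <= shrink f 1 l by rewrite ltW// shrink_gt0.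
apply: ler_prod => i _; rewrite mulr_ge0 ?sh//=.
have n1 := lt0r_neq0 (nu0 (true, i)); have n2 := lt0r_neq0 (nu0 (false, i)).
have -> : c / Num.sqrt (c + `|s i - t i| `^ (2 * H)) = r / Num.sqrt (c + `|s i - t i| `^ (2 * H)) * r.
  by rewrite -r2; ring.
apply: ler_pM; rewrite ?sh//.
  have h1 : 0 < Num.sqrt (1 + 1 / f (true, i) ^+ 2).
    by rewrite sqrtr_gt0 ltr_wpDr// divr_ge0// sqr_ge0.
  have h2 : 0 < Num.sqrt (c + `|s i - t i| `^ (2 * H)) / r.
    by rewrite divr_gt0// sqrtr_gt0 ltr_wpDr// powR_ge0.
  rewrite /shrink -[leRHS]invf_div lef_pV2 ?posrE//.
  have er : r = Num.sqrt (r ^+ 2) by rewrite sqrtr_sqr gtr0_norm.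
  rewrite ler_pdivrMr// [X in _ <= _ * X]er -sqrtrM; last first.
    by rewrite addr_ge0// divr_ge0// sqr_ge0.
  rewrite ler_sqrt; last by rewrite mulr_ge0 ?sqr_ge0// addr_ge0// divr_ge0// sqr_ge0.
  rewrite le_eqVlt; apply/orP; left; apply/eqP; rewrite -nu2 -r2 /f; field.
  by rewrite n1 gt_eqF.
rewrite /shrink -[leRHS]invrK lef_pV2 ?posrE ?invr_gt0//; last first.
  by rewrite sqrtr_gt0 ltr_wpDr// divr_ge0// sqr_ge0.
have er : r^-1 = Num.sqrt (r^-1 ^+ 2) by rewrite sqrtr_sqr gtr0_norm// invr_gt0.
rewrite er ler_sqrt; last first.
  by rewrite addr_ge0// divr_ge0// sqr_ge0.
have nf : 1 <= nu (false, i).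
  rewrite /nu /q2 /p2/= norm_t -[leLHS](powRr0 (t i)).
  apply: ler_powR; last exact: ltW.
  by apply: le_trans (tM i); apply: le_trans M4; rewrite ler1n.
have -> : 1 / f (false, i) ^+ 2 = nu (false, i) ^+ 2 * r^-1 ^+ 2.
  by rewrite /f; field; rewrite n2 gt_eqF.
have : r^-1 ^+ 2 <= nu (false, i) ^+ 2 * r^-1 ^+ 2.
  by rewrite ler_peMl ?sqr_ge0// expr_ge1// (le_trans ler01).
lra.
Qed.

End separated_times.

(** * Expectation of a product of independent functions *)

Section independence.
Context {R : realType} d (T : measurableType d) (P : probability T R).
Variables (n : nat) (F : 'I_n -> set (set T)) (G : 'I_n -> T -> R).
Hypotheses (Fm : forall i, F i `<=` measurable) (indF : mutually_independent P F)
  (GF : forall i B, measurable B -> F i (G i @^-1` B))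
  (G01 : forall i w, 0 <= G i w <= 1).

Let mG i : measurable_fun setT (G i).
Proof. by move=> _ B mB; rewrite setTI; apply: Fm; exact: GF. Qed.

Let mcap (J : {set 'I_n}) (A : 'I_n -> set T) : (forall i, i \in J -> F i (A i)) ->
  measurable (\bigcap_(i in [set` J]) A i).
Proof.
move=> FA; apply: fin_bigcap_measurable; first exact: finite_finset.
by move=> i iJ; apply: Fm; apply: FA.
Qed.

Let prod01 s w : 0 <= \prod_(i <- s) G i w <= 1.
Proof.
apply/andP; split; first by apply: prodr_ge0 => i _; case/andP: (G01 i w).
by apply: prodr_ile1 => i _; exact: G01.
Qed.

Let mprod s : measurable_fun setT (fun w => \prod_(i <- s) G i w).
Proof. by apply: measurable_prod => i _; exact: mG. Qed.

Let iG i : P.-integrable setT (EFin \o G i).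
Proof.
apply: (@bounded_integrable_prob _ _ _ P (G i) 1) => [|w]; first exact: mG.
by case/andP: (G01 i w) => ? ?; rewrite ger0_norm.
Qed.

(** Independence is given for events. The functions are brought in one at a
    time, the remaining factors being indicators: for fixed other factors both
    sides define a measure on the events of the next sigma-algebra, and they
    agree there by induction. *)
Let prod_indic s : uniq s -> forall (J : {set 'I_n}) (A : 'I_n -> set T),
  (forall i, i \in s -> i \notin J) -> (forall i, i \in J -> F i (A i)) ->
  (\int[P]_w (\prod_(i <- s) G i w * \1_(\bigcap_(i in [set` J]) A i) w)%:E =
   (\prod_(i <- s) \int[P]_w G i w)%:E * P (\bigcap_(i in [set` J]) A i))%E.
Proof.
elim: s => [_ J A _ FA|i s IH /= /andP[is_ us] J A sJ FA].
  rewrite big_nil mul1e; under eq_integral do rewrite big_nil mul1r.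
  by rewrite integral_indic ?setIT//; exact: mcap.
set K := \bigcap_(i in _) _; have mK : measurable K by exact: mcap.
have PK : P K \is a fin_num by exact: fin_num_measure.
set c := \prod_(j <- s) \int[P]_w G j w.
have c0 : 0 <= c.
  by apply: prodr_ge0 => j _; apply: Rintegral_ge0 => w _; case/andP: (G01 j w).
pose g1 w := \prod_(j <- s) G j w * \1_K w.
have same B : measurable B -> (\int[P]_(w in G i @^-1` B) (g1 w)%:E =
    \int[P]_(w in G i @^-1` B) (c * fine (P K))%:E)%E.
  move=> mB; have mGB : measurable (G i @^-1` B) by apply: Fm; exact: GF.
  rewrite integral_cst//.
  pose A' j := if j == i then G i @^-1` B else A j.
  have FA' (j : 'I_n) : j \in i |: J -> F j (A' j).
    rewrite /A' in_setU1; case: eqP => [-> _|_ /= jJ]; first exact: GF.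
    exact: FA.
  have iJ : i \notin J by rewrite sJ ?inE ?eqxx.
  have AA' (j : 'I_n) : j \in J -> A' j = A j.
    by move=> jJ; rewrite /A'; case: eqP => // ji; rewrite -ji jJ in iJ.
  have capE : \bigcap_(j in [set` i |: J]) A' j = (G i @^-1` B) `&` K.
    apply/seteqP; split=> [w h|w [h1 h2] j /=].
      split; first by have := h i; rewrite /= in_setU1 eqxx /A' eqxx; apply.
      by move=> j /= jJ; rewrite -AA'//; apply: h; rewrite /= in_setU1 jJ orbT.
    rewrite in_setU1 /A'; case: eqP => [//|_ /= jJ]; exact: h2.
  have := IH us (i |: J) A' _ FA'; rewrite capE => IH'.
  have -> : (\int[P]_(w in G i @^-1` B) (g1 w)%:E =
      \int[P]_w (\prod_(j <- s) G j w * \1_((G i @^-1` B) `&` K) w)%:E)%E.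
    rewrite integral_mkcond; apply: eq_integral => w _.
    by rewrite epatch_indic /g1 indicI/= -EFinM; congr EFin; ring.
  rewrite IH'; last first.
    move=> j js; rewrite in_setU1 negb_or sJ ?inE ?js ?orbT// andbT.
    by apply: contraNneq is_ => <-.
  have indK : P ((G i @^-1` B) `&` K) = (P (G i @^-1` B) * P K)%E.
    rewrite -capE (indF FA') big_setU1//= {1}/A' eqxx; congr (_ * _)%E.
    by rewrite /K (indF FA); apply: eq_bigr => j jJ; rewrite AA'.
  by rewrite indK EFinM fineK// -[RHS]muleA; congr (_ * _)%E; exact: muleC.
have mg1 : measurable_fun setT g1.
  by apply: measurable_funM => //; exact: measurable_indic.
have g10 w : 0 <= g1 w by rewrite mulr_ge0//; case/andP: (prod01 s w).
have cP0 : 0 <= c * fine (P K) by rewrite mulr_ge0// fine_ge0.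
have := @ge0_integral_same_law _ _ _ _ _ P P (G i) (G i) g1 (cst (c * fine (P K)))
  (mG i) (mG i) mg1 (measurable_cst _) g10 (fun=> cP0) same (fun x => (`|x|)%:E) _ _.
have -> : (\int[P]_w (\prod_(j <- i :: s) G j w * \1_K w)%:E =
    \int[P]_w ((`|G i w|)%:E * (g1 w)%:E))%E.
  apply: eq_integral => w _; rewrite big_cons /g1 -EFinM; congr EFin.
  by case/andP: (G01 i w) => g0 _; rewrite ger0_norm// mulrA.
move=> ->; first last.
- by move=> x; rewrite lee_fin.
- by apply/measurable_EFinP; exact: normr_measurable.
transitivity (\int[P]_w ((c * fine (P K))%:E * (G i w)%:E))%E.
  apply: eq_integral => w _; rewrite muleC.
  by case/andP: (G01 i w) => g0 _; rewrite ger0_norm.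
rewrite (integralZl measurableT (iG i)) /= (EFin_Rintegral measurableT (iG i)) big_cons -/c.
by rewrite -[in RHS](fineK PK) -!EFinM; congr EFin; ring.
Qed.

Lemma Rintegral_prod_indep :
  \int[P]_w \prod_i G i w = \prod_i \int[P]_w G i w.
Proof.
have := @prod_indic (index_enum 'I_n) (index_enum_uniq _) finset.set0 (fun=> setT).
have -> : \bigcap_(i in [set` (finset.set0 : {set 'I_n})]) (setT : set T) = setT.
  by apply/seteqP; split=> // w _ i; rewrite /= inE.
rewrite probability_setT mule1 => h.
rewrite -[RHS]/(fine (_)%:E) -h ?index_enum_uniq//; [|by move=> i; rewrite inE..].
by congr fine; apply: eq_integral => w _; rewrite indicT mulr1.
Qed.

End independence.

(** * Smoothed densities of the vector process *)

Lemma measurable_generated (R : realType) d (T : measurableType d) (X : R -> T -> R) (t : R) :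
  0 <= t ->
  @measurable_fun _ _ (g_sigma_algebraType (\bigcup_(t in [set t : R | 0 <= t])
        preimage_set_system [set: T] (X t) measurable)) R setT (X t).
Proof.
move=> t0 _ B mB; apply: sub_sigma_algebra; exists t => //=.
by exists B.
Qed.

Lemma process_sigma_algebra_sub (R : realType) d (T : measurableType d) (X : R -> T -> R) :
  (forall t, 0 <= t -> measurable_fun setT (X t)) ->
  process_sigma_algebra X `<=` measurable.
Proof.
move=> mX; apply: smallest_sub; first exact: sigma_algebra_measurable.
by move=> A [t /= t0] [B mB <-]; exact: mX.
Qed.

Definition gauss_kernel {R : realType} {n} (e : R) (v : 'rV[R]_n) : R :=
  expR (- ((\sum_j v 0 j ^+ 2) / (2 * e ^+ 2))).

Section fbm_densities.
Context {R : realType} disp (T : measurableType disp) (P : probability T R).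
Variables (d k : nat) (H M kappa : R) (B : R -> T -> 'rV[R]_d) (tau : 'I_k -> R).
Hypotheses (H0 : 0 < H) (H1 : H < 1) (M4 : 4 <= M)
  (tauM : forall i, M <= tau i)
  (tau_sep : forall i j : 'I_k, (i < j)%N -> M * (tau i + 1) <= tau j)
  (hB : fbm P H B)
  (dk : 8 * (M `^ (H - 1) + M `^ (- H)) * (2 * k)%:R <= kappa) (k14 : kappa <= 4^-1).

Lemma expR_sum (I : Type) (s : seq I) (f : I -> R) :
  expR (\sum_(i <- s) f i) = \prod_(i <- s) expR (f i).
Proof. exact: (big_morph _ (@expRD R) (@expR0 R)). Qed.

Lemma gauss_kernelE (e : R) (v : 'rV[R]_d) :
  gauss_kernel e v = \prod_j expR (- (v 0 j ^+ 2 / (2 * e ^+ 2))).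
Proof. by rewrite -expR_sum /gauss_kernel mulr_suml sumrN. Qed.

(** The coordinates are independent, so that estimates for the vector process
    are [d]-th powers of those for one coordinate. *)
Lemma Rintegral_prod_coordinates (G : 'I_d -> T -> R) :
  (forall j w, 0 <= G j w <= 1) ->
  (forall j, @measurable_fun _ _ (g_sigma_algebraType (\bigcup_(t in [set t : R | 0 <= t])
        preimage_set_system [set: T] (fun w => B t w 0 j) measurable)) R setT (G j)) ->
  \int[P]_w \prod_j G j w = \prod_j \int[P]_w G j w.
Proof.
move=> G01 mG; have [hfbm ind] := hB.
apply: (Rintegral_prod_indep _ ind) => //.
- move=> j; apply: process_sigma_algebra_sub => t t0.
  by apply: (fbm1_measurable (hfbm j)).
- by move=> j A mA; have := mG j measurableT A mA; rewrite setTI.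
Qed.

Lemma position_bound (t : 'I_k -> R) (x : 'rV[R]_d) (e K : R) :
  (forall i, tau i <= t i <= tau i + 1) -> 0 < e -> e <= 1 ->
  (forall j, `|x 0 j| <= K) ->
  k%:R * (K * M `^ (- H)) ^+ 2 <= kappa -> 16 * kappa * 2 ^+ k <= 1 ->
  (2^-1 * \prod_i (2 * (tau i + 1) `^ H)^-1) ^+ d * (e ^+ d) ^+ k <=
  \int[P]_w \prod_i gauss_kernel e (B (t i) w - x).
Proof.
move=> ht e0 e1 xK hK k16.
have t0 i : 0 <= t i.
  by case/andP: (ht i) => h _; apply: le_trans h; apply: le_trans (tauM i); exact: le_trans M4.
pose G j w := \prod_i expR (- ((B (t i) w 0 j - x 0 j) / e) ^+ 2 / 2).
have -> : \int[P]_w \prod_i gauss_kernel e (B (t i) w - x) = \int[P]_w \prod_j G j w.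
  apply: eq_Rintegral => w _; under eq_bigr do rewrite gauss_kernelE.
  rewrite exchange_big/=; apply: eq_bigr => j _; apply: eq_bigr => i _.
  by rewrite !mxE; congr expR; field; rewrite gt_eqF.
rewrite Rintegral_prod_coordinates; last 2 first.
- move=> j w; apply/andP; split; first by apply: prodr_ge0 => i _; exact: expR_ge0.
  apply: prodr_ile1 => i _; rewrite expR_ge0 -expR0 ler_expR.
  by rewrite mulNr oppr_le0 divr_ge0 ?sqr_ge0.
- move=> j; apply: measurable_prod => i _; apply: measurableT_comp => //.
  apply: measurable_funM => //; apply: measurableT_comp => //; apply: measurable_funX.
  apply: measurable_funM => //; apply: measurable_funB => //.
  exact: (@measurable_generated _ _ _ (fun t w => B t w 0 j)).
rewrite -exprM mulnC exprM -exprMn -[X in _ ^+ X](card_ord d) -prodr_const.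
have c0 : 0 <= 2^-1 * \prod_i (2 * (tau i + 1) `^ H)^-1 * e ^+ k.
  rewrite !mulr_ge0 ?exprn_ge0 ?(ltW e0)// prodr_ge0// => i _.
  by rewrite invr_ge0 mulr_ge0 ?powR_ge0.
apply: ler_prod => j _; rewrite c0/=.
have hK' : k%:R * (x 0 j * M `^ (- H)) ^+ 2 <= kappa.
  apply: le_trans hK; rewrite ler_wpM2l// -real_normK ?num_real// normrM.
  have K0 : 0 <= K by exact: le_trans (xK j).
  rewrite lerXn2r ?nnegrE ?mulr_ge0 ?powR_ge0// (ger0_norm (powR_ge0 _ _)).
  by rewrite ler_wpM2r ?powR_ge0.
have [hfbm _] := hB.
apply: le_trans (position_bumps_ge H0 H1 M4 tauM tau_sep (hfbm j) dk k14 ht e0 e1 hK' k16).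
rewrite big_split/= prodr_const card_ord.
by rewrite mulrAC mulrA.
Qed.

Let vv (e u : R) := 3 * e ^+ 2 + u `^ (2 * H).

Lemma pair_bound_raw (t s : 'I_k -> R) (x y : 'rV[R]_d) (e : R) i0 :
  (forall i, tau i <= t i <= tau i + 1) -> (forall i, tau i <= s i <= tau i + 1) ->
  (forall i, s i != t i) -> 0 < e ->
  \int[P]_w \prod_i (gauss_kernel e (B (t i) w - x) * gauss_kernel e (B (s i) w - y)) <=
  (4 ^+ k) ^+ d * (\prod_i ((3 * e ^+ 2) / Num.sqrt (vv e `|s i - t i|))) ^+ d *
    expR (- ((\sum_j (y 0 j - x 0 j) ^+ 2) / (2 * vv e `|s i0 - t i0|))).
Proof.
move=> ht hs st e0.
have t0 i : 0 <= t i.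
  by case/andP: (ht i) => h _; apply: le_trans h; apply: le_trans (tauM i); exact: le_trans M4.
have s0 i : 0 <= s i.
  by case/andP: (hs i) => h _; apply: le_trans h; apply: le_trans (tauM i); exact: le_trans M4.
pose G j w := \prod_i expR (- (((B (t i) w 0 j - x 0 j) ^+ 2 + (B (s i) w 0 j - y 0 j) ^+ 2)
  / (2 * e ^+ 2))).
have G01 j w : 0 <= G j w <= 1.
  apply/andP; split; first by apply: prodr_ge0 => i _; exact: expR_ge0.
  apply: prodr_ile1 => i _; rewrite expR_ge0 -expR0 ler_expR oppr_le0.
  by rewrite divr_ge0 ?addr_ge0 ?sqr_ge0// mulr_ge0 ?sqr_ge0.
have -> : \int[P]_w \prod_i (gauss_kernel e (B (t i) w - x) * gauss_kernel e (B (s i) w - y)) =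
    \int[P]_w \prod_j G j w.
  apply: eq_Rintegral => w _; under eq_bigr do rewrite !gauss_kernelE -big_split/=.
  rewrite exchange_big/=; apply: eq_bigr => j _; apply: eq_bigr => i _.
  by rewrite !mxE -expRD; congr expR; ring.
rewrite Rintegral_prod_coordinates//; last first.
  move=> j; apply: measurable_prod => i _; apply: measurableT_comp => //.
  apply: measurableT_comp => //; apply: measurable_funM => //.
  by apply: measurable_funD; apply: measurable_funX; apply: measurable_funB => //;
    exact: (@measurable_generated _ _ _ (fun t w => B t w 0 j)).
rewrite -exprMn -[X in _ ^+ X](card_ord d) -prodr_const mulr_suml -sumrN expR_sum -big_split/=.
have [hfbm _] := hB.
apply: ler_prod => j _; apply/andP; split.
  by apply: Rintegral_ge0 => w _; case/andP: (G01 j w).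
exact: (position_increment_bumps_le H0 H1 M4 tauM tau_sep (hfbm j) dk k14 ht hs st).
Qed.

End fbm_densities.

(** * Truncated powers and the Riesz kernel *)

(** [trunc_power (H d) d u r] is the size of the joint density of the process at
    two times at distance [u] near two points at distance [r]: the factor
    [u ^ (- H d)] blows up on the diagonal and the distance of the points
    stops it at [r ^ (- d)]. *)
Definition trunc_power {R : realType} (a b u r : R) := Num.min (u `^ (- a)) (r `^ (- b)).

Lemma exprn_le_expR (R : realType) (n : nat) (x : R) : 0 <= x ->
  x ^+ n <= n%:R ^+ n * expR x.
Proof.
case: n => [|n] x0; first by rewrite !expr0 mul1r -expR0 ler_expR.
have n0 : (0 : R) < n.+1%:R by rewrite ltr0n.
have h : x / n.+1%:R <= expR (x / n.+1%:R).
  by apply: le_trans (expR_ge1Dx _); rewrite lerDr.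
have h0 : 0 <= x / n.+1%:R by rewrite divr_ge0 // ltW.
have hh : (x / n.+1%:R) ^+ n.+1 <= expR (x / n.+1%:R) ^+ n.+1.
  by rewrite lerXn2r ?nnegrE ?expR_ge0.
move: hh; rewrite -expRM_natl [n.+1%:R * _]mulrC divfK ?gt_eqF// exprMn exprVn.
by rewrite ler_pdivrMr ?exprn_gt0// [expR x * _]mulrC.
Qed.

(** A Gaussian density of variance [v] in dimension [d] is at most
    [v ^ (- d / 2)], which is the first member of the minimum; at distance [r] it is
    also at most a multiple of [r ^ (- d)], since [y ^ d exp (- y ^ 2 / 2 k)] is bounded
    in [y = r / sqrt v]. *)
Lemma gauss_factor_le (R : realType) (H : R) (d k : nat) (u r v : R) :
  (0 < k)%N -> 0 < u -> 0 < r -> u `^ (2 * H) <= v ->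
  (Num.sqrt v)^-1 ^+ d * expR (- (r ^+ 2 / (2 * k%:R * v))) <=
  (1 + (2 * k%:R * d%:R) ^+ d) * trunc_power (H * d%:R) d%:R u r.
Proof.
move=> k0 u0 r0 uv.
have k0' : (0 : R) < k%:R by rewrite ltr0n.
have v0 : 0 < v by apply: lt_le_trans uv; exact: powR_gt0.
have sv0 : 0 < Num.sqrt v by rewrite sqrtr_gt0.
have C1 : (1:R) <= 1 + (2 * k%:R * d%:R) ^+ d by rewrite lerDl exprn_ge0// !mulr_ge0.
rewrite /trunc_power minr_pMr; last exact: le_trans C1.
rewrite le_min; apply/andP; split.
  apply: (@le_trans _ _ (u `^ (- (H * d%:R)))); last first.
    by rewrite ler_peMl ?powR_ge0.
  apply: (@le_trans _ _ ((Num.sqrt v)^-1 ^+ d)).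
    rewrite ler_piMr ?exprn_ge0 ?invr_ge0 ?sqrtr_ge0// -[X in _ <= X]expR0 ler_expR oppr_le0.
    by rewrite divr_ge0 ?sqr_ge0// !mulr_ge0 ?ltW.
  rewrite powRN powRrM powR_mulrn ?powR_ge0// exprVn lef_pV2 ?posrE ?exprn_gt0 ?powR_gt0//.
  rewrite lerXn2r ?nnegrE ?powR_ge0 ?sqrtr_ge0//.
  have -> : u `^ H = Num.sqrt (u `^ (2 * H)).
    by rewrite [2 * H]mulrC powRrM powR_mulrn ?powR_ge0// sqrtr_sqr ger0_norm ?powR_ge0.
  by rewrite ler_wsqrtr.
rewrite powRN.
rewrite powR_mulrn; last exact: ltW.
rewrite ler_pdivlMr ?exprn_gt0//.
rewrite mulrAC -exprMn [_^-1 * r]mulrC expRN ler_pdivrMr ?expR_gt0//.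
set y := r * _.
have y0 : 0 < y by rewrite /y divr_gt0.
have -> : r ^+ 2 / (2 * k%:R * v) = y ^+ 2 / (2 * k%:R).
  rewrite /y exprMn exprVn sqr_sqrtr ?ltW//; field.
  by rewrite !gt_eqF.
set z := _ / _.
have z0 : 0 <= z by rewrite divr_ge0 ?sqr_ge0// mulr_ge0 ?ltW.
apply: (@le_trans _ _ (1 + (y ^+ 2) ^+ d)).
  rewrite exprAC; set q := y ^+ d; have : 0 <= (q - 2^-1) ^+ 2 by exact: sqr_ge0.
  rewrite sqrrB; nra.
have -> : y ^+ 2 = (2 * k%:R) * z by rewrite mulrC divfK// gt_eqF// mulr_gt0.
rewrite exprMn [_ ^+ d * z ^+ d]mulrC.
have := exprn_le_expR d z0.
have e1 : 1 <= expR z by rewrite -expR0 ler_expR.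
move=> h; rewrite [X in _ <= X]mulrDl mul1r; apply: lerD => //.
rewrite [z ^+ d * _]mulrC [(2 * k%:R * d%:R) ^+ d]exprMn -mulrA ler_wpM2l// exprn_ge0//.
Qed.

Section pair_bound.
Context {R : realType} disp (T : measurableType disp) (P : probability T R).
Variables (d k : nat) (H M kappa : R) (B : R -> T -> 'rV[R]_d) (tau : 'I_k -> R).
Hypotheses (H0 : 0 < H) (H1 : H < 1) (M4 : 4 <= M)
  (tauM : forall i, M <= tau i)
  (tau_sep : forall i j : 'I_k, (i < j)%N -> M * (tau i + 1) <= tau j)
  (hB : fbm P H B)
  (dk : 8 * (M `^ (H - 1) + M `^ (- H)) * (2 * k)%:R <= kappa) (k14 : kappa <= 4^-1).
Hypothesis k0 : (0 < k)%N.

(** The Gaussian decay is available for one index only; taking the index that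
    minimises the variance [v i], it dominates the product of the decays
    [exp (- r ^ 2 / 2 k v i)] over all [k] indices, and every factor is
    then truncated at the distance [r] of the two targets. *)
Lemma pair_bound (t s : 'I_k -> R) (x y : 'rV[R]_d) (e : R) :
  (forall i, tau i <= t i <= tau i + 1) -> (forall i, tau i <= s i <= tau i + 1) ->
  (forall i, s i != t i) -> 0 < e -> 0 < euclidean_norm (y - x) ->
  \int[P]_w \prod_i (gauss_kernel e (B (t i) w - x) * gauss_kernel e (B (s i) w - y)) <=
  (4 ^+ k) ^+ d * (3 ^+ d * (1 + (2 * k%:R * d%:R) ^+ d)) ^+ k *
  ((e ^+ d * e ^+ d) ^+ k * \prod_i trunc_power (H * d%:R) d%:R `|s i - t i| (euclidean_norm (y - x))).
Proof.
move=> ht hs st e0 r0.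
set r := euclidean_norm _ in r0 *.
pose v i := 3 * e ^+ 2 + `|s i - t i| `^ (2 * H).
have u0 i : 0 < `|s i - t i| by rewrite normr_gt0 subr_eq0.
have v0 i : 0 < v i by rewrite addr_gt0 ?powR_gt0// mulr_gt0 ?exprn_gt0.
pose i1 : 'I_k := Ordinal k0.
pose i0 := [arg min_(i < i1) v i]%O.
have vmin i : v i0 <= v i by rewrite /i0; case: arg_minP => // i2 _ /(_ i isT).
apply: le_trans (pair_bound_raw H0 H1 M4 tauM tau_sep hB dk k14 x y i0 ht hs st e0) _.
have -> : \sum_j (y 0 j - x 0 j) ^+ 2 = r ^+ 2.
  rewrite /r /euclidean_norm sqr_sqrtr ?sumr_ge0// => [|j _]; last exact: sqr_ge0.
  by apply: eq_bigr => j _; rewrite !mxE.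
have k0' : (0 : R) < k%:R by rewrite ltr0n.
have eb : expR (- (r ^+ 2 / (2 * v i0))) <= \prod_i expR (- (r ^+ 2 / (2 * k%:R * v i))).
  rewrite -expR_sum ler_expR sumrN lerN2.
  apply: (@le_trans _ _ (\sum_(i < k) (r ^+ 2 / (2 * k%:R * v i0)))).
    apply: ler_sum => i _; rewrite ler_wpM2l ?sqr_ge0// lef_pV2 ?posrE ?mulr_gt0//.
    by rewrite ler_pM2l ?mulr_gt0.
  rewrite sumr_const card_ord -mulr_natr le_eqVlt; apply/orP; left; apply/eqP; field.
  by rewrite !gt_eqF.
rewrite -[X in X <= _]mulrA -[X in _ <= X]mulrA ler_wpM2l ?exprn_ge0//.
apply: le_trans (ler_wpM2l _ eb) _.
  by rewrite exprn_ge0// prodr_ge0// => i _; rewrite divr_ge0 ?sqrtr_ge0// mulr_ge0 ?sqr_ge0.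
have pk (a : R) : a ^+ k = \prod_(i < k) a by rewrite prodr_const card_ord.
rewrite -prodrXl -big_split/= [X in _ <= X]mulrA -[(_ * _) ^+ k * _]exprMn.
rewrite pk -big_split/=.
apply: ler_prod => i _; apply/andP; split.
  rewrite mulr_ge0 ?expR_ge0// exprn_ge0// divr_ge0 ?sqrtr_ge0// mulr_ge0 ?sqr_ge0//.
have := @gauss_factor_le R H d k _ r (v i) k0 (u0 i) r0.
rewrite {1}/v lerDr mulr_ge0 ?sqr_ge0// => /(_ isT) h.
have -> : (3 * e ^+ 2 / Num.sqrt (3 * e ^+ 2 + `|s i - t i| `^ (2 * H))) ^+ d =
   (3 ^+ d * (e ^+ d * e ^+ d)) * (Num.sqrt (v i))^-1 ^+ d.
  by rewrite !exprMn; congr (_ * _ * _); rewrite -exprM mulnC exprM expr2.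
have sw (a b c : R) : 3 ^+ d * a * b * c = (3 ^+ d * b) * (a * c) by ring.
rewrite [X in _ <= X]sw.
rewrite -[X in X <= _]mulrA ler_wpM2l//.
by have := ltW e0 => e0w; rewrite !mulr_ge0 ?exprn_ge0.
Qed.

End pair_bound.

Section truncated_power.
Context {R : realType}.
Variable a : R.
Hypothesis a1 : 1 < a.

Let L (rho : R) (m : nat) : R := 2 ^+ m * rho.
Let c (rho : R) (m : nat) : R := 2 `^ a * L rho m `^ (- a).

Lemma L_gt0 (rho : R) (m : nat) : 0 < rho -> 0 < L rho m.
Proof. by move=> r0; rewrite mulr_gt0 ?exprn_gt0. Qed.

Lemma powR_exprn (x y : R) (m : nat) : 0 <= x -> (x ^+ m) `^ y = (x `^ y) ^+ m.
Proof. move=> x0; rewrite -(powR_mulrn m x0) -(powR_mulrn m (powR_ge0 x y)) -!powRrM.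
by rewrite [_ * y]mulrC. Qed.

Lemma two_powR_lt1 : 2 `^ (1 - a) < 1.
Proof.
have a10 : 0 < a - 1 by rewrite subr_gt0.
have -> : 1 - a = - (a - 1) by ring.
rewrite powRN invf_lt1 ?powR_gt0//.
have := gt0_ltr_powR a10; move=> /(_ 1 2); rewrite powR1 !nnegrE => -> //.
by rewrite ltr1n.
Qed.

Lemma dyadic_coef (rho : R) (m : nat) : 0 < rho ->
  c rho m * (2 * L rho m) = 2 * 2 `^ a * rho `^ (1 - a) * (2 `^ (1 - a)) ^+ m.
Proof.
move=> r0; have L0 := L_gt0 m r0.
have -> : c rho m * (2 * L rho m) = 2 * 2 `^ a * (L rho m `^ (1 - a)).
  rewrite powRD; last by rewrite (gt_eqF L0) implybT.
  by rewrite powRr1 ?ltW// /c; ring.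
by rewrite /L powRM ?exprn_ge0 ?ltW// powR_exprn// -!mulrA; congr (_ * _); congr (_ * _); rewrite mulrC.
Qed.

(** Comparison with a series of indicators of intervals of dyadic lengths
    [2 ^ m rho], which makes the integral over [u] a geometric series and keeps
    the argument free of improper integrals: for the least [m] with
    [u <= 2 ^ m rho] the term of index [m] alone is large enough. *)
Lemma trunc_dyadic (rho u : R) : 0 < rho -> 0 <= u ->
  ((Num.min (u `^ (- a)) (rho `^ (- a)))%:E <=
   \sum_(m <oo) ((c rho m)%:E * (\1_[set x : R | x <= L rho m] u)%:E))%E.
Proof.
move=> r0 u0.
have h0 m : (0 <= (c rho m)%:E * (\1_[set x : R | x <= L rho m] u)%:E)%E.
  by rewrite mule_ge0 ?lee_fin ?mulr_ge0 ?powR_ge0.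
have ex : exists m, u <= L rho m.
  have [n hn] : exists n : nat, u / rho <= 2 ^+ n.
    exists (Num.truncn (u / rho)).+1; apply/ltW.
    apply: lt_le_trans (truncnS_gt _) _.
    by rewrite -natrX ler_nat ltnW// ltn_expl.
  by exists n; rewrite /L -ler_pdivrMr.
have [m um mmin] := ex_minnP ex.
suff h : (Num.min (u `^ (- a)) (rho `^ (- a)) <= c rho m)%R.
  apply: le_trans (nneseries_lim_ge m.+1 _) => //.
  rewrite big_nat_recr//= indicE mem_set// mule1 lee_paddl// ?lee_fin//.
  by apply: sume_ge0 => i _; exact: h0.
have p1 : 1 <= (2:R) `^ a.
  by rewrite -[X in X <= _](powRr0 2) ler_powR// ?ler1n// ltW// (lt_trans _ a1).
case: m um mmin => [|m] um mmin.
  rewrite ge_min; apply/orP; right.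
  by rewrite /c /L expr0 mul1r ler_peMl ?powR_ge0.
rewrite ge_min; apply/orP; left.
have : L rho m <= u.
  by rewrite leNgt; apply/negP => /ltW /mmin; rewrite ltnn.
move=> Lu; have L0 := L_gt0 m r0.
have -> : c rho m.+1 = L rho m `^ (- a).
  have h2 : L rho m.+1 = 2 * L rho m by rewrite /L exprS; ring.
  rewrite /c h2 powRM ?ltW// mulrA -powRD; last by rewrite pnatr_eq0 implybT.
  by rewrite subrr powRr0 mul1r.
rewrite !powRN lef_pV2 ?posrE ?powR_gt0//; last exact: lt_le_trans Lu.
by apply: ge0_ler_powR; rewrite ?nnegrE ?(ltW L0)// ltW// (lt_trans _ a1).
Qed.

Lemma trunc_power_integral (rho t : R) : 0 < rho ->
  (\int[lebesgue_measure]_(s in [set: R])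
     (Num.min (`|s - t| `^ (- a)) (rho `^ (- a)))%:E <=
   (2 * 2 `^ a / (1 - 2 `^ (1 - a)) * rho `^ (1 - a))%:E)%E.
Proof.
move=> r0.
pose f m (s : R) : \bar R := ((c rho m)%:E * (\1_(`[t - L rho m, t + L rho m]%classic : set R) s)%:E)%E.
have c0 m : 0 <= c rho m by rewrite mulr_ge0 ?powR_ge0.
have f0 m s : (0 <= f m s)%E by rewrite mule_ge0 ?lee_fin.
have mf m : measurable_fun setT (f m).
  by apply: measurable_funeM; apply/measurable_EFinP; exact: measurable_indic.
apply: (@le_trans _ _ (\int[lebesgue_measure]_(s in [set: R]) \sum_(m <oo) f m s)%E).
  apply: ge0_le_integral => //.
  - by move=> s _; rewrite lee_fin le_min !powR_ge0.
  - apply/measurable_EFinP; apply: measurable_minr => //.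
    apply: (measurableT_comp (measurable_powR (- a))).
    by apply: measurableT_comp => //; exact: measurable_funB.
  - by apply: (@ge0_emeasurable_sum _ _ _ _ f xpredT).
  - move=> s _; apply: le_trans (trunc_dyadic r0 (normr_ge0 _)) _.
    apply: lee_nneseries => m _; first by rewrite mule_ge0 ?lee_fin.
    rewrite /f !indicE; set A := (_ \in _); set B := (_ \in _); suff -> : A = B by [].
    apply/idP/idP; rewrite !inE/= in_itv/= ler_distl//.
rewrite integral_nneseries//.
have q1 := two_powR_lt1.
have i1 m : (\int[lebesgue_measure]_(s in [set: R]) f m s =
   (2 * 2 `^ a * rho `^ (1 - a) * (2 `^ (1 - a)) ^+ m)%:E)%E.
  rewrite /f ge0_integralZl ?lee_fin//; last first.
    by apply/measurable_EFinP; exact: measurable_indic.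
  have L0 := L_gt0 m r0.
  rewrite integral_indic// setIT.
  have := lebesgue_measure_itv `[t - L rho m, t + L rho m]; rewrite /= lte_fin => ->.
  rewrite ifT; last by lra.
  rewrite -EFinB -EFinM -dyadic_coef//; congr (_ * _)%:E; lra.
apply: lime_le.
  by apply: is_cvg_nneseries => n _ _; rewrite i1 lee_fin !mulr_ge0 ?exprn_ge0 ?powR_ge0.
apply: nearW => n; rewrite (eq_bigr _ (fun i _ => i1 i)) sumEFin lee_fin -mulr_sumr.
rewrite -[X in _ <= X]mulrA [_^-1 * _]mulrC [X in _ <= X]mulrA.
rewrite ler_wpM2l ?mulr_ge0 ?powR_ge0//.
rewrite -[X in _ <= X]mul1r ler_pdivlMr ?subr_gt0//.
set q := 2 `^ _ in q1 *.
have := subrX1 q n; rewrite big_mkord.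
have : 0 <= q ^+ n by rewrite exprn_ge0// powR_ge0.
set S := \sum_(i < n) _; nra.
Qed.

End truncated_power.

(** * Joint measurability in time and chance *)

Section joint_measurability.
Context {R : realType} d (T : measurableType d) (X : R -> T -> R).
Hypotheses (mX : forall t, 0 <= t -> measurable_fun setT (X t))
  (cX : forall w, {within `[0, +oo[, continuous (fun t : R => X t w)}).

(** Only times [t >= 0] are constrained; clamping them at 0 yields paths that
    are continuous on the whole line. *)
Lemma continuous_clamp (w : T) : continuous (fun t : R => X (Num.max 0 t) w).
Proof.
move=> t.
have := @cX w (Num.max 0 t); rewrite /continuous_at.
have -> : nbhs ((Num.max 0 t) : subspace `[0, +oo[) = within `[0, +oo[%classic (nbhs (Num.max 0 t)).
  by rewrite nbhs_subspace_in//= in_itv/= le_max lexx.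
apply: cvg_comp => A; rewrite /within/= => hA.
have mc : {for t, continuous (fun s : R => Num.max 0 s)}.
  by apply: continuous_max => //; exact: cvg_cst.
have hm : \forall s \near t, (Num.max 0 s \in `[0, +oo[) -> A (Num.max 0 s) := mc _ hA.
by apply: filterS hm => s /=; apply; rewrite in_itv/= le_max lexx.
Qed.

Lemma truncn_approx (t : R) : 0 <= t ->
  (Num.truncn (t * n.+1%:R))%:R / n.+1%:R @[n --> \oo] --> t.
Proof.
move=> t0; apply/cvgrPdist_le => /= e e0.
near=> n.
have n0 : (0 : R) < n.+1%:R by rewrite ltr0n.
have tn0 : 0 <= t * n.+1%:R by rewrite mulr_ge0.
have /andP[h1 h2] := truncn_itv tn0.
have e1 : n.+1%:R^-1 < e by near: n; exact: (near_infty_natSinv_lt (PosNum e0)).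
set q := _ / _; have hq : q * n.+1%:R = (Num.truncn (t * n.+1%:R))%:R by rewrite divfK// gt_eqF.
have k1 : q <= t by rewrite -(ler_pM2r n0) hq.
have k2 : t <= q + n.+1%:R^-1.
  by rewrite -(ler_pM2r n0) mulrDl hq mulVf ?gt_eqF// natr1 ltW.
rewrite ger0_norm ?subr_ge0//; apply: le_trans (ltW e1).
by rewrite lerBlDl.
Unshelve. all: end_near. Qed.

(** The process is the pointwise limit of its values on the grids of mesh
    [1 / (n + 1)], which depend measurably on the pair. *)
Lemma measurable_joint : measurable_fun [set: T * R] (fun z => X (Num.max 0 z.2) z.1).
Proof.
pose g (n : nat) (t : R) := (Num.truncn (t * n.+1%:R))%:R / n.+1%:R : R.
have g0 n t : 0 <= g n t by rewrite divr_ge0.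
refine (@measurable_fun_cvg _ (T * R)%type R setT (fun n (z : T * R) => X (g n (Num.max 0 z.2)) z.1) _ _ _).
- move=> n _ A mA; rewrite setTI.
  have -> : (fun z : T * R => X (g n (Num.max 0 z.2)) z.1) @^-1` A =
      \bigcup_m ((X (m%:R / n.+1%:R) @^-1` A) `*`
        [set t : R | (m%:R <= Num.max 0 t * n.+1%:R < m.+1%:R)]).
    apply/seteqP; split => [[w t]/= h|[w t]/= [m _ [/= h1 /truncn_def h2]]].
      exists (Num.truncn (Num.max 0 t * n.+1%:R)) => //; split => //=.
      by apply: truncn_itv; rewrite mulr_ge0// le_max lexx.
    by rewrite /g h2.
  apply: bigcupT_measurable => m; apply: measurableX.
    by rewrite -[X in measurable X]setTI; apply: mX => //; rewrite divr_ge0.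
  have -> : [set t : R | (m%:R <= Num.max 0 t * n.+1%:R < m.+1%:R)] =
     (fun t : R => Num.max 0 t * n.+1%:R) @^-1` `[m%:R, m.+1%:R[%classic.
    by apply/seteqP; split => t /=; rewrite in_itv/=.
  rewrite -[X in measurable X]setTI.
  have mm : measurable_fun setT (fun t : R => Num.max 0 t * n.+1%:R).
    by apply: measurable_funM => //; exact: measurable_maxr.
  by apply: mm.
- move=> [w t] _ /=.
  have h : 0 <= Num.max 0 t by rewrite le_max lexx.
  have cc := cvg_comp _ _ (truncn_approx h) (@continuous_clamp w (Num.max 0 t)).
  rewrite (max_idPr h) in cc; apply: cvg_trans cc; apply: near_eq_cvg; apply: nearW => n /=.
  by rewrite (max_idPr (g0 n _)).
Qed.

End joint_measurability.

(** * Products of integrals *)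

Section iterated_integrals.
Context {R : realType} d1 d2 (T : measurableType d1) (S : measurableType d2).
Variables (P : probability T R) (V : probability S R) (I : eqType).
Variables (f : I -> T * S -> \bar R) (h : I -> S -> \bar R).
Hypotheses (f0 : forall i z, (0 <= f i z)%E) (mf : forall i, measurable_fun setT (f i))
  (h0 : forall i u, (0 <= h i u)%E) (mh : forall i, measurable_fun setT (h i)).
Variable rel : \bar R -> \bar R -> Prop.
Hypothesis rel_integral : forall p q : S -> \bar R,
  (forall u, 0 <= p u)%E -> (forall u, 0 <= q u)%E ->
  measurable_fun setT p -> measurable_fun setT q ->
  (forall u, rel (p u) (q u)) -> rel (\int[V]_u p u)%E (\int[V]_u q u)%E.

Lemma prode_ge0 (J : Type) (s : seq J) (a : J -> \bar R) :
  (forall j, 0 <= a j)%E -> (0 <= \prod_(j <- s) a j)%E.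
Proof. by move=> a0; elim/big_ind : _ => // x y; exact: mule_ge0. Qed.

Lemma emeasurable_prod d (U : measurableType d) (J : Type) (s : seq J) (a : J -> U -> \bar R) :
  (forall j, measurable_fun setT (a j)) ->
  measurable_fun setT (fun x => \prod_(j <- s) a j x)%E.
Proof.
move=> ma; elim: s => [|j s ih].
  by under eq_fun do rewrite big_nil; exact: measurable_cst.
by under eq_fun do rewrite big_cons; exact: emeasurable_funM.
Qed.

(** An estimate for the expectation of [\prod_i f i (w, u i)] at all times
    [u], in which the right-hand side is a product, integrates to an estimate
    for the product of the integrals. The two directions, needed for the first
    and for the second moment, are obtained from one induction by abstracting
    the inequality into a relation [rel] that integrals preserve. *)
Lemma iterated_tonelli (s : seq I) : uniq s ->
  forall (g : T -> \bar R) (c : \bar R), (0 <= c)%E ->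
  (forall w, 0 <= g w)%E -> measurable_fun setT g ->
  (forall u : I -> S, rel (\int[P]_w (g w * \prod_(i <- s) f i (w, u i)))%E
     (c * \prod_(i <- s) h i (u i))%E) ->
  rel (\int[P]_w (g w * \prod_(i <- s) \int[V]_u f i (w, u)))%E
    (c * \prod_(i <- s) \int[V]_u h i u)%E.
Proof.
have F0 i w : (0 <= \int[V]_u f i (w, u))%E by exact: integral_ge0.
have mF i : measurable_fun setT (fun w => \int[V]_u f i (w, u))%E.
  exact: (measurable_fun_fubini_tonelli_F (f i)).
elim: s => [_|i s ih /= /andP[nis us]] g c c0 g0 mg H.
  have := H (fun=> point); rewrite !big_nil.
  by rewrite (eq_integral (fun w => g w * \prod_(i <- [::]) \int[V]_u f i (w, u))%E)// => w _; rewrite !big_nil.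
have mfi u : measurable_fun setT (fun w => f i (w, u)).
  exact: (measurableT_comp (mf i)).
pose K z := (g z.1 * f i z * \prod_(j <- s) \int[V]_u f j (z.1, u))%E.
have K0 z : (0 <= K z)%E by rewrite !mule_ge0// prode_ge0.
have mK : measurable_fun setT K.
  apply: emeasurable_funM; first by apply: emeasurable_funM => //; exact: measurableT_comp.
  by apply: (@measurableT_comp _ _ _ _ _ _ (fun w => \prod_(j <- s) \int[V]_u f j (w, u))%E) => //; exact: emeasurable_prod.
have -> : (\int[P]_w (g w * \prod_(j <- i :: s) \int[V]_u f j (w, u)) =
    \int[V]_u \int[P]_w K (w, u))%E.
  rewrite -fubini_tonelli//; apply: eq_integral => w _; rewrite big_cons /K/=.
  under [RHS]eq_integral do rewrite muleAC.
  rewrite ge0_integralZl//; first by rewrite muleA muleAC.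
  - exact: (measurableT_comp (mf i)).
  - by rewrite mule_ge0// prode_ge0.
have -> : (c * \prod_(j <- i :: s) \int[V]_u h j u =
    \int[V]_u (c * h i u * \prod_(j <- s) \int[V]_v h j v))%E.
  under [RHS]eq_integral do rewrite muleAC.
  rewrite ge0_integralZl//; first by rewrite big_cons muleA muleAC.
  by rewrite mule_ge0// prode_ge0// => j; exact: integral_ge0.
apply: rel_integral => //.
- by move=> u; exact: integral_ge0.
- by move=> u; rewrite !mule_ge0// prode_ge0// => j; exact: integral_ge0.
- exact: (measurable_fun_fubini_tonelli_G K).
- by apply: emeasurable_funM => //; exact: emeasurable_funM.
move=> u; apply: (ih us (fun w => g w * f i (w, u))%E) => //.
- exact: mule_ge0.
- by move=> w; exact: mule_ge0.
- exact: emeasurable_funM.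
move=> v; have := H (fun j => if j == i then u else v j).
rewrite big_cons eqxx muleA.
have E (a : I -> S -> \bar R) : (\prod_(j <- s) a j (if j == i then u else v j) =
    \prod_(j <- s) a j (v j))%E.
  by apply: eq_big_seq => j js; case: eqVneq => // ji; move: nis; rewrite -ji js.
rewrite E; congr (rel _ _); apply: eq_integral => w _.
by rewrite big_cons eqxx muleA (E (fun j v => f j (w, v))).
Qed.

End iterated_integrals.

(** * Measurability of the event of multiple points *)

Section avoidance.
Context {R : realType} (d : nat).
Variable c : R -> 'rV[R]_d.
Hypothesis cc : forall j, continuous (fun t => c t 0 j).

Lemma path_avoids_point (x : 'rV[R]_d) (a b : R) :
  (forall t, a <= t <= b -> c t <> x) ->
  \forall e \near 0^'+, forall t, a <= t <= b -> ~ ball x e (c t).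
Proof.
move=> cx.
have cab : compact (`[a, b]%classic : set R) by exact: segment_compact.
have H := (compact_near_coveringP _).1 cab R (0^'+) (fun e t => ~ ball x e (c t)) _.
suff: \forall e \near 0^'+, `[a, b]%classic `<=` (fun t => ~ ball x e (c t)).
  move=> {}H; apply: filterS H => e he t tab; apply: he; rewrite /= in_itv/=; exact: tab.
apply: H => t /=; rewrite in_itv/= => tab.
have [j hj] : exists j, c t 0 j != x 0 j.
  apply: contrapT => h; apply: (cx t tab); apply/rowP => j; apply/eqP.
  by apply: contrapT => /negP h2; apply: h; exists j.
pose n := `|c t 0 j - x 0 j| / 2.
have n0 : 0 < n by rewrite divr_gt0// normr_gt0 subr_eq0.
have h1 : \forall s \near t, `|c t 0 j - c s 0 j| < n.
  by have := @cc j t => /cvgrPdist_lt; exact.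
have h2 : \forall e \near 0^'+, e < n by exact: nbhs_right_lt.
near=> s e => /=.
have k1 : `|c t 0 j - c s 0 j| < n by near: s.
have k2 : e < n by near: e.
move=> [_ /(_ 0 j)]; rewrite /ball/= => k3.
have : `|c t 0 j - x 0 j| < n + n.
  rewrite -(subrKA (c s 0 j)); apply: le_lt_trans (ler_normD _ _) _.
  by apply: ltrD => //; rewrite distrC; exact: lt_trans k2.
by rewrite /n -splitr ltxx.
Unshelve. all: end_near. Qed.

(** The uniformity in [x] comes from the compactness of [E]: a point near [x] is
    avoided by the same piece of path as [x], at half the distance. The same
    statement serves for the measurability of the event and for the vanishing
    of the smoothed masses off it. *)
Lemma compact_avoids_paths (k : nat) (a b : 'I_k -> R) (E : set 'rV[R]_d) :
  compact E ->
  (forall x, E x -> exists i, forall t, a i <= t <= b i -> c t <> x) ->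
  exists2 e, 0 < e &
    forall x, E x -> exists i, forall t, a i <= t <= b i -> ~ ball x e (c t).
Proof.
move=> cE hE.
have H := (compact_near_coveringP _).1 cE R (0^'+)
  (fun e x => exists i, forall t, a i <= t <= b i -> ~ ball x e (c t)) _.
suff H' : \forall e \near (0 : R)^'+, E `<=` (fun x =>
    exists i, forall t, a i <= t <= b i -> ~ ball x e (c t)).
  have p0 : \forall e \near (0 : R)^'+, 0 < e by exact: nbhs_right_gt.
  have [e [e0 he]] := @filter_ex _ (0 : R)^'+ _ _ (@filterI _ _ _ _ _ p0 H'); by exists e.
apply: H => x /hE[i /path_avoids_point hi].
have p0 : \forall e \near (0 : R)^'+, 0 < e by exact: nbhs_right_gt.
have [e [e0 he]] := @filter_ex _ (0 : R)^'+ _ _ (@filterI _ _ _ _ _ p0 hi).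
near=> y e' => /=; exists i => t /he; apply: contra_not => h.
have hy : ball x (e / 2) y by near: y; apply: nbhsx_ballx; exact: divr_gt0.
have e'e : e' <= e / 2 by near: e'; apply: nbhs_right_le; exact: divr_gt0.
by rewrite (splitr e); apply: ball_triangle hy _; apply: le_ball h.
Unshelve. all: end_near. Qed.

End avoidance.

Lemma measurable_guard d (T : measurableType d) (C : Prop) (A : set T) :
  measurable A -> measurable [set w | C /\ A w].
Proof.
move=> mA; have [c|nc] := pselect C.
  by rewrite (_ : [set w | _] = A)//; apply/seteqP; split => w //= -[].
by rewrite (_ : [set w | _] = set0)//; apply/seteqP; split => w //= -[].
Qed.

Section hitting.
Context {R : realType} disp (T : measurableType disp) (d k : nat).
Variable c : T -> R -> 'rV[R]_d.
Hypotheses (cc : forall w j, continuous (fun t => c w t 0 j))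
  (mc : forall t j, measurable_fun setT (fun w => c w t 0 j)).
Variables (E : set 'rV[R]_d) (cE : compact E).

Definition hitting (a b : 'I_k -> R) : set T :=
  [set w | exists2 x, E x & forall i, exists2 t, a i <= t <= b i & c w t = x].

Lemma measurable_ball_path (q : 'rV[R]_d) (e t : R) : measurable [set w | ball q e (c w t)].
Proof.
have -> : [set w | ball q e (c w t)] = [set w | 0 < e /\
    (\bigcap_(j in [set: 'I_d]) ((fun w => c w t 0 j) @^-1` (ball (q 0 j) e))) w].
  apply/seteqP; split => w /= [e0 h]; split => //.
    by move=> j _; exact: h.
  by move=> i j; rewrite [i]ord1; exact: (h j).
apply: measurable_guard; apply: fin_bigcap_measurable; first exact: finite_finset.
move=> j _; rewrite -[X in measurable X]setTI; apply: mc => //.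
exact: measurable_ball.
Qed.

Lemma rational_near (x : 'rV[R]_d) (e : R) : 0 < e ->
  exists q : 'rV[rat]_d, ball x e (map_mx ratr q).
Proof.
move=> e0.
have /choice[q hq] : forall j, exists q : rat, `|x 0 j - ratr q| < e.
  move=> j; have /rat_in_itvoo[q] : x 0 j - e < x 0 j + e by lra.
  by rewrite in_itv/= => /andP[h1 h2]; exists q; rewrite ltr_norml; apply/andP; split; lra.
exists (\row_j q j); split => // i j; rewrite !mxE [i]ord1; exact: hq.
Qed.

Lemma rational_time_near (w : T) (a b t e : R) : a < b -> a <= t <= b -> 0 < e ->
  exists r : rat, a <= ratr r <= b /\ ball (c w t) e (c w (ratr r)).
Proof.
move=> ab /andP[at_ tb] e0.
have h : \forall s \near t, forall j, `|c w t 0 j - c w s 0 j| < e.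
  apply: (@filter_forall R 'I_d (fun j s => `|c w t 0 j - c w s 0 j| < e) (nbhs t) _) => j.
  by have := @cc w j t => /cvgrPdist_lt; exact.
have [n /= n0 hn] := h.
have : Num.max a (t - n) < Num.min b (t + n).
  rewrite gt_max !lt_min ab/=; apply/and3P; split; lra.
move=> /rat_in_itvoo[r]; rewrite in_itv/= gt_max lt_min => /andP[/andP[h1 h2] /andP[h3 h4]].
exists r; split; first by rewrite !ltW.
split => // i j; rewrite [i]ord1; apply: hn => /=.
by rewrite ltr_norml; apply/andP; split; lra.
Qed.

(** Hitting one common point of [E] on [k] intervals is a countable condition:
    at every scale there must be a rational vector close to [E] which is
    approached at rational times of all the intervals. Compactness, in the form
    of [compact_avoids_paths], gives the converse. *)
Lemma hittingE (a b : 'I_k -> R) : (forall i, a i < b i) ->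
  hitting a b = \bigcap_(n : nat) \bigcup_(q : 'rV[rat]_d)
    [set w | (exists2 x, E x & ball x n.+1%:R^-1 (map_mx ratr q : 'rV[R]_d)) /\
      (\bigcap_(i in [set: 'I_k]) \bigcup_(r : rat)
        [set w | a i <= ratr r <= b i /\ ball (map_mx ratr q : 'rV[R]_d) n.+1%:R^-1 (c w (ratr r))]) w].
Proof.
move=> ab; apply/seteqP; split => w /=.
  move=> [x Ex hx] n _.
  have e0 : 0 < n.+1%:R^-1 / 2 :> R by rewrite divr_gt0// invr_gt0.
  have [q hq] := rational_near x e0; exists q => //; split.
    by exists x => //; apply: le_ball hq; rewrite ler_pdivrMr// ler_peMr ?ler1n.
  move=> i _; have [t tab tx] := hx i.
  have [r [rab hr]] := rational_time_near w (ab i) tab e0.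
  exists r => //; split => //; rewrite (splitr n.+1%:R^-1).
  by apply: ball_triangle (ball_sym hq) _; rewrite -tx.
move=> H; apply: contrapT => nh.
have [e e0 he] : exists2 e, 0 < e &
    forall x, E x -> exists i, forall t, a i <= t <= b i -> ~ ball x e (c w t).
  apply: (compact_avoids_paths (@cc w) cE) => x Ex.
  apply: contrapT => h2; apply: nh; exists x => // i.
  apply: contrapT => h3; apply: h2; exists i => t tab tx; apply: h3.
  by exists t.
have e20 : 0 < e / 2 by rewrite divr_gt0.
near \oo => n.
have ne : n.+1%:R^-1 + n.+1%:R^-1 <= e.
  have ne2 : n.+1%:R^-1 < e / 2 by near: n; exact: (near_infty_natSinv_lt (PosNum e20)).
  by rewrite (splitr e); apply: lerD; exact: ltW.
have [q _ [[x Ex xq] hq]] := H n I.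
have [i hi] := he x Ex; have [r _ [rab hr]] := hq i I.
exact: hi _ rab (le_ball ne (ball_triangle xq hr)).
Unshelve. all: end_near. Qed.

Lemma measurable_hitting (a b : 'I_k -> R) : (forall i, a i < b i) ->
  measurable (hitting a b).
Proof.
move=> ab; rewrite hittingE//; apply: bigcapT_measurable => n.
apply: countable_bigcupT_measurable => [|q]; first exact: countableP.
apply: measurable_guard; apply: fin_bigcap_measurable; first exact: finite_finset.
move=> i _; apply: bigcupT_measurable_rat => r.
by apply: measurable_guard; exact: measurable_ball_path.
Qed.

End hitting.

Section multiple_points.
Context {R : realType} disp (T : measurableType disp) (d k : nat).
Variable B : R -> T -> 'rV[R]_d.
Hypotheses (cB : forall j w, {within `[0, +oo[, continuous (fun t : R => B t w 0 j)})
  (mB : forall t j, 0 <= t -> measurable_fun setT (fun w => B t w 0 j)).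
Variables (E : set 'rV[R]_d) (cE : compact E).

Let c (w : T) (t : R) : 'rV[R]_d := B (Num.max 0 t) w.

(** A rational left endpoint below [t i] would be negative when [t i = 0];
    the interval then starts at 0, which can happen for the first time only. *)
Lemma separating_intervals (t : 'I_k -> R) :
  (forall i, 0 <= t i) -> (forall i j : 'I_k, (i < j)%N -> t i < t j) ->
  exists p : {ffun 'I_k -> rat * rat},
    [/\ forall i, 0 <= ratr (p i).1 :> R, forall i, ratr (p i).1 < ratr (p i).2 :> R,
     forall i j : 'I_k, (i < j)%N -> ratr (p i).2 < ratr (p j).1 :> R &
     forall i, ratr (p i).1 <= t i <= ratr (p i).2].
Proof.
move=> t0 tt.
have [e [e0 he]] : exists e : R, 0 < e /\
    forall p : 'I_k * 'I_k, (p.1 < p.2)%N -> e < (t p.2 - t p.1) / 2.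
  have p0 : \forall e \near (0 : R)^'+, 0 < e by exact: nbhs_right_gt.
  have H : \forall e \near (0 : R)^'+, forall p : 'I_k * 'I_k, (p.1 < p.2)%N -> e < (t p.2 - t p.1) / 2.
    apply: (@filter_forall R ('I_k * 'I_k)%type
      (fun p e => (p.1 < p.2)%N -> e < (t p.2 - t p.1) / 2) (0 : R)^'+ _) => p.
    have [pp|pp] := ltnP p.1 p.2; last by apply: nearW.
    have g0 : 0 < (t p.2 - t p.1) / 2 by rewrite divr_gt0// subr_gt0 tt.
    by apply: filterS (nbhs_right_lt g0).
  by have [e [h1 h2]] := @filter_ex _ (0 : R)^'+ _ _ (@filterI _ _ _ _ _ p0 H); exists e.
have /choice[p hp] : forall i, exists p : rat * rat,
    [/\ 0 <= ratr p.1 :> R, ratr p.1 < ratr p.2 :> R, (0 < t i -> t i - e < ratr p.1),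
     ratr p.2 < t i + e & ratr p.1 <= t i <= ratr p.2].
  move=> i; have /rat_in_itvoo[b] : t i < t i + e by lra.
  rewrite in_itv/= => /andP[b1 b2].
  have [ti0|ti0] := eqVneq (t i) 0.
    exists (0, b); rewrite /= raddf0 ti0 lexx ltxx; split => //; rewrite -ti0//.
    exact: ltW.
  have ti0' : 0 < t i by rewrite lt_neqAle eq_sym ti0 t0.
  have /rat_in_itvoo[a] : Num.max 0 (t i - e) < t i.
    by rewrite gt_max ti0'/=; lra.
  rewrite in_itv/= gt_max => /andP[/andP[a1 a2] a3].
  exists (a, b); split => //=; first exact: ltW.
    exact: lt_trans b1.
  by rewrite !ltW.
exists [ffun i => p i]; split => [i|i|i j ij|i]; rewrite !ffunE.
- by have [] := hp i.
- by have [] := hp i.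
- have [_ _ _ h1 _] := hp i; have [_ _ h2 _ _] := hp j.
  have tj : 0 < t j by apply: le_lt_trans (tt _ _ ij).
  have := he (i, j) ij => /= h3; have := h2 tj; lra.
- by have [] := hp i.
Qed.

Lemma multiple_pointE :
  [set w | exists2 x, E x & multiple_point k B w x] =
  \bigcup_(p : {ffun 'I_k -> rat * rat})
    [set w | [/\ forall i, 0 <= ratr (p i).1 :> R, forall i, ratr (p i).1 < ratr (p i).2 :> R &
     forall i j : 'I_k, (i < j)%N -> ratr (p i).2 < ratr (p j).1 :> R] /\
     hitting c E (fun i => ratr (p i).1) (fun i => ratr (p i).2) w].
Proof.
apply/seteqP; split => w /=.
  move=> [x Ex [t [t0 tt hx]]].
  have [p [p1 p2 p3 p4]] := separating_intervals t0 tt.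
  exists p => //=; split => //; exists x => // i; exists (t i) => //.
  by rewrite /c (max_idPr (t0 i)).
move=> [p _ /= [[p1 p2 p3] [x Ex hx]]]; exists x => //.
have /choice[t ht] : forall i, exists t, ratr (p i).1 <= t <= ratr (p i).2 /\ c w t = x.
  by move=> i; have [t] := hx i; exists t.
have t0 i : 0 <= t i.
  by have [/andP[h _] _] := ht i; exact: le_trans h.
exists t; split => // [i j ij|i].
  have [/andP[_ h1] _] := ht i; have [/andP[h2 _] _] := ht j.
  by apply: le_lt_trans h1 _; apply: lt_le_trans h2; exact: p3.
by have [_ <-] := ht i; rewrite /c (max_idPr (t0 i)).
Qed.

Lemma measurable_multiple_point :
  measurable [set w | exists2 x, E x & multiple_point k B w x].
Proof.
rewrite multiple_pointE; apply: countable_bigcupT_measurable => [|p].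
  exact: countableP.
have [p2|np] := pselect (forall i, ratr (p i).1 < ratr (p i).2 :> R); last first.
  rewrite (_ : [set w | _] = set0)//; apply/seteqP; split => w //= -[[_ h] _].
  by case: (np h).
apply: measurable_guard; apply: measurable_hitting => //.
- by move=> w j; exact: (@continuous_clamp R disp T (fun t w => B t w 0 j) (@cB j) w).
- by move=> t j; apply: mB; rewrite le_max lexx.
Qed.

End multiple_points.

(** * Borel structure of the space of row vectors *)

Section borel_vectors.
Context {R : realType} {d : nat}.

Lemma measurable_compact_rV (E : set 'rV[R]_d) : compact E ->
  measurable (E : set (borel_rV R d)).
Proof.
move=> cE; have := compact_closed (@norm_hausdorff R 'rV[R]_d) cE.
rewrite -openC => oE; rewrite -[E]setCK; apply: measurableC.
exact: sub_sigma_algebra.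
Qed.

Lemma measurable_coordinate j :
  measurable_fun [set: borel_rV R d] (fun x : borel_rV R d => (x : 'rV[R]_d) 0 j).
Proof.
apply: (measurability _ (RGenOpens.measurableE R)) => _ [_ [a [b ->]] <-].
rewrite setTI; apply: sub_sigma_algebra; rewrite /=.
apply: open_comp => [x _|]; last exact: interval_open.
exact: coord_continuous.
Qed.

Lemma compact_bounded_coordinates (E : set 'rV[R]_d) : compact E ->
  exists K : R, forall x, E x -> forall j, `|x 0 j| <= K.
Proof.
move=> cE.
have H j : exists K : R, forall x, E x -> `|x 0 j| <= K.
  have : compact ((fun x : 'rV[R]_d => x 0 j) @` E).
    apply: continuous_compact => //; apply: continuous_subspaceT.
    exact: coord_continuous.
  move=> /compact_bounded[M [_ hM]]; exists (M + 1) => x Ex.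
  by apply: (hM (M + 1)); [rewrite ltrDl|exists x].
have /choice[K hK] := H.
exists (\sum_j `|K j|) => x Ex j; apply: le_trans (hK j x Ex) _.
apply: le_trans (ler_norm _) _.
by rewrite (bigD1 j)//= lerDl sumr_ge0.
Qed.

Lemma measurable_euclidean_norm_sub :
  measurable_fun [set: borel_rV R d * borel_rV R d]
    (fun z => euclidean_norm ((z.1 : 'rV[R]_d) - (z.2 : 'rV[R]_d))).
Proof.
rewrite /euclidean_norm; apply: (measurableT_comp (continuous_measurable_fun (@sqrt_continuous R))).
apply: measurable_sum => j; apply: measurable_funX.
have -> : (fun z : borel_rV R d * borel_rV R d => ((z.1 : 'rV[R]_d) - (z.2 : 'rV[R]_d)) 0 j) =
   (fun z => (z.1 : 'rV[R]_d) 0 j - (z.2 : 'rV[R]_d) 0 j).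
  by apply/funext => z; rewrite !mxE.
by apply: measurable_funB; apply: (measurableT_comp (measurable_coordinate j)).
Qed.

Lemma measurable_riesz_kernel (a : R) : measurable_fun setT (@riesz_kernel R a).
Proof.
apply: measurable_fun_ifT => //.
- exact: measurable_fun_eqr.
- by apply/measurable_EFinP; exact: measurable_powR.
Qed.

End borel_vectors.

(** * Uniform random times *)

Section uniform_times.
Context {R : realType}.

Lemma ge0_integral_uniform01 (f : R -> \bar R) :
  measurable_fun setT f -> (forall x, 0 <= f x)%E ->
  (\int[uniform_prob (@ltr01 R)]_x f x = \int[lebesgue_measure]_(x in `[0%R, 1%R]) f x)%E.
Proof.
by move=> mf f0; rewrite integral_uniform// subr0 invr1 mul1e.
Qed.

(** Times are parametrised by a uniform law on the unit interval, so that all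
    the measures at hand are probabilities. The law is kept abstract, since only
    its integrals matter. *)
Variable U : probability (measurableTypeR R) R.
Hypothesis UE : forall f : R -> \bar R,
  measurable_fun setT f -> (forall x, 0 <= f x)%E ->
  (\int[U]_x f x = \int[lebesgue_measure]_(x in `[0%R, 1%R]) f x)%E.

Lemma integral_unit_uniform_indic :
  (\int[U]_u (\1_(`[0, 1]%classic : set R) u)%:E = 1)%E.
Proof.
rewrite UE//; last by apply/measurable_EFinP; exact: measurable_indic.
rewrite integral_indic// setIid.
have := lebesgue_measure_itv `[0 : R, 1]; rewrite /= lte_fin ltr01 => ->.
by rewrite -EFinB subr0.
Qed.

Lemma unit_uniform_set1 (u : R) : U [set u] = 0%E.
Proof.
have mu1 : measurable ([set u] : set R) by exact: measurable_set1.
rewrite -[X in U X]setIT -integral_indic//.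
rewrite UE//; last by apply/measurable_EFinP; exact: measurable_indic.
rewrite integral_indic//; apply/eqP; rewrite -measure_le0 -(lebesgue_measure_set1 u).
apply: le_measure; rewrite ?inE//.
by apply: measurableI => //; exact: measurable_itv.
Qed.

Lemma measurable_diagonal : measurable [set z : R * R | z.1 = z.2].
Proof.
have -> : [set z : R * R | z.1 = z.2] = (fun z : R * R => z.1 - z.2) @^-1` [set 0].
  by apply/seteqP; split => z /= => [->|/eqP]; rewrite ?subrr// subr_eq0 => /eqP.
rewrite -[X in measurable X]setTI.
have m : measurable_fun setT (fun z : R * R => z.1 - z.2) by exact: measurable_funB.
by apply: m.
Qed.

(** The bound on pairs of times fails on the diagonal, where the increment
    vanishes identically. *)
Lemma unit_uniform_diagonal :
  (U \x U)%E [set z : R * R | z.1 = z.2] = 0%E.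
Proof.
rewrite /product_measure1 /= -[RHS](integral0 U setT).
apply: eq_integral => u _.
rewrite (_ : xsection _ u = [set u]); first exact: unit_uniform_set1.
by apply/seteqP; split => v /=; rewrite /xsection/= inE/=.
Qed.

(** Averaging over the two times lowers the exponent from [d] to [d - 1 / H]:
    the kernel is at most [r ^ (- d)] on a set of times of size [r ^ (1 / H)] and is
    integrable away from it, because [H d > 1]. *)
Lemma integral_trunc_power_unit_uniform (H : R) (d : nat) : 0 < H -> 1 < H * d%:R ->
  exists2 C : R, 0 < C & forall r, 0 < r ->
  (\int[(U \x U)%E]_z
     (trunc_power (H * d%:R) d%:R `|z.2 - z.1| r)%:E <=
   (C * r `^ (- (d%:R - H^-1)))%:E)%E.
Proof.
move=> H0 Hd.
set a := H * d%:R in Hd *.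
exists (2 * 2 `^ a / (1 - 2 `^ (1 - a))).
  by rewrite divr_gt0 ?mulr_gt0 ?powR_gt0// subr_gt0 two_powR_lt1.
move=> r r0.
pose rho := r `^ H^-1.
have rho0 : 0 < rho by exact: powR_gt0.
have e1 : rho `^ (- a) = r `^ (- d%:R).
  by rewrite /rho -powRrM; congr (_ `^ _); rewrite /a; field; rewrite gt_eqF.
have e2 : rho `^ (1 - a) = r `^ (- (d%:R - H^-1)).
  by rewrite /rho -powRrM; congr (_ `^ _); rewrite /a; field; rewrite gt_eqF.
have mtr : measurable_fun setT (fun z : R * R => (trunc_power a d%:R `|z.2 - z.1| r)%:E).
  apply/measurable_EFinP; apply: measurable_minr => //.
  apply: (measurableT_comp (measurable_powR (- a))).
  by apply: measurableT_comp => //; exact: measurable_funB.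
have tr0 u : (0 <= (trunc_power a d%:R u r)%:E)%E.
  by rewrite lee_fin /trunc_power le_min !powR_ge0.
rewrite fubini_tonelli1// /fubini_F/=.
apply: (@le_trans _ _ (\int[U]_u
   (2 * 2 `^ a / (1 - 2 `^ (1 - a)) * r `^ (- (d%:R - H^-1)))%:E)%E); last first.
  by rewrite integral_cst// [X in (_ * X)%E](_ : _ = 1%E) ?mule1//; exact: probability_setT.
apply: ge0_le_integral => //.
- by move=> u _; exact: integral_ge0.
- exact: (@measurable_fun_fubini_tonelli_F _ _ (measurableTypeR R) (measurableTypeR R) R U
    (fun z : R * R => (trunc_power a d%:R `|z.2 - z.1| r)%:E) mtr (fun z => tr0 _)).
move=> u _; rewrite -e2.
apply: le_trans (trunc_power_integral Hd u rho0).
have mu : measurable_fun setT (fun s : R => (trunc_power a d%:R `|s - u| r)%:E).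
  exact: (measurableT_comp mtr (measurable_pair1 u)).
rewrite (UE mu (fun _ => tr0 _)); rewrite /trunc_power -e1 in mu *.
apply: ge0_subset_integral => //.
by move=> x _; rewrite lee_fin le_min !powR_ge0.
Qed.

End uniform_times.

(** A probability carried by [E] may be integrated over the whole space, where
    Fubini's theorem applies. *)
Lemma integral_full_set (R : realType) dd (T : measurableType dd) (mu : probability T R)
    (E : set T) (f : T -> \bar R) :
  measurable E -> mu E = 1%E ->
  measurable_fun setT f -> (forall x, 0 <= f x)%E ->
  (\int[mu]_(x in E) f x = \int[mu]_x f x)%E.
Proof.
move=> mE muE mf f0.
rewrite [RHS](@ge0_negligible_integral _ _ _ _ setT (~` E))//; first by rewrite setTD setCK.
  exact: measurableC.
by have := probability_setC mu mE; rewrite muE subee// => <-.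
Qed.

(** * The random measure of approximate multiple points *)

Section occupation.
Context {R : realType} disp (T : measurableType disp) (d k : nat).
Variables (B : R -> T -> 'rV[R]_d) (tau : 'I_k -> R) (U : probability (measurableTypeR R) R).
Hypotheses (cB : forall j w, {within `[0, +oo[, continuous (fun t : R => B t w 0 j)})
  (mB : forall j t, 0 <= t -> measurable_fun setT (fun w => B t w 0 j)).

(** An approximation of the Dirac mass at [x], up to a constant factor, evaluated
    along the path at the time [tau i + u] and restricted to [0 <= u <= 1]. *)
Definition approx_delta (e : R) (i : 'I_k) (x : 'rV[R]_d) (z : T * R) : R :=
  \1_(`[0, 1]%classic : set R) z.2 *
    (e^-1 ^+ d * gauss_kernel e (B (Num.max 0 (tau i + z.2)) z.1 - x)).

(** The smoothed density at [x] of the intersection local time of the [k] pieces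
    of path over the intervals [[tau i, tau i + 1]]. *)
Definition intersection_density (e : R) (z : T * 'rV[R]_d) : \bar R :=
  (\prod_i \int[U]_u (approx_delta e i z.2 (z.1, u))%:E)%E.

Lemma approx_delta_ge0 e i x z : 0 < e -> 0 <= approx_delta e i x z.
Proof.
by move=> e0; rewrite !mulr_ge0 ?exprn_ge0 ?invr_ge0 ?(ltW e0) ?expR_ge0.
Qed.

Lemma measurable_approx_delta e i : measurable_fun setT
  (fun z : (T * borel_rV R d) * R => approx_delta e i z.1.2 (z.1.1, z.2)).
Proof.
apply: measurable_funM => /=.
  by apply: measurableT_comp => //; exact: measurable_indic.
apply: measurable_funM => //; rewrite /gauss_kernel.
apply: measurableT_comp => //; apply: measurableT_comp => //; apply: measurable_funM => //.
apply: measurable_sum => j; apply: measurable_funX.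
have -> : (fun z : (T * borel_rV R d) * R =>
      (B (Num.max 0 (tau i + z.2)) z.1.1 - (z.1.2 : 'rV[R]_d)) 0 j) =
    (fun z => B (Num.max 0 (tau i + z.2)) z.1.1 0 j - (z.1.2 : 'rV[R]_d) 0 j).
  by apply/funext => z; rewrite !mxE.
apply: measurable_funB.
  have m := @measurable_joint _ _ _ (fun t w => B t w 0 j) (@mB j) (@cB j).
  apply: (measurableT_comp m (g := fun z : (T * borel_rV R d) * R => (z.1.1, tau i + z.2))).
  apply: measurable_fun_pair; first by apply: measurableT_comp.
  exact: measurable_funD.
apply: (measurableT_comp (measurable_coordinate j)).
by apply: measurableT_comp.
Qed.

Lemma measurable_approx_delta1 e i (x : 'rV[R]_d) : measurable_fun setT
  (fun z : T * R => approx_delta e i x z).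
Proof.
apply: (measurableT_comp (@measurable_approx_delta e i)
  (g := fun z : T * R => ((z.1, x : borel_rV R d), z.2))).
by apply: measurable_fun_pair => //; exact: measurable_fun_pair.
Qed.

Lemma intersection_density_ge0 e z : 0 < e -> (0 <= intersection_density e z)%E.
Proof.
move=> e0; apply: prode_ge0 => i; apply: integral_ge0 => u _.
by rewrite lee_fin approx_delta_ge0.
Qed.

Lemma measurable_intersection_density e : 0 < e ->
  measurable_fun setT (fun z : T * borel_rV R d => intersection_density e z).
Proof.
move=> e0; apply: emeasurable_prod => i.
apply: (@measurable_fun_fubini_tonelli_F _ _ (T * borel_rV R d)%type (measurableTypeR R) R U
  (fun z => (approx_delta e i z.1.2 (z.1.1, z.2))%:E)).
  by apply/measurable_EFinP; exact: measurable_approx_delta.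
by move=> z; rewrite lee_fin approx_delta_ge0.
Qed.

End occupation.

Section moments.
Context {R : realType} disp (T : measurableType disp) (P : probability T R).
Variables (d k : nat) (H M kappa : R) (B : R -> T -> 'rV[R]_d) (tau : 'I_k -> R).
Hypotheses (H0 : 0 < H) (H1 : H < 1) (M4 : 4 <= M)
  (tauM : forall i, M <= tau i)
  (tau_sep : forall i j : 'I_k, (i < j)%N -> M * (tau i + 1) <= tau j)
  (hB : fbm P H B)
  (dk : 8 * (M `^ (H - 1) + M `^ (- H)) * (2 * k)%:R <= kappa) (k14 : kappa <= 4^-1).
Hypothesis k0 : (0 < k)%N.
Variable U : probability (measurableTypeR R) R.
Hypothesis UE : forall f : R -> \bar R,
  measurable_fun setT f -> (forall x, 0 <= f x)%E ->
  (\int[U]_x f x = \int[lebesgue_measure]_(x in `[0%R, 1%R]) f x)%E.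

Lemma fbm_continuous j w : {within `[0, +oo[, continuous (fun t : R => B t w 0 j)}.
Proof. by have [h _] := hB; have [_ _ _] := h j. Qed.

Lemma fbm_measurable j t : 0 <= t -> measurable_fun setT (fun w => B t w 0 j).
Proof. by move=> t0; have [h _] := hB; exact: (fbm1_measurable (h j)). Qed.

Lemma fbm_gauss_kernel_measurable (e t : R) (x : 'rV[R]_d) : 0 <= t ->
  measurable_fun setT (fun w => gauss_kernel e (B t w - x)).
Proof.
move=> t0; apply: measurableT_comp => //; apply: measurableT_comp => //.
apply: measurable_funM => //; apply: measurable_sum => j; apply: measurable_funX.
have -> : (fun w => (B t w - x) 0 j) = (fun w => B t w 0 j - x 0 j).
  by apply/funext => w; rewrite !mxE.
by apply: measurable_funB => //; exact: fbm_measurable.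
Qed.

Lemma gauss_kernel_itv (e : R) (v : 'rV[R]_d) : 0 <= gauss_kernel e v <= 1.
Proof.
rewrite expR_ge0 -[X in _ <= X]expR0 ler_expR oppr_le0 divr_ge0 ?sumr_ge0//.
  by move=> j _; exact: sqr_ge0.
by rewrite mulr_ge0 ?sqr_ge0.
Qed.

Lemma tau_ge0 i (u : R) : 0 <= u -> Num.max 0 (tau i + u) = tau i + u.
Proof.
move=> u0; apply/max_idPr; rewrite addr_ge0// (le_trans _ (tauM i))// (le_trans _ M4)//.
Qed.

Let c1 : R := (2^-1 * \prod_i (2 * (tau i + 1) `^ H)^-1) ^+ d.

(** The factors [e ^ (- d)] of the approximate Dirac masses compensate exactly the
    smallness of the expected product of bumps in [position_bound]. *)
Lemma density_mean_ge (e K : R) (x : 'rV[R]_d) : 0 < e -> e <= 1 ->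
  (forall j, `|x 0 j| <= K) -> k%:R * (K * M `^ (- H)) ^+ 2 <= kappa ->
  16 * kappa * 2 ^+ k <= 1 ->
  (c1%:E <= \int[P]_w intersection_density B tau U e (w, x))%E.
Proof.
move=> e0 e1 xK hK k16.
have := @iterated_tonelli R _ _ T (measurableTypeR R) P U 'I_k
  (fun i z => (approx_delta B tau e i x z)%:E) (fun i u => (\1_(`[0, 1]%classic : set R) u)%:E)
  _ _ _ _ (fun p q => (q <= p)%E) _ (index_enum 'I_k) (index_enum_uniq _) (fun=> 1%E) c1%:E.
move=> HH.
have c10 : 0 <= c1.
  by rewrite exprn_ge0// mulr_ge0// prodr_ge0// => i _; rewrite invr_ge0 mulr_ge0 ?powR_ge0.
suff : (c1%:E * \prod_(i < k) \int[U]_u (\1_(`[0, 1]%classic : set R) u)%:E <=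
    \int[P]_w (1 * \prod_i \int[U]_u (approx_delta B tau e i x (w, u))%:E))%E.
  under eq_bigr do rewrite integral_unit_uniform_indic//.
  rewrite big1// mule1 => h; apply: le_trans h _.
  by under eq_integral do rewrite mul1e.
apply: HH => //.
- by move=> i z; rewrite lee_fin approx_delta_ge0.
- move=> i; apply/measurable_EFinP; exact: (@measurable_approx_delta1 _ _ _ _ _ _ _ (@fbm_continuous) (@fbm_measurable)).
- by move=> i; apply/measurable_EFinP; exact: measurable_indic.
- by move=> p q p0 q0 mp mq qp; apply: ge0_le_integral => //.
move=> u.
under [leRHS]eq_integral do rewrite mul1e.
have [hu|/existsNP[i hi]] := pselect (forall i, (0 <= (u i : R) <= 1)); last first.
  have ui : \1_(`[0, 1]%classic : set R) (u i) = 0 :> R.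
    by rewrite indicE memNset//= in_itv.
  rewrite (bigD1 i)//= ui mul0e mule0.
  apply: integral_ge0 => w _; apply: prode_ge0 => j.
  by rewrite lee_fin approx_delta_ge0.
have ui i : \1_(`[0, 1]%classic : set R) (u i) = 1 :> R.
  by rewrite indicE mem_set//= in_itv/=; exact: hu.
under eq_bigr do rewrite ui.
rewrite big1// mule1.
pose t i := tau i + u i.
have ht i : tau i <= t i <= tau i + 1.
  by have /andP[h1 h2] := hu i; rewrite /t lerDl h1 lerD2l.
have t0 i : 0 <= t i.
  by have /andP[h _] := ht i; apply: le_trans h; apply: le_trans (tauM i); exact: le_trans M4.
have Ew w : (\prod_i (approx_delta B tau e i x (w, u i))%:E =
    ((e^-1 ^+ d) ^+ k * \prod_i gauss_kernel e (B (t i) w - x))%:E)%E.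
  rewrite prodEFin; congr EFin.
  rewrite -[X in _ ^+ X](card_ord k) -prodr_const -big_split/=; apply: eq_bigr => i _.
  rewrite /approx_delta/= ui mul1r tau_ge0//.
  by case/andP: (hu i).
under eq_integral do rewrite Ew EFinM.
have mg : measurable_fun setT (fun w => \prod_i gauss_kernel e (B (t i) w - x)).
  by apply: measurable_prod => i _; exact: fbm_gauss_kernel_measurable.
have g01 w : 0 <= \prod_i gauss_kernel e (B (t i) w - x) <= 1.
  apply/andP; split; first by apply: prodr_ge0 => i _; case/andP: (gauss_kernel_itv e (B (t i) w - x)).
  by apply: prodr_ile1 => i _; exact: gauss_kernel_itv.
rewrite ge0_integralZl//; last 3 first.
- exact/measurable_EFinP.
- by move=> w _; rewrite lee_fin; case/andP: (g01 w).
- by rewrite lee_fin !exprn_ge0// invr_ge0 ltW.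
rewrite EFin_Rintegral//; last first.
  apply: (@bounded_integrable_prob _ _ _ _ _ 1) => // w.
  by rewrite ger0_norm; case/andP: (g01 w).
rewrite -EFinM lee_fin.
have := position_bound H0 H1 M4 tauM tau_sep hB dk k14 ht e0 e1 xK hK k16.
have ed : 0 < (e^-1 ^+ d) ^+ k by rewrite !exprn_gt0// invr_gt0.
move=> /(ler_wpM2l (ltW ed)); apply: le_trans; rewrite mulrCA -exprMn -exprMn mulVf ?gt_eqF//.
by rewrite !expr1n mulr1.
Qed.

Let ad := approx_delta B tau.

Lemma measurable_ad e i (x : 'rV[R]_d) : measurable_fun setT (fun z : T * R => ad e i x z).
Proof.
exact: (@measurable_approx_delta1 _ _ _ _ _ _ _ (@fbm_continuous) (@fbm_measurable)).
Qed.

Let off (z : R * R) : R := \1_(~` [set z : R * R | z.1 = z.2]) z.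

Lemma measurable_ad_pair e i (x y : 'rV[R]_d) : measurable_fun setT
  (fun z : T * (R * R) => ad e i x (z.1, z.2.1) * ad e i y (z.1, z.2.2)).
Proof.
apply: measurable_funM.
  apply: (measurableT_comp (@measurable_ad e i x) (g := fun z : T * (R * R) => (z.1, z.2.1))).
  by apply: measurable_fun_pair => //; exact: measurableT_comp.
apply: (measurableT_comp (@measurable_ad e i y) (g := fun z : T * (R * R) => (z.1, z.2.2))).
by apply: measurable_fun_pair => //; exact: measurableT_comp.
Qed.

(** The product of two integrals over times is a double integral, from which
    the null set of equal times can be removed. *)
Lemma density_factor_pairE e i (x y : 'rV[R]_d) w : 0 < e ->
  ((\int[U]_u (ad e i x (w, u))%:E) * (\int[U]_u (ad e i y (w, u))%:E) =
   \int[(U \x U)%E]_z (off z * (ad e i x (w, z.1) * ad e i y (w, z.2)))%:E)%E.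
Proof.
move=> e0.
have ad0 x' u : 0 <= ad e i x' (w, u) by exact: approx_delta_ge0.
have mad x' : measurable_fun setT (fun u : R => ad e i x' (w, u)).
  exact: (measurableT_comp (@measurable_ad e i x') (measurable_pair1 w)).
have mead x' : measurable_fun setT (fun u : R => (ad e i x' (w, u))%:E).
  exact/measurable_EFinP.
have ead0 x' u : (0 <= (ad e i x' (w, u))%:E)%E by rewrite lee_fin.
have mm : measurable_fun setT (fun z : R * R => ad e i x (w, z.1) * ad e i y (w, z.2)).
  apply: measurable_funM; first exact: (measurableT_comp (mad x) measurable_fst).
  exact: (measurableT_comp (mad y) measurable_snd).
transitivity (\int[(U \x U)%E]_z (ad e i x (w, z.1) * ad e i y (w, z.2))%:E)%E.
  rewrite fubini_tonelli1//; last 2 first.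
  - exact/measurable_EFinP.
  - by move=> z; rewrite lee_fin mulr_ge0.
  rewrite /fubini_F/=.
  have -> : (\int[U]_u \int[U]_v (ad e i x (w, u) * ad e i y (w, v))%:E =
     \int[U]_u ((ad e i x (w, u))%:E * \int[U]_v (ad e i y (w, v))%:E))%E.
    apply: eq_integral => u _; under eq_integral do rewrite EFinM.
    exact: (ge0_integralZl U measurableT (mead y) (fun v _ => ead0 y v) (ead0 x u)).
  have := ge0_integralZr U measurableT (mead x) (k := (\int[U]_v (ad e i y (w, v))%:E)%E).
  by move=> -> //; apply: integral_ge0.
have mmE : measurable_fun setT (fun z : R * R => (ad e i x (w, z.1) * ad e i y (w, z.2))%:E).
  exact/measurable_EFinP.
have mm0 (z : R * R) : (0 <= (ad e i x (w, z.1) * ad e i y (w, z.2))%:E)%E.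
  by rewrite lee_fin mulr_ge0.
rewrite (@ge0_negligible_integral _ (measurableTypeR R * measurableTypeR R)%type R (U \x U)%E
  setT [set z : R * R | z.1 = z.2] _ (@measurable_diagonal R) measurableT mmE
  (fun z _ => mm0 z) (unit_uniform_diagonal UE)).
rewrite setTD integral_mkcond; apply: eq_integral => z _.
by rewrite patchE /off indicE; case: ifP => _; rewrite ?mul1r ?mul0r.
Qed.

Let f e (x y : 'rV[R]_d) i (z : T * (R * R)) : R :=
  off z.2 * (ad e i x (z.1, z.2.1) * ad e i y (z.1, z.2.2)).

Lemma pair_factor_ge0 e x y i z : 0 < e -> 0 <= f e x y i z.
Proof.
by move=> e0; rewrite /f; apply: mulr_ge0 => //; apply: mulr_ge0; exact: approx_delta_ge0.
Qed.

Lemma measurable_pair_factor e x y i : measurable_fun setT (f e x y i).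
Proof.
apply: measurable_funM; last exact: measurable_ad_pair.
apply: (measurableT_comp _ measurable_snd); apply: measurable_indic.
by apply: measurableC; exact: measurable_diagonal.
Qed.

Let A : R := (4 ^+ k) ^+ d * (3 ^+ d * (1 + (2 * k%:R * d%:R) ^+ d)) ^+ k.

Lemma pair_constant_gt0 : 0 < A.
Proof.
by rewrite mulr_gt0 ?exprn_gt0// mulr_gt0 ?exprn_gt0.
Qed.

Lemma pair_factors_le e (x y : 'rV[R]_d) (u : 'I_k -> R * R) : 0 < e ->
  0 < euclidean_norm (y - x) ->
  (\int[P]_w \prod_i (f e x y i (w, u i))%:E <=
   A%:E * \prod_i (trunc_power (H * d%:R) d%:R `|(u i).2 - (u i).1| (euclidean_norm (y - x)))%:E)%E.
Proof.
move=> e0 r0; have A0 := ltW pair_constant_gt0.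
have tr0 i : (0 <= (trunc_power (H * d%:R) d%:R `|(u i).2 - (u i).1| (euclidean_norm (y - x)))%:E)%E.
  by rewrite lee_fin /trunc_power le_min !powR_ge0.
have in01 (v : R) : (v \in (`[0, 1]%classic : set R)) = (0 <= v <= 1).
  by apply/idP/idP; rewrite inE/= in_itv.
have in_off (z : R * R) : (z \in ~` [set z : R * R | z.1 = z.2]) = (z.2 != z.1).
  by apply/idP/idP; rewrite inE/= eq_sym => /eqP.
have [good|/existsNP[i bad]] := pselect (forall i, [/\ 0 <= (u i).1 <= 1,
    0 <= (u i).2 <= 1 & (u i).2 != (u i).1]); last first.
  rewrite (eq_integral (fun=> 0%E)); last first.
    move=> w _; rewrite (bigD1 i)//=; suff -> : f e x y i (w, u i) = 0 by rewrite mul0e.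
    rewrite /f /off /ad /approx_delta/= !indicE in_off !in01.
    have [h|h] := eqVneq (u i).2 (u i).1; first by rewrite mul0r.
    have [h1|h1] := boolP (0 <= (u i).1 <= 1); last by rewrite !(mul0r, mulr0).
    have [h2|h2] := boolP (0 <= (u i).2 <= 1); last by rewrite !(mul0r, mulr0).
    by case: bad.
  by rewrite integral0 mule_ge0// prode_ge0.
pose t i := tau i + (u i).1; pose s i := tau i + (u i).2.
have ht i : tau i <= t i <= tau i + 1.
  by have [/andP[h1 h2] _ _] := good i; rewrite /t lerDl h1 lerD2l.
have hs i : tau i <= s i <= tau i + 1.
  by have [_ /andP[h1 h2] _] := good i; rewrite /s lerDl h1 lerD2l.
have tau0 i : 0 <= tau i by apply: le_trans (tauM i); exact: le_trans M4.
have t0 i : 0 <= t i by have /andP[h _] := ht i; exact: le_trans h.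
have s0 i : 0 <= s i by have /andP[h _] := hs i; exact: le_trans h.
have st i : s i != t i.
  by have [_ _ h] := good i; rewrite /s /t (inj_eq (addrI _)).
have Ew w : (\prod_i (f e x y i (w, u i))%:E =
    ((e^-1 ^+ d * e^-1 ^+ d) ^+ k * \prod_i (gauss_kernel e (B (t i) w - x) * gauss_kernel e (B (s i) w - y)))%:E)%E.
  rewrite prodEFin; congr EFin.
  rewrite -[X in _ ^+ X](card_ord k) -prodr_const -big_split/=; apply: eq_bigr => i _.
  have [h1 h2 h3] := good i.
  rewrite /f /ad /off /approx_delta/= !indicE in_off !in01 h1 h2 h3.
  rewrite (max_idPr (t0 i)) (max_idPr (s0 i)) !mul1r.
  by rewrite /t /s; ring.
under eq_integral do rewrite Ew EFinM.
pose g w := \prod_i (gauss_kernel e (B (t i) w - x) * gauss_kernel e (B (s i) w - y)).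
have mg : measurable_fun setT g.
  by apply: measurable_prod => i _; apply: measurable_funM; exact: fbm_gauss_kernel_measurable.
have g01 w : 0 <= g w <= 1.
  have h i : 0 <= gauss_kernel e (B (t i) w - x) * gauss_kernel e (B (s i) w - y) <= 1.
    have /andP[a1 a2] := gauss_kernel_itv e (B (t i) w - x).
    have /andP[b1 b2] := gauss_kernel_itv e (B (s i) w - y).
    by rewrite mulr_ge0//= mulr_ile1.
  apply/andP; split; first by apply: prodr_ge0 => i _; case/andP: (h i).
  by apply: prodr_ile1 => i _; exact: h.
have ek : 0 < (e^-1 ^+ d * e^-1 ^+ d) ^+ k.
  by rewrite exprn_gt0// mulr_gt0// exprn_gt0// invr_gt0.
rewrite ge0_integralZl//; last 3 first.
- exact/measurable_EFinP.
- by move=> w _; rewrite lee_fin; case/andP: (g01 w).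
- by rewrite lee_fin ltW.
rewrite EFin_Rintegral//; last first.
  apply: (@bounded_integrable_prob _ _ _ _ _ 1) => // w.
  by rewrite ger0_norm; case/andP: (g01 w).
rewrite prodEFin -!EFinM lee_fin.
have := pair_bound H0 H1 M4 tauM tau_sep hB dk k14 k0 ht hs st e0 r0.
move=> /(ler_wpM2l (ltW ek)) h; apply: le_trans h _.
rewrite -/A mulrCA ler_wpM2l// mulrA -exprMn mulrACA -exprMn mulVf ?gt_eqF// expr1n mul1r expr1n mul1r.
rewrite le_eqVlt; apply/orP; left; apply/eqP; apply: eq_bigr => i _.
by congr (trunc_power _ _ `|_| _); rewrite /s /t; ring.
Qed.

Lemma lee_prode (J : Type) (s : seq J) (a b : J -> \bar R) :
  (forall j, 0 <= a j)%E -> (forall j, a j <= b j)%E ->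
  (\prod_(j <- s) a j <= \prod_(j <- s) b j)%E.
Proof.
move=> a0 ab; elim: s => [|j s ih]; first by rewrite !big_nil.
by rewrite !big_cons; apply: lee_pmul => //; exact: prode_ge0.
Qed.

(** Each of the [k] blocks of times contributes one factor
    [r ^ (- (d - 1 / H))]; this produces the kernel of the capacity
    condition. At [r = 0] the kernel is infinite. *)
Lemma density_pair_le : 1 < H * d%:R -> exists2 C : R, 0 < C &
  forall (e : R) (x y : 'rV[R]_d), 0 < e ->
  (\int[P]_w (intersection_density B tau U e (w, y) * intersection_density B tau U e (w, x)) <=
   C%:E * riesz_kernel (k%:R * (d%:R - H^-1)) (euclidean_norm (y - x)))%E.
Proof.
move=> Hd; have [C0 C00 hC0] := integral_trunc_power_unit_uniform UE H0 Hd.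
have A0 := pair_constant_gt0.
exists (A * C0 ^+ k) => [|e x y e0]; first by rewrite mulr_gt0// exprn_gt0.
have C1 : 0 < A * C0 ^+ k by rewrite mulr_gt0// exprn_gt0.
rewrite /riesz_kernel; set r := euclidean_norm _.
have [r0|r0] := eqVneq r 0; first by rewrite gt0_muley ?lte_fin// leey.
have {}r0 : 0 < r by rewrite lt_neqAle eq_sym r0 sqrtr_ge0.
pose V := (U \x U)%E.
pose h (i : 'I_k) (z : R * R) : \bar R := (trunc_power (H * d%:R) d%:R `|z.2 - z.1| r)%:E.
have h0 i z : (0 <= h i z)%E by rewrite lee_fin /trunc_power le_min !powR_ge0.
have mh i : measurable_fun setT (h i).
  apply/measurable_EFinP; apply: measurable_minr => //.
  apply: (measurableT_comp (measurable_powR _)).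
  by apply: measurableT_comp => //; exact: measurable_funB.
have := @iterated_tonelli R _ _ T (measurableTypeR R * measurableTypeR R)%type P V 'I_k
  (fun i z => (f e x y i z)%:E) h
  _ _ _ _ (fun p q => (p <= q)%E) _ (index_enum 'I_k) (index_enum_uniq _) (fun=> 1%E) A%:E.
move=> HH.
suff : (\int[P]_w (1 * \prod_i \int[V]_z (f e x y i (w, z))%:E) <=
    A%:E * \prod_i \int[V]_z h i z)%E.
  under eq_integral do rewrite mul1e.
  move=> hle; apply: le_trans (le_trans hle _).
    rewrite le_eqVlt; apply/orP; left; apply/eqP; apply: eq_integral => w _.
    rewrite /intersection_density -big_split/=; apply: eq_bigr => i _.
    by rewrite muleC; exact: density_factor_pairE.
  have hs : (\prod_(i < k) \int[V]_z h i z <= \prod_(i < k) (C0 * r `^ (- (d%:R - H^-1)))%:E)%E.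
    apply: lee_prode => i; first exact: integral_ge0.
    exact: hC0.
  apply: le_trans (lee_wpmul2l _ hs) _; first by rewrite lee_fin ltW.
  rewrite prodEFin prodr_const card_ord -!EFinM lee_fin exprMn mulrA.
  have -> : - (k%:R * (d%:R - H^-1)) = - (d%:R - H^-1) * k%:R by ring.
  by rewrite powRrM powR_mulrn ?powR_ge0.
apply: HH => //.
- by move=> i z; rewrite lee_fin pair_factor_ge0.
- by move=> i; apply/measurable_EFinP; exact: measurable_pair_factor.
- by move=> p q p0 q0 mp mq qp; apply: ge0_le_integral => //.
- by rewrite lee_fin ltW.
by move=> u; under eq_integral do rewrite mul1e; exact: pair_factors_le.
Qed.

End moments.

(** * The second moment method *)

Section random_mass.
Context {R : realType} d1 d2 (T : measurableType d1) (S : measurableType d2).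
Variables (P : probability T R) (mu : probability S R) (E : set S) (G : T * S -> \bar R).
Hypotheses (mE : measurable E) (muE : mu E = 1%E)
  (G0 : forall z, (0 <= G z)%E) (mG : measurable_fun setT G).

Let mG1 w : measurable_fun setT (fun x => G (w, x)).
Proof. exact: (measurableT_comp mG (measurable_pair1 w)). Qed.

Lemma measurable_random_mass : measurable_fun setT (fun w => \int[mu]_(x in E) G (w, x))%E.
Proof.
under eq_fun do rewrite (integral_full_set mE muE)//.
exact: (measurable_fun_fubini_tonelli_F G mG G0).
Qed.

Lemma random_mass_mean_ge (c : \bar R) : (0 <= c)%E ->
  (forall x, E x -> (c <= \int[P]_w G (w, x))%E) ->
  (c <= \int[P]_w \int[mu]_(x in E) G (w, x))%E.
Proof.
move=> c0 hc.
have mF := measurable_fun_fubini_tonelli_G (m1 := P) G mG G0.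
under eq_integral do rewrite (integral_full_set mE muE)//.
rewrite fubini_tonelli// -(integral_full_set mE muE)//; last first.
  by move=> x; exact: integral_ge0.
apply: (@le_trans _ _ (\int[mu]_(x in E) c)%E).
  by rewrite integral_cst// [X in (_ * X)%E](_ : _ = 1%E) ?mule1.
apply: ge0_le_integral => //.
by apply: (measurable_funTS (f := fubini_G P G)).
Qed.

(** Expanding the square of the mass and exchanging the integrals produces the
    energy of [mu] for the kernel [phi]. *)
Lemma random_mass_square_le (C : \bar R) (phi : S -> S -> \bar R) : (0 <= C)%E ->
  (forall x y, 0 <= phi x y)%E ->
  measurable_fun setT (fun z : S * S => phi z.1 z.2) ->
  (forall x y, (\int[P]_w (G (w, x) * G (w, y)) <= C * phi x y)%E) ->
  (\int[P]_w ((\int[mu]_(x in E) G (w, x)) * (\int[mu]_(x in E) G (w, x))) <=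
   C * \int[mu]_(x in E) \int[mu]_(y in E) phi x y)%E.
Proof.
move=> C0 phi0 mphi hC.
have mphi1 x : measurable_fun setT (phi x).
  exact: (measurableT_comp mphi (measurable_pair1 x)).
have iphi0 x : (0 <= \int[mu]_y phi x y)%E by exact: integral_ge0.
have miphi : measurable_fun setT (fun x => \int[mu]_y phi x y)%E.
  exact: (measurable_fun_fubini_tonelli_F (fun z : S * S => phi z.1 z.2)).
under [in X in (_ <= _ * X)%E]eq_integral do rewrite (integral_full_set mE muE)//.
rewrite [in X in (_ <= _ * X)%E](integral_full_set mE muE)//.
under eq_integral do rewrite !(integral_full_set mE muE)//.
have J0 w : (0 <= \int[mu]_x G (w, x))%E by exact: integral_ge0.
pose K (z : (T * S) * S) := (G z.1 * G (z.1.1, z.2))%E.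
have K0 z : (0 <= K z)%E by rewrite mule_ge0.
have mK : measurable_fun setT K.
  apply: emeasurable_funM; first exact: measurableT_comp.
  apply: (measurableT_comp mG (g := fun z : (T * S) * S => (z.1.1, z.2))).
  by apply: measurable_fun_pair => //; exact: measurableT_comp.
have mF := measurable_fun_fubini_tonelli_F (m2 := mu) K mK K0.
have E1 : (\int[P]_w ((\int[mu]_x G (w, x)) * (\int[mu]_x G (w, x))) =
    \int[P]_w \int[mu]_x \int[mu]_y K ((w, x), y))%E.
  apply: eq_integral => w _.
  rewrite -ge0_integralZr//; apply: eq_integral => x _.
  by rewrite -ge0_integralZl.
rewrite E1 (fubini_tonelli (fun z => \int[mu]_y K (z, y))%E)//; last first.
  by move=> z; exact: integral_ge0.
rewrite -ge0_integralZl//; apply: ge0_le_integral => //.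
- by move=> x _; apply: integral_ge0 => w _; exact: integral_ge0.
- apply: (measurable_fun_fubini_tonelli_G (m1 := P) (fun z => \int[mu]_y K (z, y))%E) => //.
  by move=> z; exact: integral_ge0.
- exact: measurable_funeM.
move=> x _; rewrite -ge0_integralZl//.
have mKx : measurable_fun setT (fun z : T * S => K ((z.1, x), z.2)).
  apply: (measurableT_comp mK (g := fun z : T * S => ((z.1, x), z.2))).
  by apply: measurable_fun_pair => //; exact: measurable_fun_pair.
rewrite (fubini_tonelli (fun z => K ((z.1, x), z.2)))//.
apply: ge0_le_integral => //.
- by move=> y _; apply: integral_ge0.
- exact: (measurable_fun_fubini_tonelli_G (m1 := P) (fun z => K ((z.1, x), z.2))).
- exact: measurable_funeM.
- by move=> y _; exact: hC.
Qed.

End random_mass.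

(** Uniformly integrable variables whose means stay above [c > 0] cannot tend to
    0 almost surely: by [J <= min (J, L) + J ^ 2 / L], at least [c / 2] of the mean
    survives truncation at the level [L], and the truncated variables are
    subject to dominated convergence. *)
Lemma bounded_second_moment_not_cvg0 (R : realType) d (T : measurableType d)
    (P : probability T R) (J : nat -> T -> \bar R) (c D : R) :
  0 < c -> 0 < D -> (forall n w, (0 <= J n w)%E) ->
  (forall n, measurable_fun setT (J n)) ->
  (forall n, (c%:E <= \int[P]_w J n w)%E) ->
  (forall n, (\int[P]_w (J n w * J n w) <= D%:E)%E) ->
  ~ {ae P, forall w, J n w @[n --> \oo] --> 0%E}.
Proof.
move=> c0 D0 J0 mJ cJ DJ Jcvg.
(* With this level the term [J ^ 2 / L] costs at most half of [c]. *)
pose L := 2 * D / c; have L0 : 0 < L by rewrite divr_gt0// mulr_gt0.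
pose m n w := mine (J n w) L%:E.
have m0 n w : (0 <= m n w)%E by rewrite le_min J0 lee_fin ltW.
have mm n : measurable_fun setT (m n) by exact: measurable_mine.
have h n w : (J n w <= m n w + L^-1%:E * (J n w * J n w))%E.
  rewrite /m; have [JL|JL] := leP (J n w) L%:E.
    by rewrite leeDl// !mule_ge0// lee_fin invr_ge0 ltW.
  rewrite lee_paddl ?lee_fin ?(ltW L0)// muleA.
  rewrite -[leLHS]mul1e lee_wpmul2r// lee_pdivlMl// mule1 ltW//.
have h2 n : ((c / 2)%:E <= \int[P]_w m n w)%E.
  have : (c%:E <= \int[P]_w m n w + (c / 2)%:E)%E.
    apply: le_trans (cJ n) _.
    have mJJ : measurable_fun setT (fun w => J n w * J n w)%E by exact: emeasurable_funM.
    apply: (@le_trans _ _ (\int[P]_w (m n w + L^-1%:E * (J n w * J n w)))%E).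
      apply: ge0_le_integral => //.
      by apply: emeasurable_funD => //; exact: measurable_funeM.
    rewrite ge0_integralD//; last 2 first.
    - by move=> w _; rewrite !mule_ge0// lee_fin invr_ge0 ltW.
    - exact: measurable_funeM.
    rewrite leeD2l// ge0_integralZl//; last 2 first.
    - by move=> w _; rewrite mule_ge0.
    - by rewrite lee_fin invr_ge0 ltW.
    apply: le_trans (lee_wpmul2l _ (DJ n)) _; first by rewrite lee_fin invr_ge0 ltW.
    rewrite -EFinM lee_fin /L le_eqVlt; apply/orP; left; apply/eqP; field.
    by rewrite !gt_eqF.
  by rewrite -leeBlDr// -EFinB; apply: le_trans; rewrite lee_fin; lra.
have := @dominated_convergence _ _ _ P setT measurableT m (cst 0%E) (cst L%:E) mm
  (measurable_cst _) _ _ _.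
move=> DC.
suff : (\int[P]_w m n w @[n --> \oo] --> \int[P]_w (cst 0%E w))%E.
  rewrite integral0 => mcvg.
  have : ((c / 2)%:E <= limn (fun n => \int[P]_w m n w))%E.
    by apply: lime_ge; [apply/cvg_ex; exists 0%E|exact: nearW].
  by rewrite (cvg_lim _ mcvg)// lee_fin leNgt divr_gt0.
have [|||_ _ //] := DC.
- apply: filterS Jcvg => w Jw _.
  apply: (squeeze_cvge _ (cvg_cst 0%E) Jw); apply: nearW => n.
  by rewrite m0/= ge_min lexx.
- exact: finite_measure_integrable_cst.
- by apply: aeW => w n _; rewrite gee0_abs//= ge_min lexx orbT.
Qed.

(** * Vanishing of the mass off the multiple points *)

Lemma power_gauss_cvg0 (R : realType) (m : nat) (delta : R) : 0 < delta ->
  n.+1%:R ^+ m * expR (- (delta ^+ 2 / (2 * n.+1%:R^-1 ^+ 2))) @[n --> \oo] --> 0.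
Proof.
move=> d0.
pose K : R := m.+1%:R ^+ m.+1 * (2 / delta ^+ 2) ^+ m.+1.
have bnd (n : nat) : 0 <= n.+1%:R ^+ m * expR (- (delta ^+ 2 / (2 * n.+1%:R^-1 ^+ 2))) <= K * harmonic n.
  have n0 : (0 : R) < n.+1%:R by rewrite ltr0n.
  rewrite mulr_ge0 ?exprn_ge0 ?expR_ge0//=.
  set z := _ / _; have z0 : 0 < z by rewrite divr_gt0 ?exprn_gt0// mulr_gt0// exprn_gt0// invr_gt0.
  have zE : z = n.+1%:R ^+ 2 / (2 / delta ^+ 2).
    rewrite /z; move: (n.+1%:R : R) n0 => N N0; field.
    by rewrite (gt_eqF d0) gt_eqF.
  have := exprn_le_expR m.+1 (ltW z0).
  rewrite zE expr_div_n ler_pdivrMr ?exprn_gt0 ?divr_gt0 ?exprn_gt0//; rewrite -zE => h.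
  rewrite expRN ler_pdivrMr ?expR_gt0// /harmonic/= mulrAC ler_pdivlMr//.
  rewrite -exprSr; apply: (@le_trans _ _ ((n.+1%:R ^+ 2) ^+ m.+1)).
    by rewrite -exprM ler_weXn2l ?ler1n// leq_pmull.
  by apply: le_trans h _; rewrite /K mulrAC.
apply: (@squeeze_cvgr _ _ _ _ (cst 0) (fun n => K * harmonic n)).
- by apply: nearW => n; exact: bnd.
- exact: cvg_cst.
- rewrite -(mulr0 K); apply: cvgMr; exact: cvg_harmonic.
Qed.

Section vanishing.
Context {R : realType} disp (T : measurableType disp) (d k : nat).
Variables (B : R -> T -> 'rV[R]_d) (tau : 'I_k -> R) (U : probability (measurableTypeR R) R).
Hypotheses (cB : forall j w, {within `[0, +oo[, continuous (fun t : R => B t w 0 j)})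
  (mB : forall j t, 0 <= t -> measurable_fun setT (fun w => B t w 0 j))
  (tau0 : forall i, 0 <= tau i).

Lemma gauss_kernel_le_far (e delta : R) (x v : 'rV[R]_d) : 0 < e -> 0 < delta ->
  ~ ball x delta v -> gauss_kernel e (v - x) <= expR (- (delta ^+ 2 / (2 * e ^+ 2))).
Proof.
move=> e0 d0 far.
have [j hj] : exists j, delta <= `|v 0 j - x 0 j|.
  apply: contrapT => h; apply: far; split => // i j; rewrite [i]ord1 /ball/= distrC ltNge.
  by apply/negP => h2; apply: h; exists j.
rewrite ler_expR lerN2 ler_wpM2r ?invr_ge0 ?mulr_ge0 ?sqr_ge0 ?(ltW e0)//.
rewrite (bigD1 j)//= !mxE; apply: ler_wpDr; first by apply: sumr_ge0 => i _; exact: sqr_ge0.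
by rewrite -[leRHS]real_normK ?num_real// lerXn2r ?nnegrE ?(ltW d0).
Qed.

(** One piece of path that stays at distance [delta] from [x] makes the whole
    product small. *)
Lemma intersection_density_le_far (e delta : R) (w : T) (x : 'rV[R]_d) i :
  0 < e -> 0 < delta ->
  (forall t, tau i <= t <= tau i + 1 -> ~ ball x delta (B (Num.max 0 t) w)) ->
  (intersection_density B tau U e (w, x) <=
   ((e^-1 ^+ d) ^+ k * expR (- (delta ^+ 2 / (2 * e ^+ 2))))%:E)%E.
Proof.
move=> e0 d0 far; set b := expR _.
have e10 : 0 <= e^-1 ^+ d by rewrite exprn_ge0// invr_ge0 ltW.
pose a (j : 'I_k) := e^-1 ^+ d * (if j == i then b else 1).
have a0 j : 0 <= a j by rewrite /a mulr_ge0//; case: ifP => // _; exact: expR_ge0.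
have ada j u : approx_delta B tau e j x (w, u) <= a j.
  rewrite /approx_delta/= indicE.
  have [hu|hu] := boolP (u \in _); last by rewrite mul0r.
  rewrite mul1r ler_wpM2l//; move: hu; rewrite inE/= in_itv/= => /andP[u0 u1].
  case: eqVneq => [ji|_].
    apply: gauss_kernel_le_far => //; apply: far.
    by rewrite ji lerDl u0 lerD2l.
  rewrite -[leRHS]expR0 ler_expR oppr_le0 divr_ge0 ?mulr_ge0 ?sqr_ge0 ?(ltW e0)//.
  by apply: sumr_ge0 => j' _; exact: sqr_ge0.
apply: (@le_trans _ _ (\prod_j (a j)%:E)%E).
  apply: lee_prode => j.
    by apply: integral_ge0 => u _; rewrite lee_fin approx_delta_ge0.
  apply: (@le_trans _ _ (\int[U]_u (a j)%:E)%E).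
    apply: ge0_le_integral => //.
    - by move=> u _; rewrite lee_fin approx_delta_ge0.
    - apply/measurable_EFinP.
      exact: (measurableT_comp (@measurable_approx_delta1 _ _ _ _ _ _ tau cB mB e j x) (measurable_pair1 w)).
    - by move=> u _; rewrite lee_fin.
  by rewrite integral_cst// [X in (_ * X)%E](_ : _ = 1%E) ?mule1//; exact: probability_setT.
rewrite prodEFin lee_fin /a big_split/= prodr_const card_ord -big_mkcond/= big_pred1_eq.
by [].
Qed.

(** If the [k] pieces of path have no common point in [E], then at every point of
    [E] one of the pieces is at distance [delta] at least, with [delta] uniform by
    compactness. *)
Lemma random_mass_cvg0 (mu : probability (borel_rV R d) R) (E : set 'rV[R]_d) (w : T) :
  compact E -> mu E = 1%E ->
  (forall x, E x -> exists i, forall t, tau i <= t <= tau i + 1 -> B t w <> x) ->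
  (\int[mu]_(x in E) intersection_density B tau U n.+1%:R^-1 (w, x) @[n --> \oo] --> 0)%E.
Proof.
move=> cE muE nohit; have mE := measurable_compact_rV cE.
have [delta d0 hd] : exists2 delta, 0 < delta & forall x, E x -> exists i, forall t,
    tau i <= t <= tau i + 1 -> ~ ball x delta (B (Num.max 0 t) w).
  apply: (@compact_avoids_paths R d (fun t => B (Num.max 0 t) w)) => //.
    by move=> j; exact: (@continuous_clamp R disp T (fun t w => B t w 0 j) (@cB j) w).
  move=> x Ex; have [i hi] := nohit x Ex; exists i => t /andP[t1 t2].
  by rewrite (max_idPr (le_trans (tau0 i) t1)); apply: hi; rewrite t1.
have e0 n : 0 < n.+1%:R^-1 :> R by rewrite invr_gt0.
apply: (@squeeze_cvge _ _ _ _ (cst 0%E) _ (fun n : nat =>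
   ((n.+1%:R ^+ (d * k) * expR (- (delta ^+ 2 / (2 * n.+1%:R^-1 ^+ 2)))) : R)%:E)).
- apply: nearW => n; apply/andP; split.
    by apply: integral_ge0 => x _; exact: intersection_density_ge0.
  set b := (X in (_ <= X%:E)%E).
  apply: (@le_trans _ _ (\int[mu]_(x in E) b%:E)%E).
    apply: ge0_le_integral => //.
    - by move=> x _; exact: intersection_density_ge0.
    - apply: (measurable_funTS (f := fun x : borel_rV R d => intersection_density B tau U n.+1%:R^-1 (w, x))).
      exact: (measurableT_comp (@measurable_intersection_density _ _ _ _ _ _ tau U cB mB _ (e0 n)) (measurable_pair1 w)).
    - move=> x Ex; have [i hi] := hd x Ex.
      by have := intersection_density_le_far (e0 n) d0 hi; rewrite invrK -exprM.
  by rewrite integral_cst// [X in (_ * X)%E](_ : _ = 1%E) ?mule1.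
- exact: cvg_cst.
- by apply: cvg_EFin; [exact: nearW|exact: power_gauss_cvg0].
Qed.

End vanishing.

(** * Choice of the time scales and conclusion *)

Lemma powR_small (R : realType) (g c : R) : 0 < g -> 0 < c ->
  forall M, c `^ (- g^-1) <= M -> M `^ (- g) <= c.
Proof.
move=> g0 c0 M cM.
have M0 : 0 < M by apply: lt_le_trans cM; exact: powR_gt0.
have -> : c = (c `^ (- g^-1)) `^ (- g).
  by rewrite -powRrM mulrNN mulVf ?gt_eqF// powRr1// ltW.
rewrite ![_ `^ (- g)]powRN lef_pV2 ?posrE ?powR_gt0//.
by apply: ge0_ler_powR; rewrite ?nnegrE ?powR_ge0 ?(ltW g0) ?(ltW M0).
Qed.

(** All the smallness conditions are powers of [1 / M], and the blocks of times
    start at the points [(2 M) ^ (i + 1)]. *)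
Lemma separated_scales (R : realType) (H K : R) (k : nat) : 0 < H -> H < 1 ->
  exists (M kappa : R) (tau : 'I_k -> R),
    [/\ 4 <= M, forall i, M <= tau i,
        forall i j : 'I_k, (i < j)%N -> M * (tau i + 1) <= tau j,
        8 * (M `^ (H - 1) + M `^ (- H)) * (2 * k)%:R <= kappa &
        [/\ kappa <= 4^-1, k%:R * (K * M `^ (- H)) ^+ 2 <= kappa & 16 * kappa * 2 ^+ k <= 1]].
Proof.
move=> H0 H1.
have p1 : (1 : R) <= 2 ^+ k by rewrite exprn_ege1// ler1n.
pose kappa : R := (16 * 2 ^+ k)^-1.
have k1 : 16 * kappa * 2 ^+ k = 1.
  by rewrite /kappa; field; rewrite expf_neq0.
have kap0 : 0 < kappa by rewrite invr_gt0 mulr_gt0// exprn_gt0.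
have kap1 : kappa <= 16^-1.
  by rewrite lef_pV2 ?posrE ?mulr_gt0 ?exprn_gt0// ler_peMr.
pose q : R := 32 * k%:R + k%:R * K ^+ 2 + 1.
have kr0 : (0 : R) <= k%:R by [].
have kK : 0 <= k%:R * K ^+ 2 by rewrite mulr_ge0 ?sqr_ge0.
have q1 : 1 <= q by rewrite /q; lra.
pose c : R := kappa / q.
have c0 : 0 < c by rewrite divr_gt0//; lra.
have cq : c * q = kappa by rewrite divfK// gt_eqF//; lra.
have c1 : c <= 1.
  by rewrite ler_pdivrMr; [lra|lra].
pose M : R := Num.max 4 (Num.max (c `^ (- (1 - H)^-1)) (c `^ (- H^-1))).
have M4 : 4 <= M by rewrite le_max lexx.
have h1 : M `^ (H - 1) <= c.
  have -> : H - 1 = - (1 - H) by ring.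
  by apply: powR_small => //; rewrite ?subr_gt0// !le_max lexx orbT.
have h2 : M `^ (- H) <= c by apply: powR_small => //; rewrite !le_max lexx !orbT.
have h20 : 0 <= M `^ (- H) by exact: powR_ge0.
pose tau (i : 'I_k) : R := (2 * M) ^+ i.+1.
have M1 : 1 <= 2 * M by lra.
exists M, kappa, tau; split => //.
- move=> i; rewrite /tau exprS; apply: (@le_trans _ _ (2 * M)); first by lra.
  by rewrite ler_peMr ?exprn_ege1//; lra.
- move=> i j ij; apply: (@le_trans _ _ ((2 * M) ^+ i.+2)).
    rewrite exprS -/(tau i).
    have : 1 <= tau i by rewrite exprn_ege1.
    move: (tau i) => t t1; nra.
  by rewrite /tau ler_weXn2l.
- rewrite natrM.
  apply: (@le_trans _ _ (8 * (c + c) * (2 * k%:R))).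
    by rewrite ler_wpM2r ?mulr_ge0// ler_wpM2l// lerD.
  rewrite -cq; have := mulr_ge0 (ltW c0) kK; have := mulr_ge0 (ltW c0) kr0.
  rewrite /q; move: (K ^+ 2) => K2; nra.
split; last by rewrite k1.
- by apply: le_trans kap1 _; rewrite lef_pV2 ?posrE// ler_nat.
- rewrite exprMn mulrA; apply: (@le_trans _ _ (k%:R * K ^+ 2 * c)).
    rewrite ler_wpM2l//; apply: (le_trans _ h2).
    by rewrite expr2 ler_piMr// (le_trans h2).
  rewrite -cq mulrC ler_wpM2l ?(ltW c0)// /q; lra.
Qed.

Theorem theorem3p1 (R : realType) (disp : measure_display)
    (Omega : measurableType disp) (P : probability Omega R)
    (k d : nat) (H : R) (B : R -> Omega -> 'rV[R]_d) (E : set 'rV[R]_d)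
    (k_gt0 : (0 < k)%N) (H_gt0 : 0 < H) (H_lt1 : H < 1)
    (Hd_gt1 : 1 < H * d%:R) (B_fbm : fbm P H B)
    (E_neq0 : E !=set0) (E_compact : compact E)
    (E_capacity : (0%:E < capacity (riesz_kernel (k%:R * (d%:R - H^-1))) E)%E) :
  measurable [set w | exists2 x, E x & multiple_point k B w x] /\
  (0%:E < P [set w | exists2 x, E x & multiple_point k B w x])%E.
Proof.
have cB := fbm_continuous B_fbm; have mB := fbm_measurable B_fbm.
have mEv := @measurable_multiple_point R disp Omega d k B cB (fun t j => mB j t) E E_compact.
split; first exact: mEv.
set phi := riesz_kernel _ in E_capacity.
have [mu muE mufin] : exists2 mu : probability (borel_rV R d) R, mu E = 1%E & (energy phi E mu < +oo)%E.
  have : (ereal_inf [set energy phi E mu | mu in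
      [set mu : probability (borel_rV R d) R | mu E = 1%E]] < +oo)%E.
    rewrite ltey; apply: contraTneq E_capacity; rewrite /capacity => ->.
    by rewrite invey ltxx.
  by move=> /ereal_inf_lt[_ [mu muE <-]] h; exists mu.
have mE := measurable_compact_rV E_compact.
rewrite lt_neqAle measure_ge0 andbT eq_sym; apply/negP => /eqP Pev0.
have [K hK] := compact_bounded_coordinates E_compact.
have [M [kappa [tau [M4 tauM tau_sep dk [k14 hKk k16]]]]] := @separated_scales R H K k H_gt0 H_lt1.
have tau0 i : 0 <= tau i by apply: le_trans (tauM i); exact: le_trans M4.
pose U : probability (measurableTypeR R) R := uniform_prob (@ltr01 R).
have UE := @ge0_integral_uniform01 R.
have [C C0 hC] := density_pair_le H_gt0 H_lt1 M4 tauM tau_sep B_fbm dk k14 k_gt0 (U := U) UE Hd_gt1.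
pose e (n : nat) : R := n.+1%:R^-1.
have e0 n : 0 < e n by rewrite invr_gt0.
have e1 n : e n <= 1 by rewrite invf_le1// ler1n.
pose G n (z : Omega * borel_rV R d) := intersection_density B tau U (e n) z.
have G0 n z : (0 <= G n z)%E by exact: intersection_density_ge0.
have mG n : measurable_fun setT (G n) by exact: measurable_intersection_density.
pose J n w := (\int[mu]_(x in E) G n (w, x))%E.
have phi0 (x y : 'rV[R]_d) : (0 <= phi (euclidean_norm (x - y)))%E.
  by rewrite /phi /riesz_kernel; case: ifP => // _; rewrite lee_fin powR_ge0.
have mphi : measurable_fun setT (fun z : borel_rV R d * borel_rV R d =>
    phi (euclidean_norm ((z.1 : 'rV[R]_d) - (z.2 : 'rV[R]_d)))).
  apply: (measurableT_comp (@measurable_riesz_kernel R _)).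
  exact: measurable_euclidean_norm_sub.
have en0 : (0 <= energy phi E mu)%E.
  by apply: integral_ge0 => x _; apply: integral_ge0 => y _.
have enfin : energy phi E mu \is a fin_num by rewrite ge0_fin_numE.
pose c := (2^-1 * \prod_i (2 * (tau i + 1) `^ H)^-1) ^+ d.
have c0 : 0 < c.
  rewrite exprn_gt0// mulr_gt0// prodr_gt0// => i _.
  by rewrite invr_gt0 mulr_gt0// powR_gt0// ltr_wpDl.
pose D := C * fine (energy phi E mu) + 1.
have D0 : 0 < D by rewrite ltr_wpDl// mulr_ge0 ?(ltW C0)// fine_ge0.
apply: (@bounded_second_moment_not_cvg0 R disp Omega P J c D c0 D0).
- by move=> n w; exact: integral_ge0.
- by move=> n; exact: measurable_random_mass.
- move=> n; apply: random_mass_mean_ge => //; first by rewrite lee_fin ltW.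
  move=> x Ex.
  exact: (density_mean_ge H_gt0 H_lt1 M4 tauM tau_sep B_fbm dk k14 UE (e0 n) (e1 n) (hK x Ex) hKk k16).
- move=> n; apply: (@le_trans _ _ (C%:E * energy phi E mu)%E).
    apply: (@random_mass_square_le _ _ _ _ _ _ _ _ _ _ _ _ _ _
      (fun x y : borel_rV R d => phi (euclidean_norm ((x : 'rV[R]_d) - (y : 'rV[R]_d))))) => //.
      by rewrite lee_fin ltW.
    by move=> x y; exact: hC.
  by rewrite -(fineK enfin) -EFinM lee_fin /D lerDl.
exists [set w | exists2 x, E x & multiple_point k B w x]; split => //.
move=> w /= nw; apply: contrapT => nev; apply: nw.
apply: (@random_mass_cvg0 R disp Omega d k B tau U cB mB tau0 mu E w E_compact muE) => x Ex.
apply: contrapT => nh; apply: nev; exists x => //.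
have /choice[t ht] : forall i, exists t, tau i <= t <= tau i + 1 /\ B t w = x.
  move=> i; apply: contrapT => h; apply: nh; exists i => t tt Bt; apply: h.
  by exists t.
exists t; split.
- by move=> i; have [/andP[h _] _] := ht i; exact: le_trans h.
- move=> i j ij; have [/andP[_ h1] _] := ht i; have [/andP[h2 _] _] := ht j.
  have h3 := tau_sep i j ij; have h4 := tau0 i.
  apply: (le_lt_trans h1); apply: (lt_le_trans _ h2); apply: (lt_le_trans _ h3).
  move: (tau i) h4 => u u0; nra.
- by move=> i; have [_] := ht i.
Qed.
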